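(* Let $r>1$ and suppose $\|\phi_j\|_{W^{1,\infty}(D)}\le C_{\rm KL}\,j^{-r}$ for all $j\in\mathbb{N}$. Assume $h_\ell\simeq 2^{-\ell}$ and $\#\mathcal{T}_\ell\simeq 2^{d\ell}$. Choose $m_j:=\lceil 4j\rceil$ and $s_\nu:=\lceil 2^{2\nu/(r-1)}\rceil$. For $N\in\{0,1,2,\dots\}$ let $$G_N:=\sum_{\ell,\nu\ge 0,\ \ell+\nu\le N}Q^{(\nu)}_{m_{N-\ell-\nu}}\big(G(D_\ell^\nu)\big),\qquad E_N:=\sqrt{\mathbb{E}_{\rm MC}|\mathbb{E}(G(u))-G_N|^2},$$ and let $C_N$ be the number of computational operations necessary to compute $G_N$, given by the cost model $$C_N\simeq\sum_{j,\ell,\nu\ge 0,\ j+\ell+\nu\le N}2^{m_j}\,2^{d\ell}\,s_\nu .$$ Then there is a constant $C>0$ independent of $N$ such that for all $N$ $$E_N\le C\,(N+1)^2\,2^{-2N}\,\|f\|_{L^2(D)}\|g\|_{L^2(D)},$$ and $$C_N\simeq\sum_{j,\ell,\nu\ge 0,\ j+\ell+\nu\le N}2^{4j}\,2^{d\ell}\,2^{\frac{2\nu}{r-1}}\le C\,2^{\max\{4,\,d,\,\frac{2}{r-1}\}N}.$$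
   Context: Let $D\subset\mathbb{R}^d$, $d\in\{2,3\}$, be a bounded Lipschitz domain, $f,g\in L^2(D)$, $G(v):=\int_D g v\,dx$. The symbol $\simeq$ denotes equality up to multiplicative constants independent of the level parameters. Random coefficient: $\Omega=[0,1]^{\mathbb{N}}$ with the product of the uniform (Lebesgue) measures, expectation $\mathbb{E}$. Let $\phi_j\in W^{1,\infty}(D)$ ($j\ge0$), $\psi_j\in L^\infty([0,1],[-C_\psi,C_\psi])$ for a fixed $C_\psi>0$, and $$A^\nu(x,\omega)=\phi_0(x)+\sum_{j=1}^{s_\nu}\psi_j(\omega_j)\phi_j(x),\qquad A(x,\omega)=A^\infty(x,\omega)=\phi_0(x)+\sum_{j=1}^\infty\psi_j(\omega_j)\phi_j(x),$$ the series converging absolutely in $W^{1,\infty}(D)$ for all $\omega\in\Omega$, with $\lim_{\nu\to\infty}\|A-A^\nu\|_{L^\infty(\Omega;W^{1,\infty}(D))}=0$. There are constants $0<A_{\min}\le1$, $A_{\max}<\infty$ with $A_{\min}\le A^\nu(x,\omega)\le A_{\max}$ for all $\nu\in\mathbb{N}_0\cup\{\infty\}$, and the bilinear forms $a^\nu_\omega(w,v):=\int_D A^\nu(x,\omega)\nabla w\cdot\nabla v\,dx$ satisfy $a^\nu_\omega(w,w)\ge A_{\min}\|w\|_{H^1(D)}^2$ and $|a^\nu_\omega(w,v)|\le A_{\max}\|w\|_{H^1(D)}\|v\|_{H^1(D)}$ on $H^1_0(D)$. Finite elements: $\mathcal{X}_0\subseteq\mathcal{X}_1\subseteq\dots\subset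 H^1_0(D)$ are finite element spaces on nested triangulations $\mathcal{T}_\ell$ of $D$, with a monotone sequence $h_\ell>0$, $h_\ell\to0$, $h_{\ell+1}\ge C_{\rm unif}h_\ell$, $C_{\rm unif}>0$, and $\inf_{v\in\mathcal{X}_\ell}\|w-v\|_{H^1(D)}\le C_{\rm approx}h_\ell\|w\|_{H^2(D)}$ for all $w\in H^2(D)\cap H^1_0(D)$. Let $u^\nu(\omega)\in H^1_0(D)$ and $u^\nu_\ell(\omega)\in\mathcal{X}_\ell$ be the solutions of $a^\nu_\omega(u^\nu,v)=\int_D fv\,dx$ for all $v\in H^1_0(D)$, and $a^\nu_\omega(u^\nu_\ell,v)=\int_D fv\,dx$ for all $v\in\mathcal{X}_\ell$; $u=u^\infty$ is the solution for the coefficient $A$. $H^2$-regularity is assumed: for every right-hand side $\tilde f\in L^2(D)$ in place of $f$, the corresponding exact solution $\tilde u^\nu$ satisfies $\|\tilde u^\nu(\omega)\|_{H^2(D)}\le C_{\rm reg}A_{\min}^{-2}(1+\|A^\nu(\omega)\|_{W^{1,\infty}(D)})\|\tilde f\|_{L^2(D)}$ for all $\nu,\omega$. Double differences: $D^\nu_\ell:=(u^\nu_\ell-u^\nu_{\ell-1})-(u^{\nu-1}_\ell-u^{\nu-1}_{\ell-1})$ for $\ell,\nu\ge0$, where terms with index $-1$ are $0$. Sampling: for a function $F$ depending on $\omega_1,\dots,\omega_{s_\nu}$ only, $Q^{(\nu)}_m(F):=\frac1M\sum_{i=1}^M F(X^i)$ with $M=2^m$ and $X^1,\dots,X^M$ i.i.d.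 uniform in $[0,1]^{s_\nu}$. $\mathbb{E}_{\rm MC}$ is the expectation over all samples used. Cost model: a linear iterative solver solves the sparse finite element system on level $\ell$ at cost $O(2^{d\ell})$; each bilinear form $\int_D\phi_j\nabla v\cdot\nabla w\,dx$ on $\mathcal{X}_\ell$ is computed exactly at cost $O(\#\mathcal{T}_\ell)$, so that assembling the system matrix from $s_\nu$ such forms costs $O(2^{d\ell}s_\nu)$.
   Formalization: For r = 3/2, where 2/(r-1) = 4, the last bound fails as printed because the sum is at least (N+1) 2^{4N}; there the bound proved is C (N+1) 2^{4N}, and for every other r > 1 it is the printed one. *)

(* Defs.v *)
From HB Require Import structures.
From mathcomp Require Import all_boot all_order all_algebra.
From mathcomp Require Import all_classical all_reals all_analysis.
From mathcomp Require Import ess_sup_inf.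

Set Implicit Arguments.
Unset Strict Implicit.
Unset Printing Implicit Defensive.

Import Order.TTheory GRing.Theory Num.Theory.
Import numFieldNormedType.Exports.

Local Open Scope classical_set_scope.
Local Open Scope ring_scope.

(* R^d is 'rV[R]_d with its Borel sigma-algebra. *)
HB.instance Definition _ (R : realType) (m n : nat) :=
  @isMeasurable.Build (sigma_display (@open 'M[R]_(m, n))) 'M[R]_(m, n)
    <<s (@open 'M[R]_(m, n)) >> (@sigma_algebra0 _ setT _)
    (@sigma_algebraC _ _) (@sigma_algebra_bigcup _ setT _).

(* This determines mu uniquely among Borel measures: mu is d-dimensional
   Lebesgue measure. *)
Definition is_lebesgue (R : realType) (d : nat)
    (mu : {measure set 'rV[R]_d -> \bar R}) : Prop :=
  forall a b : 'rV[R]_d, (forall i, a 0 i <= b 0 i) ->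
    mu [set x | forall i, a 0 i <= x 0 i <= b 0 i]
    = (\prod_(i < d) (b 0 i - a 0 i))%:E.

(* A bounded Lipschitz domain: near each boundary point, and in suitable
   orthonormal coordinates (x *m O), D is the strict epigraph of a Lipschitz
   function of all coordinates but the k-th one. *)
Definition lipschitz_domain (R : realType) (d : nat) (D : set 'rV[R]_d) : Prop :=
  [/\ open D, D !=set0, connected D, bounded_set D &
  forall x0, closure D x0 -> ~ D x0 ->
    exists (O : 'M[R]_d) (k : 'I_d) (gam : 'rV[R]_d -> R) (L eps : R),
      [/\ O *m O^T = 1%:M,
          forall y z : 'rV[R]_d, (forall i, i != k -> y 0 i = z 0 i) -> gam y = gam z,
          forall y z : 'rV[R]_d, `|gam y - gam z| <= L * `|y - z|,
          0 < eps &
          forall x : 'rV[R]_d, ball x0 eps x -> (D x <-> gam (x *m O) < (x *m O) 0 k)]].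

Section Sobolev.
Context (R : realType) (d : nat).
Local Notation pt := 'rV[R]_d.
Context (mu : {measure set pt -> \bar R}) (D : set pt).
Implicit Types (w v z f a : pt -> R) (i j : 'I_d).

Definition in_L2 f : Prop :=
  measurable_fun D f /\ (\int[mu]_(x in D) (f x ^+ 2)%:E < +oo)%E.

Definition L2norm f : R := Num.sqrt (\int[mu]_(x in D) (f x ^+ 2)).

Definition Linfnorm f : \bar R := ess_sup mu (fun x => `|(f \_ D) x|%:E).

Definition in_Linf f : Prop := measurable_fun D f /\ (Linfnorm f < +oo)%E.

Definition pderiv (s : seq 'I_d) f : pt -> R :=
  foldr (fun i (h : pt -> R) => 'D_(delta_mx 0 i) h) f s.

(* C_c^oo(D) *)
Definition test_function f : Prop :=
  [/\ forall s i x, derivable (pderiv s f) x (delta_mx 0 i),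
      forall s, continuous (pderiv s f) &
      exists K, [/\ compact K, K `<=` D & forall x, ~ K x -> f x = 0]].

Definition in_L1loc f : Prop :=
  measurable_fun D f /\
  forall K, compact K -> K `<=` D -> mu.-integrable K (EFin \o f).

Definition is_weak_deriv i w z : Prop :=
  [/\ in_L1loc w, in_L1loc z & forall f, test_function f ->
      \int[mu]_(x in D) (w x * pderiv [:: i] f x)
      = - \int[mu]_(x in D) (z x * f x)].

Definition weakly_derivable i w : Prop := exists z, is_weak_deriv i w z.

(* A representative of the i-th weak derivative, which is unique almost
   everywhere; the value 0 is junk when w is not weakly derivable. *)
Definition wderiv i w : pt -> R := xget (fun=> 0) [set z | is_weak_deriv i w z].

Definition in_H1 w : Prop :=
  in_L2 w /\ forall i, weakly_derivable i w /\ in_L2 (wderiv i w).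

Definition H1norm w : R :=
  Num.sqrt (L2norm w ^+ 2 + \sum_i L2norm (wderiv i w) ^+ 2).

Definition in_H2 w : Prop := in_H1 w /\ forall i, in_H1 (wderiv i w).

Definition H2norm w : R :=
  Num.sqrt (H1norm w ^+ 2
            + \sum_i \sum_j L2norm (wderiv j (wderiv i w)) ^+ 2).

(* closure of C_c^oo(D) in H^1(D) *)
Definition in_H10 w : Prop :=
  in_H1 w /\
  forall e : R, 0 < e -> exists f, test_function f /\ H1norm (w \- f) < e.

Definition in_W1inf w : Prop :=
  in_Linf w /\ forall i, weakly_derivable i w /\ in_Linf (wderiv i w).

Definition W1infnorm w : \bar R :=
  maxe (Linfnorm w) (\big[maxe/0%E]_i Linfnorm (wderiv i w)).

Definition L2dot f v : R := \int[mu]_(x in D) (f x * v x).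

Definition bform a w v : R :=
  \int[mu]_(x in D) (a x * \sum_i wderiv i w x * wderiv i v x).

(* u solves the variational problem with coefficient a and right-hand side f
   on the space V; V = in_H10 gives the exact solution. *)
Definition solves a f (V : set (pt -> R)) (u : pt -> R) : Prop :=
  V u /\ forall v, V v -> bform a u v = L2dot f v.

End Sobolev.

Section FiniteElements.
Context (R : realType) (d : nat).
Local Notation pt := 'rV[R]_d.

(* Barycentric coordinates on the reference simplex conv(0, e_1, ..., e_d). *)
Definition bary (y : pt) (k : 'I_d.+1) : R :=
  if unlift ord0 k is Some i then y 0 i else 1 - \sum_i y 0 i.

Definition ref_face (I : {set 'I_d.+1}) : set pt :=
  [set y | (forall k, 0 <= bary y k) /\ (forall k, k \notin I -> bary y k = 0)].

Definition ref_simplex : set pt := ref_face [set: 'I_d.+1].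

(* The cells are the images of the reference simplex under the element maps.
   These are affine for straight simplices; bi-Lipschitz element maps also
   allow the curved cells needed when D is not a polytope. *)
Record mesh := Mesh { ncells : nat; emap : 'I_ncells -> pt -> pt }.

Definition cell (T : mesh) (K : 'I_(ncells T)) : set pt :=
  emap K @` ref_simplex.

Definition triangulation (D : set pt) (T : mesh) : Prop :=
  [/\ forall K : 'I_(ncells T), exists2 L : R, 0 < L &
        forall y z, ref_simplex y -> ref_simplex z ->
          L^-1 * `|y - z| <= `|emap K y - emap K z| <= L * `|y - z|,
      closure D = \bigcup_(K in [set: 'I_(ncells T)]) cell K &
      forall K K' : 'I_(ncells T), K != K' ->
        exists I I' : {set 'I_d.+1},
          [/\ I != [set: 'I_d.+1]%SET, I' != [set: 'I_d.+1]%SET,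
              cell K `&` cell K' = emap K @` ref_face I &
              cell K `&` cell K' = emap K' @` ref_face I']].

Definition refines (T' T : mesh) : Prop :=
  forall K' : 'I_(ncells T'), exists K : 'I_(ncells T), cell K' `<=` cell K.

(* the polynomial of degree at most p in d variables with coefficients c *)
Definition mpoly_fun (p : nat) (c : {ffun 'I_d -> 'I_p.+1} -> R) (y : pt) : R :=
  \sum_(al : {ffun 'I_d -> 'I_p.+1} | (\sum_i al i <= p)%N)
     c al * \prod_i y 0 i ^+ al i.

(* H^1_0-conforming finite element space: a linear space of functions whose
   pull-backs to the reference simplex are polynomials of degree at most p. *)
Definition fe_space (mu : {measure set pt -> \bar R}) (D : set pt)
    (T : mesh) (p : nat) (X : set (pt -> R)) : Prop :=
  [/\ X `<=` in_H10 mu D,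
      X (fun=> 0),
      forall (c : R) v w, X v -> X w -> X (fun x => c * v x + w x) &
      forall v, X v -> forall K : 'I_(ncells T), exists c,
        {ae mu, forall x, forall y, ref_simplex y -> emap K y = x ->
                  v x = @mpoly_fun p c y}].

End FiniteElements.

Section RandomInput.
Context (R : realType).

(* Coordinates are numbered from 0: w j is omega_(j+1). *)
Definition cylinders : set (set (nat -> R)) :=
  [set C | exists (j : nat) (B : set R), measurable B /\
           C = [set w | B (w j)]].

Definition seqR : measurableType _ := g_sigma_algebraType cylinders.

Definition cube : set seqR := [set w | forall j : nat, 0 <= (w : nat -> R) j <= 1].

Definition unif01 (B : set R) : \bar R :=
  lebesgue_measure (B `&` `[0, 1]%classic).

(* P is the infinite product of the uniform measures (it is determined by its
   values on cylinders, and is carried by the cube [0,1]^N). *)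
Definition is_uniform_product (P : probability seqR R) : Prop :=
  forall (n : nat) (B : nat -> set R), (forall j, measurable (B j)) ->
    P [set w : seqR | forall j, (j < n)%N -> B j ((w : nat -> R) j)]
    = (\prod_(j < n) unif01 (B j))%E.

(* X 0, ..., X (M-1) are i.i.d. and uniform in [0,1]^s. *)
Definition iid_uniform (dT : measure_display) (Th : measurableType dT)
    (PMC : probability Th R) (M s : nat) (X : 'I_M -> Th -> s.-tuple R) : Prop :=
  [/\ forall i, measurable_fun setT (X i),
      forall i (B : 'I_s -> set R), (forall k, measurable (B k)) ->
        PMC [set t | forall k, B k (tnth (X i t) k)]
        = (\prod_(k < s) unif01 (B k))%E &
      forall E : 'I_M -> set (s.-tuple R), (forall i, measurable (E i)) ->
        PMC [set t | forall i, E i (X i t)]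
        = (\prod_(i < M) PMC (X i @^-1` E i))%E].

(* embedding of [0,1]^s into [0,1]^N *)
Definition extend (s : nat) (x : s.-tuple R) : seqR :=
  ((fun j => nth 0 x j) : nat -> R).

Definition quadrature (M s : nat) (F : seqR -> R) (X : 'I_M -> s.-tuple R) : R :=
  M%:R^-1 * \sum_(i < M) F (extend (X i)).

Section Coefficient.
Context (d : nat) (psi : nat -> R -> R) (phi : nat -> 'rV[R]_d -> R).

(* psi j stands for psi_(j+1), whereas phi j is phi_j. *)
Definition coef_trunc (s : nat) (w : seqR) (x : 'rV[R]_d) : R :=
  phi 0 x + \sum_(j < s) psi j ((w : nat -> R) j) * phi j.+1 x.

Definition coef_lim (w : seqR) (x : 'rV[R]_d) : R :=
  limn (fun n => coef_trunc n w x).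

(* A^nu for nu in N (Some nu) and nu = oo (None) *)
Definition coef (s : nat -> nat) (nu : option nat) : seqR -> 'rV[R]_d -> R :=
  if nu is Some n then coef_trunc (s n) else coef_lim.

End Coefficient.

End RandomInput.

Arguments cube {R}.

Definition backward_diff (V : zmodType) (F : nat -> V) (n : nat) : V :=
  F n - (if n is k.+1 then F k else 0).

(* U nu l is u^nu_l *)
Definition double_diff (V : zmodType) (U : nat -> nat -> V) (l nu : nat) : V :=
  backward_diff (fun n => backward_diff (U n) l) nu.

Definition simeq (R : realType) (a b : nat -> R) : Prop :=
  exists c1 c2 : R, [/\ 0 < c1, 0 < c2 &
    forall n, c1 * b n <= a n <= c2 * b n].

Section Method.
Context (R : realType) (r : R).

Definition m_ (j : nat) : nat := `|Num.ceil (4 * j%:R : R)|%N.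

Definition s_ (nu : nat) : nat :=
  `|Num.ceil (2 `^ (2 * nu%:R / (r - 1)) : R)|%N.

Definition sample_family (Th : Type) (N : nat) :=
  forall l nu : nat, 'I_(2 ^ m_ (N - l - nu)) -> Th -> (s_ nu).-tuple R.

(* G_N; q l nu w is G(D_l^nu(w)) *)
Definition estimator (Th : Type) (N : nat) (q : nat -> nat -> seqR R -> R)
    (X : sample_family Th N) (t : Th) : R :=
  \sum_(l < N.+1) \sum_(nu < N.+1 | (l + nu <= N)%N)
    quadrature (q l nu) (fun i => X l nu i t).

Definition cost_model (d N : nat) : R :=
  \sum_(j < N.+1) \sum_(l < N.+1) \sum_(nu < N.+1 | (j + l + nu <= N)%N)
    2 ^+ m_ j * 2 ^+ (d * l) * (s_ nu)%:R.

Definition cost_sum (d N : nat) : R :=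
  \sum_(j < N.+1) \sum_(l < N.+1) \sum_(nu < N.+1 | (j + l + nu <= N)%N)
    2 ^+ (4 * j) * 2 ^+ (d * l) * 2 `^ (2 * nu%:R / (r - 1)).

End Method.

(* Main.v *)
(* Pointwise in the random parameter, with a = A^nu, b = A^(nu-1) and kappa = ||a - b||_{W^{1,oo}}, Galerkin
   orthogonality for the two bilinear forms and duality give
     |G(u_a - u_(a,l)) - G(u_b - u_(b,l))| <= C kappa h_l^2 ||f|| ||g||;
   the H^2-regularity of the dual problem with right-hand side - div((a - b) grad z) enters through the product
   rule for a W^{1,oo} function times a weakly differentiable one.  Since kappa <= C 4^(-nu) by the decay of the
   phi_j, double differences are O(4^(-l-nu)), and telescoping shows that the sparse sum has bias
   O((N+1) 4^(-N)).  Each Monte Carlo average contributes a variance O(16^(-l-nu)) / 16^(N-l-nu) = O(16^(-N)),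
   and the O((N+1)^2) averages are combined with the Cauchy-Schwarz inequality, so that no independence between
   different levels is needed. *)

Require Import Defs.
From HB Require Import structures.
From mathcomp Require Import all_boot all_order all_algebra.
From mathcomp Require Import all_classical all_reals all_analysis.
From mathcomp Require Import ess_sup_inf measurable_realfun.
From mathcomp Require Import zify ring lra.

Import Order.TTheory GRing.Theory Num.Theory.
Import numFieldNormedType.Exports.

Local Open Scope classical_set_scope.
Local Open Scope ring_scope.

Set Implicit Arguments.
Unset Strict Implicit.
Unset Printing Implicit Defensive.

(** * Integration *)

(** Functions are not identified when they agree almost everywhere, and solutions are prescribed
    only for parameters in the unit cube. The regularity hypothesis yields some H^2 solution, which
    has to be matched with the given one up to H1-norm zero. Measurability in the parameter is
    proved, not assumed: the discrete quantities are Lipschitz in finitely many numbers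
    psi_j(omega_j), hence measurable although psi_j is merely measurable, and G(u) is a pointwise
    limit of sparse sums by the bias estimate itself.

    The product rule is obtained by doubling variables. The coefficient is tested in x and the other
    factor in y against a smooth kernel in x - y, so derivatives fall on smooth functions only. The
    kernel first tends to the indicator of a cube, then the cube shrinks; boundedness of the
    coefficient and its derivative gives weak-star convergence, which suffices against an integrable
    factor.

    The term (a - b)(z, e_b) left over by Galerkin orthogonality is only of first order in h when
    estimated directly; a second dual problem recovers the missing power. For the same reason u_a -
    u_b needs an H^2 bound of order kappa. *)

Section IntegrationTools.
Context (dT : measure_display) (T : measurableType dT) (R : realType).
Context (mu : {measure set T -> \bar R}).
Implicit Types (D : set T) (f g : T -> R).

Lemma integrable_fadd D f g : measurable D -> mu.-integrable D (EFin \o f) ->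
  mu.-integrable D (EFin \o g) -> mu.-integrable D (EFin \o (fun x => f x + g x)).
Proof.
by move=> mD fi gi; have := integrableD mD fi gi; apply: eq_integrable.
Qed.

Lemma integrable_fscale D (k : R) f : measurable D -> mu.-integrable D (EFin \o f) ->
  mu.-integrable D (EFin \o (fun x => k * f x)).
Proof.
by move=> mD fi; have := integrableZl mD k fi; apply: eq_integrable.
Qed.

Lemma integrable_fsub D f g : measurable D -> mu.-integrable D (EFin \o f) ->
  mu.-integrable D (EFin \o g) -> mu.-integrable D (EFin \o (fun x => f x - g x)).
Proof.
by move=> mD fi gi; have := integrableB mD fi gi; apply: eq_integrable.
Qed.

Lemma integrable_fnorm D f : measurable D -> mu.-integrable D (EFin \o f) ->
  mu.-integrable D (EFin \o (fun x => `|f x|)).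
Proof. by move=> mD fi; exact: (integrable_norm fi). Qed.

Lemma ae_le_integrable D f g : measurable D -> measurable_fun D f ->
  mu.-integrable D (EFin \o g) -> {ae mu, forall x, D x -> `|f x| <= g x} ->
  mu.-integrable D (EFin \o f).
Proof.
move=> mD mf ig fg; apply/integrableP; split; first exact/measurable_EFinP.
have /integrableP[mg igoo] := ig.
apply: le_lt_trans igoo; apply: ae_ge0_le_integral => //.
- by apply: measurableT_comp => //; exact/measurable_EFinP.
- exact: measurableT_comp.
- apply: filterS fg => x h Dx; rewrite /= lee_fin.
  by apply: le_trans (h Dx) _; exact: ler_norm.
Qed.

Lemma integrable_bounded D f (M : R) : measurable D -> (mu D < +oo)%E ->
  measurable_fun D f -> {ae mu, forall x, D x -> `|f x| <= M} ->
  mu.-integrable D (EFin \o f).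
Proof.
move=> mD Doo mf fM; apply: (@ae_le_integrable _ _ (cst M)) => //.
apply/integrableP; split; first exact/measurable_EFinP.
by rewrite (@integral_cst _ _ _ mu D mD `|M|%:E) lte_mul_pinfty.
Qed.

Lemma integrableM_bounded D f g (M : R) : measurable D ->
  mu.-integrable D (EFin \o f) -> measurable_fun D g ->
  {ae mu, forall x, D x -> `|g x| <= M} ->
  mu.-integrable D (EFin \o (fun x => f x * g x)).
Proof.
move=> mD fi mg gM.
have mf : measurable_fun D f by apply/measurable_EFinP; exact: measurable_int fi.
apply: (@ae_le_integrable _ _ (fun x => `|M| * `|f x|)) => //.
- exact: measurable_funM.
- exact/integrable_fscale/integrable_fnorm.
- apply: filterS gM => x h Dx; rewrite normrM mulrC ler_wpM2r //.
  by apply: le_trans (h Dx) _; exact: ler_norm.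
Qed.

Lemma integrable_indic_fin D (A : set T) : measurable D -> measurable A ->
  (mu A < +oo)%E -> mu.-integrable D (EFin \o (\1_A : T -> R)).
Proof.
move=> mD mA Aoo; apply: (@integrableS _ _ _ mu setT) => //.
have : mu.-integrable A (EFin \o (cst 1 : T -> R)).
  by apply: (@integrable_bounded _ _ 1) => //; apply/aeW => x _; rewrite normr1.
move/(integrable_mkcond _ mA); apply: eq_integrable => // x _.
by rewrite patchE /= indicE; case: (_ \in _).
Qed.

Lemma indicSD (A B : set T) x : B `<=` A -> \1_(A `\` B) x = \1_A x - \1_B x :> R.
Proof.
move=> BA; rewrite !indicE in_setD.
have [Bx|Bx] := boolP (x \in B); last by rewrite andbT subr0.
by rewrite andbF (_ : x \in A) ?subrr // inE; apply: BA; rewrite -inE.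
Qed.

Lemma cvg_indic_bigcup (F : (set T)^nat) x : nondecreasing_seq F ->
  (\1_(F n) x : R) @[n --> \oo] --> (\1_(\bigcup_n F n) x : R).
Proof.
move=> ndF; have [[k _ Fk]|nF] := pselect ((\bigcup_n F n) x).
  rewrite indicE mem_set; last by exists k.
  apply: cvg_near_cst; near=> n; rewrite indicE mem_set //.
  have kn : (k <= n)%N by near: n; exact: nbhs_infty_ge.
  by move: (ndF _ _ kn); rewrite subsetEset; exact.
rewrite indicE memNset // (_ : (fun _ => _) = cst 0); first exact: cvg_cst.
by apply/funext => n; rewrite indicE memNset // => Fn; apply: nF; exists n.
Unshelve. all: by end_near.
Qed.

Lemma Rintegral_indicr (B E : set T) f :
  \int[mu]_(x in B) (f x * \1_E x) = \int[mu]_(x in B `&` E) f x.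
Proof.
rewrite Rintegral_mkcond [RHS]Rintegral_mkcond; apply: eq_Rintegral => x _.
by rewrite !patchE in_setI indicE; case: (x \in B); case: (x \in E); rewrite ?mulr1 ?mulr0.
Qed.

Lemma ae_eq_Rintegral D f g : measurable D -> measurable_fun D f ->
  measurable_fun D g -> {ae mu, forall x, D x -> f x = g x} ->
  \int[mu]_(x in D) f x = \int[mu]_(x in D) g x.
Proof.
move=> mD mf mg fg; rewrite /Rintegral; congr fine; apply: ae_eq_integral => //.
- exact/measurable_EFinP.
- exact/measurable_EFinP.
- by apply: filterS fg => x h Dx; rewrite h.
Qed.

Lemma Rdominated_convergence D (f_ : nat -> T -> R) f g : measurable D ->
  (forall n, measurable_fun D (f_ n)) -> measurable_fun D f ->
  {ae mu, forall x, D x -> f_ n x @[n --> \oo] --> f x} ->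
  mu.-integrable D (EFin \o g) ->
  {ae mu, forall x n, D x -> `|f_ n x| <= g x} ->
  \int[mu]_(x in D) f_ n x @[n --> \oo] --> \int[mu]_(x in D) f x.
Proof.
move=> mD mf_ mf cf ig fg.
have h1 : {ae mu, forall x, D x -> (EFin \o f_ n) x @[n --> \oo] --> (EFin \o f) x}.
  by apply: filterS cf => x h Dx; apply/fine_cvgP; split; [exact: nearW|exact: h].
have h2 : {ae mu, forall x n, D x -> (`|(EFin \o f_ n) x| <= (EFin \o g) x)%E}.
  by apply: filterS fg => x h n Dx; rewrite /= lee_fin; exact: h.
have [fi _ cv] := dominated_convergence mD
  (fun n => (measurable_EFinP _ _).2 (mf_ n)) ((measurable_EFinP _ _).2 mf) h1 ig h2.
by apply: fine_cvg; rewrite fineK; [exact: cv|exact: integrable_fin_num].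
Qed.

Lemma ae_le_Rintegral D f g : measurable D -> mu.-integrable D (EFin \o f) ->
  mu.-integrable D (EFin \o g) -> {ae mu, forall x, D x -> f x <= g x} ->
  \int[mu]_(x in D) f x <= \int[mu]_(x in D) g x.
Proof.
move=> mD fi gi fg.
have [mf mg] : measurable_fun D f /\ measurable_fun D g.
  by split; apply/measurable_EFinP; [exact: measurable_int fi|exact: measurable_int gi].
have fgi : mu.-integrable D (EFin \o (fun x => g x - f x)) by exact: integrable_fsub.
have maxi : mu.-integrable D (EFin \o (fun x => Num.max 0 (g x - f x))).
  apply: (@ae_le_integrable _ _ (fun x => `|g x - f x|)) => //.
  - by apply: measurable_maxr => //; exact: measurable_funB.
  - exact: integrable_fnorm.
  - by apply/aeW => x _; rewrite ger0_norm ?le_max ?lexx // ge_max normr_ge0 ler_norm.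
rewrite -subr_ge0 -RintegralB //.
(* [Rintegral_ge0] asks for a sign everywhere, so g - f is replaced by its positive part, to which
   it is equal almost everywhere. *)
rewrite (_ : \int[mu]_(x in D) (g x - f x) = \int[mu]_(x in D) Num.max 0 (g x - f x)).
  by apply: Rintegral_ge0 => x _; rewrite le_max lexx.
apply: ae_eq_Rintegral => //.
- exact: measurable_funB.
- by apply: measurable_maxr => //; exact: measurable_funB.
- apply: filterS fg => x h Dx; apply/esym/max_idPr; rewrite subr_ge0; exact: h.
Qed.

End IntegrationTools.

(** * Lebesgue measure on boxes *)

Section Boxes.
Context (R : realType) (d : nat).
Local Notation pt := 'rV[R]_d.
Implicit Types (a b x : pt) (e : R).

Definition obox a b : set pt := [set x | forall i, a 0 i < x 0 i < b 0 i].
Definition cbox a b : set pt := [set x | forall i, a 0 i <= x 0 i <= b 0 i].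

Lemma obox_cbox a b : obox a b `<=` cbox a b.
Proof. by move=> x xab i; have /andP[/ltW -> /ltW ->] := xab i. Qed.

Lemma ball_rVE x e : 0 < e -> ball x e = obox (x - const_mx e) (x + const_mx e).
Proof.
move=> e0; apply/seteqP; split=> y /=.
  move=> [_ xy] i; have := xy 0 i; rewrite /ball /= !mxE ltr_distlC.
  by move=> /andP[-> ->].
move=> xy; split => // i j; rewrite (ord1 i) /ball /=.
by have := xy j; rewrite !mxE ltr_distlC.
Qed.

Lemma oboxI a b a' b' : obox a b `&` obox a' b' =
  obox (\row_i Num.max (a 0 i) (a' 0 i)) (\row_i Num.min (b 0 i) (b' 0 i)).
Proof.
apply/seteqP; split=> x /=.
  move=> [h1 h2] i; rewrite !mxE; have /andP[p1 p2] := h1 i; have /andP[p3 p4] := h2 i.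
  by rewrite gt_max p1 p3 /= lt_min p2 p4.
move=> h; split=> i; have := h i; rewrite !mxE gt_max lt_min.
  by move=> /andP[/andP[-> _] /andP[-> _]].
by move=> /andP[/andP[_ ->] /andP[_ ->]].
Qed.

Lemma open_obox a b : open (obox a b).
Proof.
rewrite openE => x xab; rewrite /interior /=.
apply: (@filter_forall _ _ (fun i (y : pt) => a 0 i < y 0 i < b 0 i) (nbhs x)) => i; have /andP[ax xb] := xab i.
have := @coord_continuous R 1 d 0 i x.
move=> /cvgrPdist_lt cx.
have e0 : 0 < Num.min (x 0 i - a 0 i) (b 0 i - x 0 i).
  by rewrite lt_min !subr_gt0 ax.
have := cx _ e0; apply: filterS => y /=.
rewrite lt_min !ltr_distlC => /andP[/andP[h1 _] /andP[_ h2]].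
apply/andP; split; lra.
Qed.

Lemma closed_cbox a b : closed (cbox a b).
Proof.
have -> : cbox a b = \bigcap_(i in [set: 'I_d]) ((fun x : pt => x 0 i) @^-1` `[a 0 i, b 0 i]%classic).
  apply/seteqP; split=> x /=.
    by move=> h i _ /=; rewrite in_itv /=; exact: h.
  by move=> h i; have := h i I; rewrite /= in_itv.
apply: closed_bigI => i _; apply: preimage_closed => //.
  by move=> x _; exact: coord_continuous.
exact: interval_closed.
Qed.

Lemma compact_cbox a b : compact (cbox a b).
Proof.
have := @rV_compact R d (fun i => `[a 0 i, b 0 i]%classic)
  (fun i => @segment_compact _ _ _).
by congr compact; apply/seteqP; split=> x /= h i; have := h i; rewrite in_itv.
Qed.

(** Rational corners make the boxes countable in number. The closed box stays inside U so that a
    bump supported on it is a test function when U is the domain. *)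
Lemma openU_obox (U : set pt) : open U -> forall x, U x ->
  exists a b : 'rV[rat]_d, [/\ obox (map_mx ratr a) (map_mx ratr b) x,
    cbox (map_mx ratr a) (map_mx ratr b) `<=` U &
    forall i, (ratr (a 0 i) : R) < ratr (b 0 i)].
Proof.
move=> oU x Ux.
have /nbhs_ballP[e /= e0 xeU] : nbhs x U by exact: open_nbhs_nbhs.
have ha i : exists q : rat, x 0 i - e < ratr q < x 0 i.
  have /rat_in_itvoo[q] : x 0 i - e < x 0 i by lra.
  by rewrite in_itv /=; exists q.
have hb i : exists q : rat, x 0 i < ratr q < x 0 i + e.
  have /rat_in_itvoo[q] : x 0 i < x 0 i + e by lra.
  by rewrite in_itv /=; exists q.
have [fa hfa] := choice ha; have [fb hfb] := choice hb.
exists (\row_i fa i), (\row_i fb i); split.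
- by move=> i; rewrite !mxE; have /andP[_ ->] := hfa i; have /andP[-> _] := hfb i.
- move=> y hy; apply: xeU; rewrite ball_rVE // => i; have := hy i; rewrite !mxE.
  have /andP[h1 h2] := hfa i; have /andP[h3 h4] := hfb i.
  by move=> /andP[h5 h6]; apply/andP; split; lra.
- move=> i; rewrite !mxE; have /andP[_ h] := hfa i; have /andP[h' _] := hfb i.
  exact: lt_trans h h'.
Qed.

Definition oboxes : set (set pt) := [set A | exists a b, A = obox a b].

Lemma oboxes_setI : setI_closed oboxes.
Proof. by move=> _ _ [a [b ->]] [a' [b' ->]]; rewrite oboxI; do 2 eexists. Qed.

Lemma open_measurable_rV (U : set pt) : open U -> measurable U.
Proof. by move=> oU; exact: sub_sigma_algebra. Qed.

Lemma measurable_obox a b : measurable (obox a b).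
Proof. by apply: open_measurable_rV; exact: open_obox. Qed.

Lemma closed_measurable_rV (U : set pt) : closed U -> measurable U.
Proof.
by move=> cU; rewrite -(setCK U); apply: measurableC; apply: open_measurable_rV; exact: closed_openC.
Qed.

Lemma measurable_cbox a b : measurable (cbox a b).
Proof. by apply: closed_measurable_rV; exact: closed_cbox. Qed.

Lemma open_bigcup_oboxes (U : set pt) : open U ->
  U = \bigcup_(q in [set q : 'rV[rat]_d * 'rV[rat]_d |
         cbox (map_mx ratr q.1) (map_mx ratr q.2) `<=` U])
         obox (map_mx ratr q.1) (map_mx ratr q.2).
Proof.
move=> oU; apply/seteqP; split=> x.
  move=> /(openU_obox oU)[a [b [h1 h2 _]]].
  by exists (a, b).
by move=> [[a b]] /= abU /obox_cbox /abU.
Qed.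

Lemma measurable_oboxesE : @measurable _ pt = <<s oboxes >>.
Proof.
apply/seteqP; split.
  apply: smallest_sub; first exact: smallest_sigma_algebra.
  move=> U /open_bigcup_oboxes ->; rewrite bigcup_mkcond.
  apply: (@countable_bigcupT_measurable _ (g_sigma_algebraType oboxes)) => //.
  move=> q; case: ifP => _; last exact: measurable0.
  by apply: sub_sigma_algebra; do 2 eexists.
apply: smallest_sub; first exact: sigma_algebra_measurable.
by move=> _ [a [b ->]]; exact: measurable_obox.
Qed.

Lemma obox_cover : \bigcup_k obox (const_mx (- k%:R)) (const_mx k%:R) = setT.
Proof.
rewrite -subTset => x _.
have [M [Mr hM]] : \forall M \near +oo, forall i, `|x 0 i| < M.
  apply: filter_forall => i; exact: nbhs_pinfty_gt.
exists (Num.truncn (Num.max 0 (M + 1))).+1 => //= i; rewrite !mxE -ltr_norml.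
have h := truncnS_gt (Num.max 0 (M + 1)).
apply: lt_trans h; apply: hM.
by rewrite lt_max; apply/orP; right; lra.
Qed.

(** Dynkin's lemma: open boxes form a pi-system that generates the Borel sets. Statements checked on
    boxes reach all Borel sets once they survive proper differences and increasing unions. *)
Lemma obox_induction (Pr : set (set pt)) :
  (forall a b, Pr (obox a b)) -> Pr setT ->
  setSD_closed Pr -> ndseq_closed Pr ->
  forall E, measurable E -> Pr E.
Proof.
move=> Pb PT PD PU E mE.
apply: (@lambda_system_subset _ oboxes oboxes_setI setT Pr) => //.
- by move=> _ [a [b ->]].
- by rewrite -measurable_oboxesE.
Qed.

End Boxes.

(** * Open boxes, sigma-finiteness and translation invariance of Lebesgue measure *)

Section Lebesgue.
Context (R : realType) (d : nat).
Local Notation pt := 'rV[R]_d.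
Context (mu : {measure set pt -> \bar R}) (hmu : is_lebesgue mu).
Implicit Types (a b x : pt) (e : R).

Lemma mu_cbox a b : (forall i, a 0 i <= b 0 i) ->
  mu (cbox a b) = (\prod_(i < d) (b 0 i - a 0 i))%:E.
Proof. exact: hmu. Qed.

Lemma mu_face a b i : (forall i, a 0 i <= b 0 i) -> a 0 i = b 0 i -> mu (cbox a b) = 0%E.
Proof. by move=> ab abi; rewrite mu_cbox // (bigD1 i) //= abi subrr mul0r. Qed.

(** The boundary lies in the union of the 2d faces. A face is a degenerate closed box, whose product
    of side lengths has a zero factor. *)
Lemma negligible_boundary a b : mu.-negligible (cbox a b `\` obox a b).
Proof.
have [ab|/existsNP[i /negP ab]] := pselect (forall i, a 0 i <= b 0 i); last first.
  apply: negligibleS (@negligible_set0 _ _ _ mu) => x [/= h _].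
  by have /andP[/le_trans h1 /h1] := h i; rewrite (negbTE ab).
have : \forall x \ae mu, forall i, cbox a b x -> a 0 i < x 0 i < b 0 i.
  apply: filter_forall => i.
  have h1 : mu (cbox a (\row_j if j == i then a 0 i else b 0 j)) = 0%E.
    apply: (@mu_face _ _ i); last by rewrite mxE eqxx.
    by move=> j; rewrite mxE; case: eqP => // ->.
  have h2 : mu (cbox (\row_j if j == i then b 0 i else a 0 j) b) = 0%E.
    apply: (@mu_face _ _ i); last by rewrite mxE eqxx.
    by move=> j; rewrite mxE; case: eqP => // ->.
  have /(negligibleP _ (measurable_cbox _ _)) n1 := h1.
  have /(negligibleP _ (measurable_cbox _ _)) n2 := h2.
  apply: negligibleS (negligibleU n1 n2) => x /= /not_implyP[xab /negP].
  have /andP[xa xb] := xab i.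
  rewrite negb_and -!leNgt => /orP[h|h]; [left|right] => j; rewrite mxE;
    have := xab j; case: (eqVneq j i) => [->|//]; rewrite ?h ?xa ?xb //.
apply: negligibleS => x [xab nxab] /= h; apply: nxab => i; exact: h.
Qed.

Lemma mu_obox a b : (forall i, a 0 i <= b 0 i) ->
  mu (obox a b) = (\prod_(i < d) (b 0 i - a 0 i))%:E.
Proof.
move=> ab; rewrite -mu_cbox //; apply/eqP; rewrite eq_le; apply/andP; split.
  by apply: le_measure; rewrite ?inE; [exact: measurable_obox|exact: measurable_cbox|exact: obox_cbox].
have -> : cbox a b = obox a b `|` (cbox a b `\` obox a b).
  by rewrite setDE setUIr setUCr setIT setUidr //; exact: obox_cbox.
have mD : measurable (cbox a b `\` obox a b).
  by apply: measurableD; [exact: measurable_cbox|exact: measurable_obox].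
apply: le_trans (measureU2 _ _ _) _; rewrite ?measureU2 //; first exact: measurable_obox.
have /(negligibleP _ mD) -> := negligible_boundary a b.
by rewrite adde0.
Qed.

Lemma mu_obox_fin a b : (mu (obox a b) < +oo)%E.
Proof.
have [ab|/existsNP[i /negP ab]] := pselect (forall i, a 0 i <= b 0 i).
  by rewrite mu_obox // ltry.
suff -> : obox a b = set0 by rewrite measure0 ltry.
apply/seteqP; split=> x //= h.
by have /andP[/lt_trans h1 /h1 /ltW] := h i; rewrite (negbTE ab).
Qed.

Lemma lebesgue_sigma_finite : sigma_finite setT mu.
Proof.
exists (fun k => obox (const_mx (- k%:R)) (const_mx k%:R)).
  by rewrite obox_cover.
by move=> k; split; [exact: measurable_obox|exact: mu_obox_fin].
Qed.

Lemma measurable_shift (v : pt) : measurable_fun setT (fun x : pt => x + v).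
Proof.
apply: (@measurability _ _ _ _ setT (fun x : pt => x + v) open) => //.
move=> _ [U oU <-]; rewrite setTI; apply: open_measurable_rV.
apply: open_comp => //; move=> x _.
by apply: continuousD => //; exact: cst_continuous.
Qed.

(** The measure and its push-forward under the shift agree on boxes, and the cubes centred at 0
    exhaust the space with finite measure, so uniqueness of measures applies. *)
Lemma lebesgue_shift (v : pt) A : measurable A ->
  mu ((fun x : pt => x + v) @^-1` A) = mu A.
Proof.
move=> mA.
have Gg k : @oboxes R d (obox (const_mx (- k%:R)) (const_mx k%:R)) by do 2 eexists.
have H := @measure_unique _ _ pt (@oboxes R d) _
  (measurable_oboxesE R d) (@oboxes_setI R d) Gg (obox_cover R d) mu
  (measure_function_pushforward__canonical__measure_function_Measure mu (measurable_shift v)).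
apply/esym; apply: H => //; last by move=> k; exact: mu_obox_fin.
move=> _ [a [b ->]]; rewrite /= /pushforward /=.
have -> : (fun x : pt => x + v) @^-1` obox a b = obox (a - v) (b - v).
  by apply/seteqP; split=> x /= h i; have := h i; rewrite !mxE ltrBlDr ltrBrDr.
have [ab|/existsNP[i /negP ab]] := pselect (forall i, a 0 i <= b 0 i).
  rewrite !mu_obox //; last by move=> i; rewrite !mxE lerD2r.
  by congr EFin; apply: eq_bigr => i _; rewrite !mxE; lra.
have e0 a' b' : ~~ (a' 0 i <= b' 0 i) -> obox a' b' = set0.
  move=> ab'; apply/seteqP; split=> x //= h.
  by have /andP[/lt_trans h1 /h1 /ltW] := h i; rewrite (negbTE ab').
by rewrite !e0 ?measure0 // !mxE lerD2r.
Qed.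

End Lebesgue.

(** * Smooth bump functions *)

Section Smooth.
Context (R : realType) (d : nat).
Local Notation pt := 'rV[R]_d.
Local Notation e_ i := (delta_mx 0 i : pt).
Implicit Types (f g : pt -> R) (x : pt) (i j : 'I_d).

Definition smooth f : Prop :=
  (forall s i x, derivable (pderiv s f) x (e_ i)) /\
  (forall s, continuous (pderiv s f)).

Lemma pderiv_cat s t f : pderiv s (pderiv t f) = pderiv (s ++ t) f.
Proof. by rewrite /pderiv foldr_cat. Qed.

Lemma smooth_pderiv s f : smooth f -> smooth (pderiv s f).
Proof. by move=> [h1 h2]; split=> [t i x|t]; rewrite pderiv_cat. Qed.

Lemma smooth_continuous f : smooth f -> continuous f.
Proof. by move=> [_ h]; exact: (h [::]). Qed.

Lemma smooth_derivable f x i : smooth f -> derivable f x (e_ i).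
Proof. by move=> [h _]; exact: (h [::]). Qed.

Lemma smooth_derive f i : smooth f -> smooth ('D_(e_ i) f).
Proof. exact: (@smooth_pderiv [:: i]). Qed.

(** Smoothness asks for all iterated partial derivatives at once. A class of continuous, partially
    differentiable functions that is stable under partial derivatives delivers them by induction on
    the list of directions. *)
Lemma smooth_class (S : set (pt -> R)) :
  (forall f, S f -> continuous f /\
    forall i, (forall x, derivable f x (e_ i)) /\ S ('D_(e_ i) f)) ->
  forall f, S f -> smooth f.
Proof.
move=> hS f Sf; have Sp s : S (pderiv s f).
  by elim: s => //= i s ih; have [_ /(_ i)[]] := hS _ ih.
split=> [s i x|s].
  by have [_ /(_ i)[]] := hS _ (Sp s).
by have [] := hS _ (Sp s).
Qed.

(** The algebra generated by B. By the Leibniz rule it is stable under partial derivatives as soon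
    as the derivatives of the generators belong to it. *)
Inductive generated (B : set (pt -> R)) : (pt -> R) -> Prop :=
| gen_base f : B f -> generated B f
| gen_cst c : generated B (fun=> c)
| gen_add f g : generated B f -> generated B g -> generated B (fun x => f x + g x)
| gen_mul f g : generated B f -> generated B g -> generated B (fun x => f x * g x).

Lemma generated_smooth (B : set (pt -> R)) :
  (forall f, B f -> continuous f /\
    forall i, (forall x, derivable f x (e_ i)) /\ generated B ('D_(e_ i) f)) ->
  forall f, generated B f -> smooth f.
Proof.
move=> hB; apply: (@smooth_class (generated B)) => f.
elim=> {f} [f /hB//|c|f g gf [cf df] gg [cg dg]|f g gf [cf df] gg [cg dg]].
- split; first exact: cst_continuous.
  move=> i; split; first by move=> x; exact: derivable_cst.
  have -> : 'D_(e_ i) (fun=> c) = (fun=> 0) :> (pt -> R).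
    by apply/funext => x; exact: derive_cst.
  exact: gen_cst.
- split; first by move=> x; exact: continuousD (cf x) (cg x).
  move=> i; have [df1 df2] := df i; have [dg1 dg2] := dg i.
  split; first by move=> x; exact: derivableD (df1 x) (dg1 x).
  have -> : 'D_(e_ i) (fun x => f x + g x) =
      (fun x => 'D_(e_ i) f x + 'D_(e_ i) g x) :> (pt -> R).
    by apply/funext => x; exact: deriveD (df1 x) (dg1 x).
  exact: gen_add.
- split; first by move=> x; exact: continuousM (cf x) (cg x).
  move=> i; have [df1 df2] := df i; have [dg1 dg2] := dg i.
  split; first by move=> x; exact: derivableM (df1 x) (dg1 x).
  have -> : 'D_(e_ i) (fun x => f x * g x) =
      (fun x => f x * 'D_(e_ i) g x + g x * 'D_(e_ i) f x) :> (pt -> R).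
    by apply/funext => x; exact: deriveM (df1 x) (dg1 x).
  by apply: gen_add; exact: gen_mul.
Qed.

Lemma smooth_generated f : generated smooth f -> smooth f.
Proof.
apply: generated_smooth => {}f sf; split; first exact: smooth_continuous.
move=> i; split; first by move=> x; exact: smooth_derivable.
by apply: gen_base; exact: smooth_derive.
Qed.

Lemma smooth_cst c : smooth (fun=> c).
Proof. by apply: smooth_generated; exact: gen_cst. Qed.

Lemma smooth_add f g : smooth f -> smooth g -> smooth (fun x => f x + g x).
Proof. by move=> sf sg; apply: smooth_generated; apply: gen_add; exact: gen_base. Qed.

Lemma smooth_mul f g : smooth f -> smooth g -> smooth (fun x => f x * g x).
Proof. by move=> sf sg; apply: smooth_generated; apply: gen_mul; exact: gen_base. Qed.

(** Along direction i the function f depends on one real variable, the coordinate j, which moves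
    only if i = j. Partial derivatives thus reduce to the one-dimensional G. *)
Lemma derivable_coord (G : R -> R) f i j x (dG : R) :
  (forall h : R, f (h *: e_ i + x) = G (h * (i == j)%:R + x 0 j)) ->
  is_derive (x 0 j) 1 G dG -> is_derive x (e_ i) f ((i == j)%:R * dG).
Proof.
move=> fG iG.
have eq : (fun h : R => h^-1 *: ((f \o shift x) (h *: e_ i) - f x)) =
   (fun h : R => h^-1 *: ((G \o shift (x 0 j)) (h *: ((i == j)%:R : R)) - G (x 0 j))).
  apply/funext => h /=; rewrite fG.
  by have := fG 0; rewrite scale0r add0r mul0r add0r => ->.
have : is_derive (x 0 j) ((i == j)%:R : R) G ((i == j)%:R * dG).
  case: (i == j) => /=; first by rewrite mul1r.
  by rewrite mul0r; exact: is_derive0.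
by case=> h1 h2; split; rewrite /derivable /derive eq.
Qed.

End Smooth.

(** * Flat functions of one variable and plateaus *)

Section Bump.
Context (R : realType).
Implicit Types (t : R) (k n : nat).

(** The classical flat function exp(-1/t), times a negative power of t. The power is carried along
    because the derivative of [bump k] is [bump k.+2] minus k times [bump k.+1], so that linear
    combinations of the family are stable under differentiation. *)
Definition bump k t : R := if 0 < t then t ^- k * expR (- t^-1) else 0.

Lemma bump_ge0 k t : 0 <= bump k t.
Proof. by rewrite /bump; case: ifP => // t0; rewrite mulr_ge0 ?expR_ge0 // invr_ge0 exprn_ge0 // ltW. Qed.

(** With n = [m.+1], exp(1/t) is the n-th power of exp(1/(n t)), which is at least 1/(n t). *)
Lemma expRN_inv_le m t : 0 < t -> expR (- t^-1) <= (m.+1%:R * t) ^+ m.+1.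
Proof.
move=> t0; rewrite expRN -[leRHS]invrK lef_pV2 ?posrE ?expR_gt0 //; last first.
  by rewrite invr_gt0 exprn_gt0 // mulr_gt0.
have -> : t^-1 = (m.+1%:R * t)^-1 *+ m.+1.
  by rewrite invfM -mulrnAl -mulr_natl mulfV ?mul1r // pnatr_eq0.
rewrite -[X in expR X]mulr_natr expRM_natr -exprVn lerXn2r ?nnegrE ?invr_ge0 ?expR_ge0 //.
  by rewrite mulr_ge0 // ltW.
by apply: le_trans (expR_ge1Dx _); rewrite lerDr.
Qed.

(** A power k + m + 1 of t absorbs t^(-k) and leaves t^(m+1). The case m = 0 bounds [bump k] for |t|
    at most 1; the case m = 1 makes its derivative at 0 vanish. *)
Lemma bump_le_expX k m t : bump k t <= (k + m).+1%:R ^+ (k + m).+1 * `|t| ^+ m.+1.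
Proof.
rewrite /bump; case: ifP => [t0|_]; last by rewrite mulr_ge0 // exprn_ge0.
have := expRN_inv_le (k + m) t0.
rewrite -(ler_pM2l (_ : 0 < t ^- k)); last by rewrite invr_gt0 exprn_gt0.
move/le_trans; apply; rewrite exprMn mulrCA (gtr0_norm t0) -addnS (exprD t) mulKf //.
by rewrite expf_neq0 // gt_eqF.
Qed.

Lemma bump_bounded k : exists2 M : R, 0 < M & forall t, bump k t <= M.
Proof.
exists (Num.max 1 ((k + 0).+1%:R ^+ (k + 0).+1)); first by rewrite lt_max ltr01.
move=> t; have [t1|t1] := leP `|t| 1.
  rewrite le_max; apply/orP; right; apply: le_trans (bump_le_expX _ 0 _) _.
  by rewrite ler_piMr // exprn_ge0.
rewrite le_max; apply/orP; left; rewrite /bump; case: ifP => // t0.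
have t1' : 1 < t by rewrite -(gtr0_norm t0).
apply: mulr_ile1; rewrite ?expR_ge0 ?invr_ge0 ?exprn_ge0 ?(ltW t0) //.
  by rewrite invf_le1 ?exprn_gt0 // exprn_ege1 // ltW.
by rewrite expR_le1 oppr_le0 invr_ge0 ltW.
Qed.

Lemma bump0_le1 t : bump 0 t <= 1.
Proof.
rewrite /bump; case: ifP => // t0; rewrite expr0 invr1 mul1r ltW //.
by rewrite expR_lt1 oppr_lt0 invr_gt0.
Qed.

Lemma is_derive_bump k t : is_derive t 1 (bump k) (bump k.+2 t - k%:R * bump k.+1 t).
Proof.
have [t0|t0|->] := ltgtP t 0.
- have bt j : bump j t = 0 by rewrite /bump ltNge ltW.
  rewrite !bt mulr0 subr0.
  apply: (@near_eq_is_derive _ _ _ (cst 0)) => //.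
  near=> z; rewrite /bump; case: ifP => // z0.
  suff : z < 0 by rewrite ltNge ltW.
  near: z; exact: lt_nbhsl.
- have tn0 : t != 0 by rewrite gt_eqF.
  have d1 : is_derive t 1 (fun s : R => s^-1) _ := is_deriveV tn0 (is_derive_id t 1).
  have d2 : is_derive t 1 (fun s : R => expR (- s^-1)) _ := is_derive1_comp (is_derive_expR _) (is_deriveN d1).
  have d3 : is_derive t 1 (fun s : R => s^-1 ^+ k) ((k%:R * t^-1 ^+ k.-1) *: (- t ^- 2 *: 1)).
    have := is_deriveX k d1; rewrite (_ : (_ ^+ k) = (fun s : R => s^-1 ^+ k)) //.
    by apply/funext => s; rewrite exprfctE.
  have d4 : is_derive t 1 (fun s : R => s^-1 ^+ k * expR (- s^-1)) _ := is_deriveM d3 d2.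
  have near4 : \forall s \near t, s^-1 ^+ k * expR (- s^-1) = bump k s.
    near=> z; rewrite /bump ifT ?exprVn //; near: z; exact: lt_nbhsr.
  apply: is_derive_eq (near_eq_is_derive near4 d4) _.
  rewrite /bump t0 opprfctE /GRing.scale /= !mulr1 -!exprVn.
  case: k {d3 d4 near4} => [|k] /=.
    by rewrite !(mulr0n, mul0r, mulr0, subr0, addr0, expr0, mul1r); ring.
  by rewrite !exprS; ring.
- have b0 j : bump j 0 = 0 by rewrite /bump ltxx.
  rewrite !b0 mulr0 subr0.
  (* At the origin the quadratic bound of [bump_le_expX] leaves a difference quotient of size at
     most C |h|. *)
  have cv : h^-1 *: ((bump k \o shift 0) (h *: 1) - bump k 0) @[h --> 0^'] --> (0 : R).
    set C : R := (k + 1).+1%:R ^+ (k + 1).+1.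
    have C0 : 0 < C by rewrite exprn_gt0.
    apply/cvgrPdist_le => e e0; near=> h.
    rewrite b0 /= sub0r subr0 normrN addr0 /GRing.scale /= mulr1 normrM.
    have h0 : h != 0 by near: h; exact: nbhs_dnbhs_neq.
    rewrite normfV ler_pdivrMl ?normr_gt0 // ger0_norm ?bump_ge0 //.
    apply: le_trans (bump_le_expX k 1 h) _; rewrite -/C expr2 mulrCA ler_wpM2l //.
    rewrite -ler_pdivlMl // mulrC.
    near: h; apply: (@dnbhs0_le R R); exact: divr_gt0.
  split; last exact: cvg_lim cv.
  by apply/cvg_ex; exists 0.
Unshelve. all: by end_near.
Qed.

Lemma cvg_bump0 t :
  bump 0 (n.+1%:R * t) @[n --> \oo] --> (if 0 < t then 1 else 0 : R).
Proof.
case: ifPn => [t0|t0]; last first.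
  rewrite (_ : (fun _ => _) = cst 0); first exact: cvg_cst.
  by apply/funext => n; rewrite /bump pmulr_rgt0 ?ltr0Sn // (negbTE t0).
have -> : (fun n => bump 0 (n.+1%:R * t)) = (fun n => expR (- (harmonic n * t^-1))).
  apply/funext => n; rewrite /bump pmulr_rgt0 ?ltr0Sn // t0 expr0 invr1 mul1r.
  by rewrite invfM.
rewrite -expR0; apply: continuous_cvg; first exact: continuous_expR.
rewrite -oppr0 -(mul0r t^-1); apply: cvgN; apply: cvgMr_tmp; exact: cvg_harmonic.
Qed.

(* [bump 2] is the derivative of [bump 0], hence [dplateau] is the derivative of [plateau]. *)
Definition plateau n (e t : R) : R :=
  bump 0 (n.+1%:R * (t + e)) * bump 0 (n.+1%:R * (e - t)).

Definition dplateau n (e t : R) : R :=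
  n.+1%:R * (bump 2 (n.+1%:R * (t + e)) * bump 0 (n.+1%:R * (e - t))
           - bump 0 (n.+1%:R * (t + e)) * bump 2 (n.+1%:R * (e - t))).

Lemma plateauN n e t : plateau n e (- t) = plateau n e t.
Proof. by rewrite /plateau opprK mulrC addrC [- t + e]addrC. Qed.

Lemma dplateauN n e t : dplateau n e (- t) = - dplateau n e t.
Proof. by rewrite /dplateau opprK [- t + e]addrC [e + t]addrC; ring. Qed.

Lemma plateau_ge0 n e t : 0 <= plateau n e t.
Proof. by rewrite mulr_ge0 ?bump_ge0. Qed.

Lemma plateau_le1 n e t : plateau n e t <= 1.
Proof. by rewrite mulr_ile1 ?bump_ge0 ?bump0_le1. Qed.

Lemma is_derive_bump_affine k (a b t : R) :
  is_derive t 1 (fun s => bump k (a * s + b))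
    (a * (bump k.+2 (a * t + b) - k%:R * bump k.+1 (a * t + b))).
Proof.
have d1 : is_derive t 1 (fun s : R => a * s + b) (a *: 1 + 0).
  by apply: is_deriveD; exact: is_deriveZ.
have [D1 D2] := @is_derive1_comp R (bump k) (fun s : R => a * s + b) t _ _ (is_derive_bump k (a * t + b)) d1.
apply: (DeriveDef D1); apply: etrans D2 _.
by rewrite /GRing.scale /= mulr1 addr0 mulrC.
Qed.

Lemma is_derive_plateau n e t : is_derive t 1 (plateau n e) (dplateau n e t).
Proof.
have -> : plateau n e = (fun s => bump 0 (n.+1%:R * s + n.+1%:R * e) *
   bump 0 (- n.+1%:R * s + n.+1%:R * e)).
  by apply/funext => s; rewrite /plateau; congr (bump 0 _ * bump 0 _); ring.
apply: is_derive_eq.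
  exact: is_deriveM (is_derive_bump_affine 0 _ _ t) (is_derive_bump_affine 0 _ _ t).
rewrite /dplateau /GRing.scale /= !mul0r !subr0.
have -> : n.+1%:R * (t + e) = n.+1%:R * t + n.+1%:R * e :> R by ring.
have -> : n.+1%:R * (e - t) = - n.+1%:R * t + n.+1%:R * e :> R by ring.
ring.
Qed.

Lemma continuous_plateau n e : continuous (plateau n e).
Proof.
move=> t; apply: differentiable_continuous; apply/derivable1_diffP.
by have [] := is_derive_plateau n e t.
Qed.

Lemma continuous_bump_affine k (a b : R) : continuous (fun s => bump k (a * s + b)).
Proof.
move=> t; apply: differentiable_continuous; apply/derivable1_diffP.
by have [] := is_derive_bump_affine k a b t.
Qed.

Lemma continuous_dplateau n e : continuous (dplateau n e).
Proof.
have -> : dplateau n e = (fun t => n.+1%:R *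
   (bump 2 (n.+1%:R * t + n.+1%:R * e) * bump 0 (- n.+1%:R * t + n.+1%:R * e)
           - bump 0 (n.+1%:R * t + n.+1%:R * e) * bump 2 (- n.+1%:R * t + n.+1%:R * e))).
  apply/funext => t; rewrite /dplateau.
  have -> : n.+1%:R * (t + e) = n.+1%:R * t + n.+1%:R * e :> R by ring.
  by have -> : n.+1%:R * (e - t) = - n.+1%:R * t + n.+1%:R * e :> R by ring.
move=> t; apply: cvgM; first exact: cvg_cst.
by apply: cvgB; apply: cvgM; exact: continuous_bump_affine.
Qed.

Lemma dplateau_bounded n e : exists2 M : R, 0 < M & forall t, `|dplateau n e t| <= M.
Proof.
have [M M0 hM] := bump_bounded 2.
exists (n.+1%:R * (M + M)); first by rewrite mulr_gt0 // addr_gt0.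
move=> t; rewrite normrM normr_nat ler_pM2l ?ltr0Sn //.
apply: le_trans (ler_normB _ _) _; apply: lerD.
  rewrite normrM !ger0_norm ?bump_ge0 // -[leRHS]mulr1.
  by apply: ler_pM; rewrite ?bump_ge0 ?hM ?bump0_le1.
rewrite normrM !ger0_norm ?bump_ge0 // -[leRHS]mul1r.
by apply: ler_pM; rewrite ?bump_ge0 ?hM ?bump0_le1.
Qed.

End Bump.

Section Measurability.
Context (R : realType) (d : nat).
Local Notation pt := 'rV[R]_d.

Lemma continuous_measurable_rV (f : pt -> R) : continuous f -> measurable_fun setT f.
Proof.
move=> cf; apply: (measurability _ (RGenOpens.measurableE R)) => //.
move=> _ [_ [a [b ->]] <-]; rewrite setTI; apply: open_measurable_rV.
by apply: open_comp; [move=> x _; exact: cf|exact: interval_open].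
Qed.

Lemma measurable_coord i : measurable_fun setT (fun x : pt => x 0 i).
Proof. by apply: continuous_measurable_rV => x; exact: coord_continuous. Qed.

End Measurability.

(** * Smooth approximations of box indicators, and the kernel used for doubling variables *)

Section Kernels.
Context (R : realType) (d : nat).
Local Notation pt := 'rV[R]_d.
Local Notation e_ i := (delta_mx 0 i : pt).
Implicit Types (a b x y : pt) (n : nat) (i j : 'I_d) (e : R).

Definition boxbump n a b x : R :=
  \prod_i (bump 0 (n.+1%:R * (x 0 i - a 0 i)) * bump 0 (n.+1%:R * (b 0 i - x 0 i))).

Lemma boxbump_ge0 n a b x : 0 <= boxbump n a b x.
Proof. by apply: prodr_ge0 => i _; rewrite mulr_ge0 ?bump_ge0. Qed.

Lemma boxbump_le1 n a b x : boxbump n a b x <= 1.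
Proof.
apply: prodr_ile1 => i _; rewrite mulr_ge0 ?bump_ge0 //= mulr_ile1 ?bump_ge0 ?bump0_le1 //.
Qed.

Lemma boxbump_eq0 n a b x : ~ obox a b x -> boxbump n a b x = 0.
Proof.
move/existsNP => [i /negP]; rewrite negb_and -!leNgt => h.
have b0 (t : R) : t <= 0 -> bump 0 (n.+1%:R * t) = 0.
  by move=> t0; rewrite /bump pmulr_rgt0 ?ltr0Sn // ltNge t0.
rewrite /boxbump (bigD1 i) //=.
by case/orP : h => h; [rewrite (b0 (x 0 i - _))|rewrite (b0 (_ - x 0 i))]; rewrite ?subr_le0 // !(mul0r, mulr0).
Qed.

Lemma cvg_boxbump a b x :
  boxbump n a b x @[n --> \oo] --> (\1_(obox a b) x : R).
Proof.
have [xab|xab] := pselect (obox a b x); last first.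
  rewrite indicE memNset // (_ : (fun _ => _) = cst 0); first exact: cvg_cst.
  by apply/funext => n; rewrite boxbump_eq0.
rewrite indicE mem_set //= /boxbump.
suff H (s : seq 'I_d) : \prod_(i <- s) (bump 0 (n.+1%:R * (x 0 i - a 0 i)) *
    bump 0 (n.+1%:R * (b 0 i - x 0 i))) @[n --> \oo] --> (1 : R) by exact: H.
elim: s => [|i s ih].
  by rewrite (_ : (fun _ => _) = cst 1); [exact: cvg_cst|apply/funext => n; rewrite big_nil].
rewrite (_ : (fun _ => _) = (fun n => bump 0 (n.+1%:R * (x 0 i - a 0 i)) * bump 0 (n.+1%:R * (b 0 i - x 0 i)) *
   \prod_(i <- s) (bump 0 (n.+1%:R * (x 0 i - a 0 i)) * bump 0 (n.+1%:R * (b 0 i - x 0 i))))); last first.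
  by apply/funext => n; rewrite big_cons.
rewrite -[X in _ --> X]mulr1; apply: cvgM => //; rewrite -[X in _ --> X]mulr1; have /andP[h1 h2] := xab i.
apply: cvgM.
  by have := @cvg_bump0 R (x 0 i - a 0 i); rewrite subr_gt0 h1.
by have := @cvg_bump0 R (b 0 i - x 0 i); rewrite subr_gt0 h2.
Qed.

Definition coord_bumps : set (pt -> R) :=
  [set f | exists k j (a b : R), f = fun x => bump k (a * x 0 j + b)].

Lemma generated_prod (B : set (pt -> R)) (I : Type) (s : seq I) (F : I -> pt -> R) :
  (forall k, generated B (F k)) -> generated B (fun x => \prod_(k <- s) F k x).
Proof.
move=> h; elim: s => [|k s ih].
  by rewrite (_ : (fun _ => _) = fun=> 1); [exact: gen_cst|apply/funext => x; rewrite big_nil].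
rewrite (_ : (fun _ => _) = (fun x => F k x * \prod_(j <- s) F j x)); first exact: gen_mul.
by apply/funext => x; rewrite big_cons.
Qed.

Lemma coord_bumps_smooth f : generated coord_bumps f -> smooth f.
Proof.
apply: generated_smooth => {}f [k [j [a [b ->]]]]; split.
  move=> x; apply: (@continuous_comp _ _ _ (fun x : pt => x 0 j) (fun s => bump k (a * s + b))).
    exact: coord_continuous.
  exact: continuous_bump_affine.
move=> i.
have D x : is_derive x (e_ i) (fun x => bump k (a * x 0 j + b))
   ((i == j)%:R * (a * (bump k.+2 (a * x 0 j + b) - k%:R * bump k.+1 (a * x 0 j + b)))).
  apply: (derivable_coord (G := fun s => bump k (a * s + b))).
    by move=> h; rewrite !mxE eqxx /= eq_sym.
  exact: is_derive_bump_affine.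
split; first by move=> x; have [] := D x.
have -> : 'D_(e_ i) (fun x => bump k (a * x 0 j + b)) =
  (fun x => (i == j)%:R * (a * (bump k.+2 (a * x 0 j + b) + (- k%:R) * bump k.+1 (a * x 0 j + b)))) :> (pt -> R).
  by apply/funext => x; have [_ ->] := D x; rewrite mulNr.
apply: gen_mul; first exact: gen_cst.
apply: gen_mul; first exact: gen_cst.
apply: gen_add; first by apply: gen_base; exists k.+2, j, a, b.
apply: gen_mul; first exact: gen_cst.
by apply: gen_base; exists k.+1, j, a, b.
Qed.

Lemma smooth_boxbump n a b : smooth (boxbump n a b).
Proof.
apply: coord_bumps_smooth; apply: generated_prod => i.
apply: gen_mul; apply: gen_base.
  exists 0%N, i, n.+1%:R, (- (n.+1%:R * a 0 i)).
  by apply/funext => x; rewrite mulrBr.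
exists 0%N, i, (- n.+1%:R), (n.+1%:R * b 0 i).
by apply/funext => x; congr bump; ring.
Qed.

(* eta n e x y is a smooth approximation of the indicator of |x - y| < e. *)
Definition eta n e x y : R := \prod_i plateau n e (x 0 i - y 0 i).

Definition deta n e i x y : R :=
  dplateau n e (x 0 i - y 0 i) * \prod_(j | j != i) plateau n e (x 0 j - y 0 j).

Lemma eta_boxbumpl n e x y :
  eta n e x y = boxbump n (y - const_mx e) (y + const_mx e) x.
Proof.
by apply: eq_bigr => i _; rewrite /plateau !mxE; congr (bump 0 _ * bump 0 _); ring.
Qed.

Lemma eta_boxbumpr n e x y :
  eta n e x y = boxbump n (x - const_mx e) (x + const_mx e) y.
Proof.
by apply: eq_bigr => i _; rewrite /plateau !mxE mulrC; congr (bump 0 _ * bump 0 _); ring.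
Qed.

Lemma prod_plateau_ge0_le1 n e x y (P : pred 'I_d) :
  0 <= \prod_(j | P j) plateau n e (x 0 j - y 0 j) <= 1.
Proof.
apply/andP; split; first by apply: prodr_ge0 => j _; exact: plateau_ge0.
by apply: prodr_ile1 => i _; rewrite plateau_ge0 plateau_le1.
Qed.

Lemma deta_bounded n e i : exists2 M : R, 0 < M & forall x y, `|deta n e i x y| <= M.
Proof.
have [M M0 hM] := dplateau_bounded n e; exists M => // x y.
rewrite normrM -[leRHS]mulr1; apply: ler_pM => //.
by have /andP[h1 h2] := prod_plateau_ge0_le1 n e x y (fun j => j != i); rewrite ger0_norm.
Qed.

Lemma is_derive_etal n e i x y :
  is_derive x (e_ i) (eta n e ^~ y) (deta n e i x y).
Proof.
rewrite -[deta _ _ _ _ _]mul1r -[1]/((true : bool)%:R) -(eqxx i).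
apply: (derivable_coord (G := fun s => plateau n e (s - y 0 i) *
   \prod_(j | j != i) plateau n e (x 0 j - y 0 j))).
  move=> h; rewrite /eta (bigD1 i) //= !mxE !eqxx /=; congr (_ * _).
  by apply: eq_bigr => j ji; rewrite !mxE (negbTE ji) mulr0 add0r.
have d1 : is_derive (x 0 i) 1 (fun s => plateau n e (s - y 0 i)) (dplateau n e (x 0 i - y 0 i)).
  have d2 : is_derive (x 0 i) 1 (fun s : R => s - y 0 i) (1 - 0) by exact: is_deriveB.
  have [D1 D2] := @is_derive1_comp R (plateau n e) (fun s => s - y 0 i) (x 0 i) _ _
     (is_derive_plateau n e (x 0 i - y 0 i)) d2.
  by apply: (DeriveDef D1); apply: etrans D2 _; rewrite subr0 mulr1.
rewrite /deta mulrC.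
set c := \prod_(_ | _) _.
have [D1 D2] := is_deriveZ c d1.
rewrite (_ : (fun _ => _) = (c \*: (fun s => plateau n e (s - y 0 i)))) //.
by apply/funext => s; rewrite mulrC.
Qed.

(** The kernel is even in x - y, so the two arguments can be exchanged, which turns the derivative
    in y into minus the derivative in x. This sign is what later moves a derivative from one
    variable to the other. *)
Lemma is_derive_etar n e i x y :
  is_derive y (e_ i) (eta n e x) (- deta n e i x y).
Proof.
have -> : eta n e x = eta n e ^~ x.
  by apply/funext => z; apply: eq_bigr => j _; rewrite -plateauN opprB.
suff -> : - deta n e i x y = deta n e i y x by exact: is_derive_etal.
rewrite /deta -mulNr -dplateauN opprB; congr (_ * _).
by apply: eq_bigr => j _; rewrite -plateauN opprB.
Qed.

Lemma measurable_coord_sub i :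
  measurable_fun setT (fun z : pt * pt => z.1 0 i - z.2 0 i).
Proof.
apply: measurable_funB.
  exact: (measurableT_comp (measurable_coord i) measurable_fst).
exact: (measurableT_comp (measurable_coord i) measurable_snd).
Qed.

Lemma measurable_eta n e :
  measurable_fun setT (fun z : pt * pt => eta n e z.1 z.2).
Proof.
apply: measurable_prod => i _.
apply: measurableT_comp (measurable_coord_sub i).
by apply: continuous_measurable_fun; exact: continuous_plateau.
Qed.

Lemma measurable_deta n e i :
  measurable_fun setT (fun z : pt * pt => deta n e i z.1 z.2).
Proof.
apply: measurable_funM.
  apply: measurableT_comp (measurable_coord_sub i).
  by apply: continuous_measurable_fun; exact: continuous_dplateau.
rewrite (_ : (fun _ => _) = (fun z : pt * pt => \prod_(j <- [seq j <- index_enum 'I_d | j != i]) plateau n e (z.1 0 j - z.2 0 j))).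
  apply: measurable_prod => j _.
  apply: measurableT_comp (measurable_coord_sub j).
  by apply: continuous_measurable_fun; exact: continuous_plateau.
by apply/funext => z; rewrite big_filter.
Qed.

End Kernels.

(** * Continuous functions of compact support; integrals of derivatives *)

Section SupportedFunctions.
Context (R : realType) (d : nat).
Local Notation pt := 'rV[R]_d.
Local Notation e_ i := (delta_mx 0 i : pt).
Context (mu : {measure set pt -> \bar R}) (hmu : is_lebesgue mu).
Implicit Types (f g : pt -> R) (K : set pt).

Lemma compact_sub_obox K : compact K ->
  exists2 N : R, 0 < N & K `<=` obox (const_mx (- N)) (const_mx N).
Proof.
move=> /compact_bounded [M [Mr hM]].
exists (Num.max 1 (M + 1)); first by rewrite lt_max ltr01.
move=> x Kx i; rewrite !mxE -ltr_norml.
have h : `|x| <= M + 2^-1 by apply: hM => //; rewrite ltrDl invr_gt0.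
have h2 : `|x 0 i| <= `|x|.
  by rewrite [leRHS]/Num.norm /= mx_normrE; apply: (le_bigmax _ (fun i => `|x i.1 i.2|) (0, i)).
apply: le_lt_trans h2 _; apply: le_lt_trans h _.
by rewrite lt_max; apply/orP; right; rewrite ltrD2l invf_lt1 // ltr1n.
Qed.

Lemma compact_mu_fin K : compact K -> (mu K < +oo)%E.
Proof.
move=> cK; have [N N0 KN] := compact_sub_obox cK.
apply: le_lt_trans (mu_obox_fin hmu (const_mx (- N)) (const_mx N)).
apply: le_measure; rewrite ?inE //; last exact: measurable_obox.
apply: closed_measurable_rV; apply: compact_closed => //.
Qed.

Lemma compact_measurable_rV K : compact K -> measurable K.
Proof. by move=> cK; apply: closed_measurable_rV; exact: compact_closed. Qed.

Lemma compact_support_bounded f K : compact K -> continuous f ->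
  (forall x, ~ K x -> f x = 0) -> exists2 M : R, 0 < M & forall x, `|f x| <= M.
Proof.
move=> cK cf fK.
have /compact_bounded[M [Mr hM]] : compact (f @` K).
  by apply: continuous_compact => //; apply: continuous_subspaceT.
exists (Num.max 1 (M + 1)); first by rewrite lt_max ltr01.
move=> x; have [Kx|/fK ->] := pselect (K x); last by rewrite normr0 le_max ler01.
rewrite le_max; apply/orP; right; apply: (hM (M + 1)); first by rewrite ltrDl.
by exists x.
Qed.

Lemma compact_support_integrable f K (A : set pt) : measurable A -> compact K ->
  continuous f -> (forall x, ~ K x -> f x = 0) -> mu.-integrable A (EFin \o f).
Proof.
move=> mA cK cf fK; have [M M0 fM] := compact_support_bounded cK cf fK.
have mK := compact_measurable_rV cK.
suff : mu.-integrable setT (EFin \o f) by apply: integrableS.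
apply/(integrable_mkcond _ measurableT) => /=.
rewrite (_ : _ \_ _ = (EFin \o f) \_ K); last first.
  by apply/funext => x; rewrite !patchE in_setT; case: ifPn => // /negP; rewrite inE /= => /fK ->.
apply/(integrable_mkcond _ mK); apply: (@integrable_bounded _ _ _ _ _ _ M) => //.
- exact: compact_mu_fin.
- by apply: measurable_funTS; exact: continuous_measurable_rV.
- by apply/aeW => x _.
Qed.

Lemma derive_support f K i : compact K -> (forall x, ~ K x -> f x = 0) ->
  forall x, ~ K x -> 'D_(e_ i) f x = 0.
Proof.
move=> cK fK x nKx; rewrite (_ : 0 = 'D_(e_ i) (cst 0 : pt -> R) x); last by rewrite derive_cst.
apply: near_eq_derive.
have : nbhs x (~` K).
  apply: open_nbhs_nbhs; split => //; apply: closed_openC; exact: compact_closed.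
by apply: filterS => y /fK ->.
Qed.

Lemma is_derive_line f i x (s : R) : derivable f (s *: e_ i + x) (e_ i) ->
  is_derive s 1 (fun s => f (s *: e_ i + x)) ('D_(e_ i) f (s *: e_ i + x)).
Proof.
have eq : (fun h : R => h^-1 *: (((fun s => f (s *: e_ i + x)) \o shift s) (h *: (1 : R)) - f (s *: e_ i + x))) =
   (fun h : R => h^-1 *: ((f \o shift (s *: e_ i + x)) (h *: e_ i) - f (s *: e_ i + x))).
  by apply/funext => h /=; rewrite [h%:A](_ : _ = h) ?scalerDl ?addrA //; exact: mulr1.
by move=> df; split; rewrite /derivable /derive eq.
Qed.

Lemma difference_le f i x (M h : R) : 0 < h -> (forall y, derivable f y (e_ i)) ->
  (forall y, `|'D_(e_ i) f y| <= M) -> `|f (h *: e_ i + x) - f x| <= M * h.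
Proof.
move=> h0 df dM; pose g (s : R) := f (s *: e_ i + x).
have dg (s : R) : is_derive s 1 g ('D_(e_ i) f (s *: e_ i + x)).
  by apply: is_derive_line; exact: df.
have [c _] := @MVT R g (fun s => 'D_(e_ i) f (s *: e_ i + x)) 0 h h0 (fun s _ => dg s)
  (derivable_within_continuous (fun s _ => @ex_derive _ _ _ _ _ _ _ (dg s))).
rewrite /g scale0r add0r subr0 => ->; rewrite normrM (gtr0_norm h0) ler_wpM2r //.
exact: ltW.
Qed.

Lemma Rintegral_shift f (v : pt) : mu.-integrable setT (EFin \o f) ->
  mu.-integrable setT (EFin \o (fun x => f (x + v))) /\
  \int[mu]_x f (x + v) = \int[mu]_x f x.
Proof.
move=> fi; have mf := measurable_int _ fi.
pose M := measure_function_pushforward__canonical__measure_function_Measure mu (measurable_shift v).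
have Mmu (A : set pt) : measurable A -> A `<=` setT -> M A = mu A.
  by move=> mA _; exact: (lebesgue_shift hmu v mA).
have fvi : mu.-integrable setT (EFin \o (fun x => f (x + v))).
  apply/integrableP; split; first exact: (measurableT_comp mf (measurable_shift v)).
  have /integrableP[_] := fi.
  rewrite -(@eq_measure_integral _ _ _ _ mu M _ Mmu).
  have := @ge0_integral_pushforward _ _ _ _ R _ (measurable_shift v) mu setT (fun x => `|(f x)%:E|)%E measurableT.
  rewrite preimage_setT => <- //; exact: measurableT_comp.
split=> //; rewrite /Rintegral; congr fine.
have := @integral_pushforward _ _ _ _ R _ (measurable_shift v) mu setT (EFin \o f) mf.
rewrite preimage_setT => /(_ fvi measurableT) <-.
exact: (@eq_measure_integral _ _ _ _ mu M _ Mmu).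
Qed.

Lemma harmonic_cvg_dnbhs : (@harmonic R) n @[n --> \oo] --> 0^'.
Proof.
move=> A; rewrite /dnbhs /= => hA.
have hA' : \forall n \near \oo, harmonic n != 0 -> A (harmonic n) := @cvg_harmonic R _ hA.
suff : \forall n \near \oo, A (harmonic n) by [].
by apply: filterS hA' => n; apply; rewrite /= invr_eq0 pnatr_eq0.
Qed.

(** By translation invariance every difference quotient in direction i has integral 0, and the
    quotients converge dominatedly to the derivative. No iterated integration is involved. *)
Lemma integral_derive_eq0 f K i : compact K -> (forall x, ~ K x -> f x = 0) ->
  smooth f -> \int[mu]_x 'D_(e_ i) f x = 0.
Proof.
move=> cK fK sf; have cf := smooth_continuous sf.
have df0 := derive_support i cK fK.
have cdf : continuous ('D_(e_ i) f) by exact/smooth_continuous/smooth_derive.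
have [M M0 dM] := compact_support_bounded cK cdf df0.
have fi := compact_support_integrable measurableT cK cf fK.
have [N N0 KN] := compact_sub_obox cK.
(* The steps [harmonic n] are at most 1, so enlarging the cube around the support by 1 covers the
   supports of all the quotients. *)
pose Q : set pt := obox (const_mx (- (N + 1))) (const_mx (N + 1)).
have mQ : measurable Q by exact: measurable_obox.
pose q n x := (harmonic n)^-1 * (f (harmonic n *: e_ i + x) - f x) : R.
have hn0 n : 0 < harmonic n :> R by rewrite invr_gt0.
have hn1 n : harmonic n <= 1 :> R by rewrite invf_le1 ?ltr0Sn // ler1n.
have q0 n : \int[mu]_x q n x = 0.
  have [fi1 fi2] := Rintegral_shift (harmonic n *: e_ i) fi.
  rewrite /q RintegralZl //; last first.
    apply: integrable_fsub => //; apply: eq_integrable fi1 => //= x _.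
    by rewrite addrC.
  rewrite RintegralB //; last first.
    by apply: eq_integrable fi1 => //= x _; rewrite addrC.
  rewrite (_ : \int[mu]_x f (harmonic n *: 'e_i + x) = \int[mu]_x f (x + harmonic n *: 'e_i)).
    by rewrite fi2 subrr mulr0.
  by apply: eq_Rintegral => x _; rewrite addrC.
have qb n x : `|q n x| <= M * \1_Q x.
  have [Qx|Qx] := pselect (Q x).
    rewrite indicE mem_set // mulr1 /q normrM gtr0_norm ?invr_gt0 // ler_pdivrMl // mulrC.
    by apply: difference_le => // y; exact: smooth_derivable.
  rewrite indicE memNset // mulr0 /q normr_le0 mulf_eq0; apply/orP; right.
  rewrite !fK ?subrr // => /KN h; apply: Qx => j; have := h j; rewrite !mxE.
    by move=> /andP[? ?]; apply/andP; split; lra.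
  have h01 (b : bool) : (0 : R) <= (harmonic n : R) * b%:R <= (1 : R).
    by case: b; rewrite ?mulr1 ?mulr0 ?lexx ?ler01 // hn1 ltW.
  rewrite eqxx /=; have := h01 (j == i); move: (_ * _) => t.
  by move=> /andP[? ?] /andP[? ?]; apply/andP; split; lra.
have cq x : q n x @[n --> \oo] --> 'D_(e_ i) f x.
  have := @smooth_derivable _ _ f x i sf => /derivableP[] + _ => df.
  have := cvg_comp _ _ harmonic_cvg_dnbhs df.
  by apply.
have : \int[mu]_x q n x @[n --> \oo] --> \int[mu]_x 'D_(e_ i) f x.
  apply: (@Rdominated_convergence _ _ _ _ _ _ _ (fun x => M * \1_Q x)) => //.
  - move=> n; apply: measurable_funM => //; apply: measurable_funB.
      apply: continuous_measurable_rV => x; apply: continuous_comp; last exact: cf.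
      by apply: continuousD; [exact: cst_continuous|].
    exact: continuous_measurable_rV.
  - exact: continuous_measurable_rV.
  - by apply/aeW => x _; exact: cq.
  - apply: integrable_fscale => //; apply: integrable_indic_fin => //; exact: mu_obox_fin.
  - by apply/aeW => x n _; exact: qb.
under eq_fun do rewrite q0.
by move=> /(cvg_lim (@Rhausdorff R)) <-; rewrite lim_cst.
Qed.

End SupportedFunctions.

(** * Weak derivatives *)

Section WeakDerivatives.
Context (R : realType) (d : nat).
Local Notation pt := 'rV[R]_d.
Local Notation e_ i := (delta_mx 0 i : pt).
Context (mu : {measure set pt -> \bar R}) (hmu : is_lebesgue mu).
Context (D : set pt) (oD : open D).
Implicit Types (f g w v z : pt -> R) (K : set pt) (i : 'I_d).
Let mD : measurable D := open_measurable_rV oD.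

Lemma test_smooth f : test_function D f -> smooth f.
Proof. by case. Qed.

Lemma test_mul f g : smooth g -> test_function D f -> test_function D (fun x => f x * g x).
Proof.
move=> sg tf; have sf := test_smooth tf; have [s1 s2] := smooth_mul sf sg.
by case: tf => _ _ [K [cK KD fK]]; split=> //; exists K; split=> // x /fK ->; rewrite mul0r.
Qed.

Lemma test_add f g : test_function D f -> test_function D g ->
  test_function D (fun x => f x + g x).
Proof.
move=> tf tg; have [s1 s2] := smooth_add (test_smooth tf) (test_smooth tg).
case: tf tg => _ _ [K [cK KD fK]] [_ _ [K' [cK' KD' fK']]]; split=> //.
exists (K `|` K'); split; first exact: compactU.
  by rewrite subUset.
by move=> x /not_orP[/fK -> /fK' ->]; rewrite addr0.
Qed.

Lemma test_scale (c : R) f : test_function D f -> test_function D (fun x => c * f x).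
Proof.
move=> tf; have := test_mul (smooth_cst d c) tf.
by under eq_fun do rewrite mulrC.
Qed.

Lemma test_boxbump n a b : cbox a b `<=` D -> test_function D (boxbump n a b).
Proof.
move=> abD; have [s1 s2] := smooth_boxbump n a b; split=> //.
exists (cbox a b); split=> //; first exact: compact_cbox.
move=> x nx; apply: boxbump_eq0 => /obox_cbox; exact: nx.
Qed.

Lemma test_continuous f : test_function D f -> continuous f.
Proof. by move/test_smooth/smooth_continuous. Qed.

Lemma pderiv1_support f i K : compact K -> (forall x, ~ K x -> f x = 0) ->
  forall x, ~ K x -> pderiv [:: i] f x = 0.
Proof. exact: derive_support. Qed.

Lemma test_pderiv1 f i : test_function D f -> test_function D (pderiv [:: i] f).
Proof.
move=> tf; have [s1 s2] := smooth_pderiv [:: i] (test_smooth tf).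
case: tf => _ _ [K [cK KD fK]]; split=> //; exists K; split=> //.
exact: pderiv1_support.
Qed.

Lemma test_integrable f A : measurable A -> test_function D f -> mu.-integrable A (EFin \o f).
Proof.
move=> mA tf; have cf := test_continuous tf; case: tf => _ _ [K [cK _ fK]].
exact: compact_support_integrable cK cf fK.
Qed.

Lemma test_bounded f : test_function D f -> exists2 M : R, 0 < M & forall x, `|f x| <= M.
Proof.
move=> tf; have cf := test_continuous tf; case: tf => _ _ [K [cK _ fK]].
exact: compact_support_bounded cK cf fK.
Qed.

Lemma test_measurable f A : measurable A -> test_function D f -> measurable_fun A f.
Proof.
by move=> mA tf; apply: measurable_funTS; apply: continuous_measurable_rV; exact: test_continuous.
Qed.

Lemma L1loc_test w f : in_L1loc mu D w -> test_function D f ->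
  mu.-integrable D (EFin \o (fun x => w x * f x)).
Proof.
move=> [mw wK] tf; have cf := test_continuous tf; have [M M0 fM] := test_bounded tf.
case: tf => _ _ [K [cK KD fK]].
have mK := compact_measurable_rV cK.
have : mu.-integrable K (EFin \o (fun x => w x * f x)).
  apply: (@integrableM_bounded _ _ _ _ _ _ _ M) => //.
  - exact: wK.
  - by apply: measurable_funTS; exact: continuous_measurable_rV.
  - by apply/aeW => x _; exact: fM.
move/(integrable_mkcond _ mK) => h; apply/(integrable_mkcond _ mD).
apply: eq_integrable h => // x _; rewrite !patchE.
have [Kx|Kx] := pselect (K x).
  by rewrite !mem_set //; exact: KD.
by rewrite (memNset Kx); case: ifPn => //= _; rewrite fK // mulr0.
Qed.

Lemma test_L1loc f : test_function D f -> in_L1loc mu D f.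
Proof.
move=> tf; split; first exact: test_measurable.
by move=> K cK KD; apply: test_integrable => //; exact: compact_measurable_rV.
Qed.

Lemma Rintegral_pderiv_test f i : test_function D f -> \int[mu]_(x in D) pderiv [:: i] f x = 0.
Proof.
move=> tf; have sf := test_smooth tf; case: (tf) => _ _ [K [cK KD fK]].
rewrite -[RHS](integral_derive_eq0 hmu i cK fK sf) Rintegral_mkcond.
apply: eq_Rintegral => x _; rewrite patchE; case: ifPn => // /negP nDx.
by rewrite (derive_support i cK fK) // => /KD h; apply: nDx; rewrite inE.
Qed.

(** Integration by parts: the product of two test functions is a test function, and the integral of
    its derivative is 0. *)
Lemma weak_deriv_test f i : test_function D f -> is_weak_deriv mu D i f (pderiv [:: i] f).
Proof.
move=> tf; split; [exact: test_L1loc|exact/test_L1loc/test_pderiv1|].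
move=> g tg.
have sf := test_smooth tf; have sg := test_smooth tg.
have := Rintegral_pderiv_test i (test_mul sg tf).
have -> : pderiv [:: i] (fun x => f x * g x) =
   (fun x => f x * pderiv [:: i] g x + pderiv [:: i] f x * g x).
  apply/funext => x /=; rewrite [_ * g x]mulrC.
  exact: (deriveM (@smooth_derivable _ _ _ x i sf) (@smooth_derivable _ _ _ x i sg)).
rewrite RintegralD //.
- by move/eqP; rewrite addr_eq0 => /eqP.
- by apply: L1loc_test; [exact: test_L1loc|exact: test_pderiv1].
- by apply: L1loc_test => //; apply: test_L1loc; exact: test_pderiv1.
Qed.

Lemma is_weak_deriv_linear i (c : R) w z v y : is_weak_deriv mu D i w z ->
  is_weak_deriv mu D i v y ->
  is_weak_deriv mu D i (fun x => c * w x + v x) (fun x => c * z x + y x).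
Proof.
have L1lin a b : in_L1loc mu D a -> in_L1loc mu D b -> in_L1loc mu D (fun x => c * a x + b x).
  move=> [ma ia] [mb ib]; split; first by apply: measurable_funD => //; exact: measurable_funM.
  move=> K cK KD; have mK := compact_measurable_rV cK; apply: integrable_fadd => //; last exact: ib.
  by apply: integrable_fscale => //; exact: ia.
move=> [lw lz h1] [lv ly h2]; split; [exact: L1lin|exact: L1lin|] => f tf.
have E a b g : in_L1loc mu D a -> in_L1loc mu D b -> test_function D g ->
   \int[mu]_(x in D) ((c * a x + b x) * g x) =
   c * \int[mu]_(x in D) (a x * g x) + \int[mu]_(x in D) (b x * g x).
  move=> la lb tg; under eq_Rintegral do rewrite mulrDl -mulrA.
  rewrite RintegralD //; last exact: L1loc_test.
    by rewrite RintegralZl //; exact: L1loc_test.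
  by apply: integrable_fscale => //; exact: L1loc_test.
by rewrite !E // ?h1 ?h2 //; [ring|exact: test_pderiv1].
Qed.

(** Box bumps increase the class of admissible test objects to indicators of boxes whose closure
    lies in D. Dynkin's lemma inside one such box then makes the integral of z vanish on all its
    Borel subsets, hence z = 0 there almost everywhere, and countably many rational boxes cover
    D. *)
Lemma fundamental_lemma z : in_L1loc mu D z ->
  (forall f, test_function D f -> \int[mu]_(x in D) (z x * f x) = 0) ->
  {ae mu, forall x, D x -> z x = 0}.
Proof.
move=> lz hz; have [mz iz] := lz.
have box0 a b : cbox a b `<=` D -> \int[mu]_(x in cbox a b) (z x * \1_(obox a b) x) = 0.
  move=> abD; have mc := measurable_cbox a b.
  have cv : \int[mu]_(x in cbox a b) (z x * boxbump n a b x) @[n --> \oo] -->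
      \int[mu]_(x in cbox a b) (z x * \1_(obox a b) x).
    apply: (@Rdominated_convergence _ _ _ _ _ _ _ (fun x => `|z x|)) => //.
    - move=> n; apply: measurable_funM; first exact: measurable_funS abD mz.
      by apply: measurable_funTS; apply: continuous_measurable_rV; apply/smooth_continuous/smooth_boxbump.
    - apply: measurable_funM; first exact: measurable_funS abD mz.
      by apply: measurable_indic; exact: measurable_obox.
    - apply/aeW => x _; apply: cvgMl_tmp; exact: cvg_boxbump.
    - apply: integrable_fnorm => //; apply: iz => //; exact: compact_cbox.
    - apply/aeW => x n _; rewrite normrM ler_piMr // ger0_norm ?boxbump_ge0 //; exact: boxbump_le1.
  have : (fun n => \int[mu]_(x in cbox a b) (z x * boxbump n a b x)) = cst 0.
    apply/funext => n; rewrite -(hz _ (test_boxbump n abD)) Rintegral_mkcond [RHS]Rintegral_mkcond.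
    apply: eq_Rintegral => x _; rewrite !patchE.
    have [Kx|Kx] := pselect (cbox a b x).
      by rewrite !mem_set //; exact: abD.
    rewrite (memNset Kx); case: ifPn => //= _; rewrite boxbump_eq0 ?mulr0 // => /obox_cbox; exact: Kx.
  move=> E; move: cv; rewrite E => /(cvg_lim (@Rhausdorff R)) <-; exact: lim_cst.
have ae0 (q : 'rV[rat]_d * 'rV[rat]_d) : cbox (map_mx ratr q.1) (map_mx ratr q.2) `<=` D ->
  {ae mu, forall x, obox (map_mx ratr q.1) (map_mx ratr q.2) x -> z x = 0}.
  set a : pt := map_mx _ _; set b : pt := map_mx _ _ => abD.
  have mB := measurable_obox a b; have mC := measurable_cbox a b.
  have iC : mu.-integrable (cbox a b) (EFin \o z) by apply: iz => //; exact: compact_cbox.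
  have iB : mu.-integrable (obox a b) (EFin \o z) by apply: integrableS iC => //; exact: obox_cbox.
  pose J E := \int[mu]_(x in obox a b) (z x * \1_E x).
  have iJ E : measurable E -> mu.-integrable (obox a b) (EFin \o (fun x => z x * \1_E x)).
    move=> mE; apply: (@integrableM_bounded _ _ _ _ _ _ _ 1) => //.
    by apply/aeW => x _; rewrite ger0_norm // indicE; case: (_ \in _).
  have J0 E : measurable E -> measurable E /\ J E = 0.
    apply: (@obox_induction _ _ (fun E => measurable E /\ J E = 0)).
    - move=> a' b'; split; first exact: measurable_obox.
      rewrite /J Rintegral_indicr oboxI.
      set a2 := \row_i _; set b2 := \row_i _.
      rewrite -(@box0 a2 b2) ?Rintegral_indicr ?setIidr //; first exact: obox_cbox.
      apply: subset_trans abD => x h j; have := h j; rewrite !mxE ge_max le_min.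
      by move=> /andP[/andP[-> _] /andP[-> _]].
    - split=> //; rewrite /J Rintegral_indicr setIT -(box0 _ _ abD).
      by rewrite Rintegral_indicr setIidr //; exact: obox_cbox.
    - move=> A B BA [mA JA] [mB' JB]; split; first exact: measurableD.
      transitivity (J A - J B); last by rewrite JA JB subrr.
      rewrite /J -RintegralB //; try exact: iJ.
      by apply: eq_Rintegral => x _; rewrite -mulrBr indicSD.
    - move=> F ndF hF; split; first by apply: bigcupT_measurable => k; have [] := hF k.
      have cv : J (F n) @[n --> \oo] --> J (\bigcup_n F n).
        apply: (@Rdominated_convergence _ _ _ _ _ _ _ (fun x => `|z x|)) => //.
        + move=> n; apply/measurable_EFinP; apply: measurable_int (iJ _ _); by have [] := hF n.
        + apply/measurable_EFinP; apply: measurable_int (iJ _ _).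
          by apply: bigcupT_measurable => k; have [] := hF k.
        + apply/aeW => x _; by apply: cvgMl_tmp; exact: cvg_indic_bigcup.
        + exact: integrable_fnorm.
        + by apply/aeW => x n _; rewrite normrM ler_piMr // indicE; case: (_ \in _); rewrite ?normr1 ?normr0.
      move: cv; rewrite (_ : (fun n => J (F n)) = cst 0); last first.
        by apply/funext => n; have [] := hF n.
      by move=> /(cvg_lim (@Rhausdorff R)) <-; rewrite lim_cst.
  have H E : E `<=` obox a b -> measurable E ->
      (\int[mu]_(x in E) (EFin \o z) x = \int[mu]_(x in E) (cst 0 x))%E.
    move=> EB mE.
    have := (J0 E mE).2; rewrite /J Rintegral_indicr (setIidr EB) => h.
    rewrite integral0 -[LHS]fineK; first by rewrite -/(Rintegral _ _ _) h.
    by apply: integrable_fin_num => //; exact: integrableS iB.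
  have := @integral_ae_eq _ _ _ mu (obox a b) mB (cst 0%E) (EFin \o z) iB (measurable_cst _) H.
  by apply: filterS => x h Bx; have [] := h Bx.
(* The pairs of rational corners are enumerated by [unpickle], so that only countably many null sets
   are united. *)
have : {ae mu, forall x (n : nat), if unpickle n is Some q then
    (cbox (map_mx ratr (q : 'rV[rat]_d * 'rV[rat]_d).1) (map_mx ratr q.2) `<=` D ->
     obox (map_mx ratr q.1) (map_mx ratr q.2) x -> z x = 0) else True}.
  apply/ae_foralln => n; case: (unpickle n) => [q|]; last exact/aeW.
  have [/ae0|h] := pselect (cbox (map_mx ratr q.1) (map_mx ratr q.2) `<=` D).
    by apply: filterS => x h _.
  by apply/aeW => x /h.
apply: filterS => x h Dx; have [a [b [xab abD _]]] := openU_obox oD Dx.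
have := h (pickle (a, b)); rewrite pickleK; exact.
Qed.

Lemma weak_deriv_unique i w z1 z2 : is_weak_deriv mu D i w z1 ->
  is_weak_deriv mu D i w z2 -> {ae mu, forall x, D x -> z1 x = z2 x}.
Proof.
move=> h1 h2; have [lw lz h] := is_weak_deriv_linear (-1) h1 h2.
have : {ae mu, forall x, D x -> (fun x => -1 * z1 x + z2 x) x = 0}.
  apply: fundamental_lemma => // f tf.
  apply/eqP; rewrite -oppr_eq0 -h //; apply/eqP; rewrite -[RHS](@Rintegral_set0 _ _ _ mu (cst 0)) Rintegral_mkcond [RHS]Rintegral_mkcond.
  by apply: eq_Rintegral => x _; rewrite !patchE mulN1r addNr mul0r; case: ifP; case: ifP.
apply: filterS => x hx Dx; have /eqP := hx Dx.
by rewrite mulN1r addrC subr_eq0 => /eqP.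
Qed.

Lemma wderivP i w : weakly_derivable mu D i w -> is_weak_deriv mu D i w (wderiv mu D i w).
Proof. by move=> [z hz]; exact: (@xgetPex _ (fun=> 0) [set z | is_weak_deriv mu D i w z] (ex_intro _ z hz)). Qed.

Lemma wderiv_ae i w z : is_weak_deriv mu D i w z ->
  {ae mu, forall x, D x -> wderiv mu D i w x = z x}.
Proof. by move=> hz; apply: (weak_deriv_unique (w := w) (i := i)) => //; apply: wderivP; exists z. Qed.

End WeakDerivatives.

(** * The spaces L2, H1 and their bilinear forms *)

Section SemiInner.
Context (R : realType) (E : lmodType R) (V : set E) (B : E -> E -> R).
Hypothesis Vlin : forall (c : R) u v, V u -> V v -> V (c *: u + v).
Hypothesis Blin : forall (c : R) u v w, V u -> V v -> V w ->
  B (c *: u + v) w = c * B u w + B v w.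
Hypothesis Bsym : forall u v, V u -> V v -> B u v = B v u.
Hypothesis Bge0 : forall u, V u -> 0 <= B u u.

Lemma semi_inner_expand (c : R) u v : V u -> V v ->
  B (c *: u + v) (c *: u + v) = c ^+ 2 * B u u + 2 * c * B u v + B v v.
Proof.
move=> Vu Vv; have Vuv := Vlin c Vu Vv.
rewrite Blin // (Bsym Vu Vuv) (Bsym Vv Vuv) !Blin // (Bsym Vv Vu); ring.
Qed.

(** Since functions are not identified almost everywhere, B is only semi-definite. The usual
    minimising c = - B(u,v) / B(u,u) needs B(u,u) nonzero; otherwise the quadratic in c is affine
    and cannot stay nonnegative unless B(u,v) = 0. *)
Lemma semi_inner_CS2 u v : V u -> V v -> B u v ^+ 2 <= B u u * B v v.
Proof.
move=> Vu Vv.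
have h c : 0 <= c ^+ 2 * B u u + 2 * c * B u v + B v v.
  by rewrite -semi_inner_expand // Bge0 //; exact: Vlin.
have [u0|u0] := eqVneq (B u u) 0.
  rewrite u0 mul0r; have [->|uv0] := eqVneq (B u v) 0; first by rewrite expr0n.
  (* For this c the affine expression is equal to -1. *)
  have := h (- (B v v + 1) / (2 * B u v)); rewrite u0 mulr0 add0r.
  have -> : 2 * (- (B v v + 1) / (2 * B u v)) * B u v = - (B v v + 1).
    by field.
  by lra.
have up : 0 < B u u by rewrite lt_def u0 Bge0.
have := h (- B u v / B u u).
have -> : (- B u v / B u u) ^+ 2 * B u u + 2 * (- B u v / B u u) * B u v + B v v =
  (B u u * B v v - B u v ^+ 2) / B u u by field.
by rewrite pmulr_lge0 ?invr_gt0 // subr_ge0.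
Qed.

Lemma semi_inner_CS u v : V u -> V v ->
  `|B u v| <= Num.sqrt (B u u) * Num.sqrt (B v v).
Proof.
by move=> Vu Vv; rewrite -sqrtrM ?Bge0 // -sqrtr_sqr ler_wsqrtr // semi_inner_CS2.
Qed.

Lemma semi_inner_triangle c u v : V u -> V v ->
  Num.sqrt (B (c *: u + v) (c *: u + v)) <=
  `|c| * Num.sqrt (B u u) + Num.sqrt (B v v).
Proof.
move=> Vu Vv; rewrite -[leRHS]ger0_norm ?addr_ge0 ?mulr_ge0 ?sqrtr_ge0 //.
rewrite -sqrtr_sqr ler_wsqrtr // semi_inner_expand // sqrrD exprMn real_normK ?num_real //.
rewrite !sqr_sqrtr ?Bge0 // lerD2r lerD2l.
apply: le_trans (ler_norm _) _; rewrite !normrM normr_nat -mulrA -[leRHS]mulr_natl ler_wpM2l //.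
by rewrite -mulrA ler_wpM2l // semi_inner_CS.
Qed.

End SemiInner.

Lemma finite_CS (R : realType) (I : finType) (x y : I -> R) :
  (forall i, 0 <= x i) -> (forall i, 0 <= y i) ->
  \sum_i x i * y i <= Num.sqrt (\sum_i x i ^+ 2) * Num.sqrt (\sum_i y i ^+ 2).
Proof.
move=> x0 y0.
pose B (f g : I -> R) := \sum_i f i * g i.
have := @semi_inner_CS R _ setT B (fun _ _ _ _ _ => Logic.I) _ _ _ x y Logic.I Logic.I.
have E f : B f f = \sum_i f i ^+ 2 by apply: eq_bigr => i _; rewrite expr2.
rewrite !E => h; apply: le_trans (ler_norm _) _; apply: h.
- move=> c u v w _ _ _; rewrite /B mulr_sumr -big_split /=; apply: eq_bigr => i _.
  by rewrite mulrDl mulrA.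
- by move=> u v _ _; apply: eq_bigr => i _; rewrite mulrC.
- by move=> u _; rewrite E; apply: sumr_ge0 => i _; exact: sqr_ge0.
Qed.

Section L2.
Context (R : realType) (d : nat).
Local Notation pt := 'rV[R]_d.
Context (mu : {measure set pt -> \bar R}) (D : set pt).
Hypothesis mD : measurable D.
Implicit Types (f g c : pt -> R).

Lemma L2_measurable f : in_L2 mu D f -> measurable_fun D f.
Proof. by case. Qed.

Lemma L2_sqr_integrable f : in_L2 mu D f <->
  measurable_fun D f /\ mu.-integrable D (EFin \o (fun x => f x ^+ 2)).
Proof.
split=> [[mf foo]|[mf /integrableP[_ foo]]]; split=> //.
  apply/integrableP; split; first by apply/measurable_EFinP; exact: measurable_funX.
  by under eq_integral do rewrite /= ger0_norm ?sqr_ge0 //.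
by under eq_integral do rewrite -(ger0_norm (sqr_ge0 _)).
Qed.

Lemma L2_mul_integrable f g : in_L2 mu D f -> in_L2 mu D g ->
  mu.-integrable D (EFin \o (fun x => f x * g x)).
Proof.
move=> /L2_sqr_integrable[mf fi] /L2_sqr_integrable[mg gi].
apply: (@ae_le_integrable _ _ _ _ _ _ (fun x => f x ^+ 2 + g x ^+ 2)) => //.
- exact: measurable_funM.
- exact: integrable_fadd.
- apply/aeW => x _; rewrite ler_norml; have := sqr_ge0 (f x + g x); have := sqr_ge0 (f x - g x).
  rewrite (sqrrB (f x)) (sqrrD (f x)); have := sqr_ge0 (f x); have := sqr_ge0 (g x).
  by move=> ? ? ? ?; apply/andP; split; lra.
Qed.

Lemma L2_linear (k : R) f g : in_L2 mu D f -> in_L2 mu D g -> in_L2 mu D (k *: f + g).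
Proof.
move=> Lf Lg; have [mf fi] := (L2_sqr_integrable f).1 Lf; have [mg gi] := (L2_sqr_integrable g).1 Lg.
apply/L2_sqr_integrable; split; first by apply: measurable_funD => //; exact: measurable_funM.
have := integrable_fadd mD (integrable_fscale (k ^+ 2) mD fi)
  (integrable_fadd mD (integrable_fscale (2 * k) mD (L2_mul_integrable Lf Lg)) gi).
apply: eq_integrable => // x _ /=; congr EFin.
by rewrite !fctE /GRing.scale /=; ring.
Qed.

Lemma L2_0 : in_L2 mu D 0.
Proof.
by split; [exact: measurable_cst|rewrite integral0_eq ?ltry // => x _; rewrite expr0n].
Qed.

Lemma L2dot_sym f g : L2dot mu D f g = L2dot mu D g f.
Proof. by apply: eq_Rintegral => x _; rewrite mulrC. Qed.

Lemma L2dot_linear (k : R) f g w : in_L2 mu D f -> in_L2 mu D g -> in_L2 mu D w ->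
  L2dot mu D (k *: f + g) w = k * L2dot mu D f w + L2dot mu D g w.
Proof.
move=> Lf Lg Lw; rewrite /L2dot -RintegralZl //; last exact: L2_mul_integrable.
rewrite -RintegralD //; first by apply: eq_Rintegral => x _; rewrite !fctE /GRing.scale /=; ring.
  by apply: integrable_fscale => //; exact: L2_mul_integrable.
exact: L2_mul_integrable.
Qed.

Lemma L2dot_linearr (k : R) f g w : in_L2 mu D f -> in_L2 mu D g -> in_L2 mu D w ->
  L2dot mu D w (k *: f + g) = k * L2dot mu D w f + L2dot mu D w g.
Proof. by move=> Lf Lg Lw; rewrite !(L2dot_sym w) L2dot_linear. Qed.

Lemma L2dot_ge0 f : 0 <= L2dot mu D f f.
Proof. by apply: Rintegral_ge0 => x _; rewrite -expr2 sqr_ge0. Qed.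

Lemma L2normE f : L2norm mu D f = Num.sqrt (L2dot mu D f f).
Proof. by rewrite /L2norm; congr Num.sqrt; apply: eq_Rintegral => x _; rewrite expr2. Qed.

Lemma L2norm_ge0 f : 0 <= L2norm mu D f.
Proof. exact: sqrtr_ge0. Qed.

Lemma L2norm_sqr f : L2norm mu D f ^+ 2 = L2dot mu D f f.
Proof. by rewrite L2normE sqr_sqrtr // L2dot_ge0. Qed.

Lemma L2_CS f g : in_L2 mu D f -> in_L2 mu D g ->
  `|L2dot mu D f g| <= L2norm mu D f * L2norm mu D g.
Proof.
move=> Lf Lg; rewrite !L2normE.
apply: (@semi_inner_CS R (pt -> R) (in_L2 mu D)) => //.
- by move=> ? ? ?; exact: L2_linear.
- by move=> ? ? ? ?; exact: L2dot_linear.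
- by move=> ? ? _ _; exact: L2dot_sym.
- by move=> ? _; exact: L2dot_ge0.
Qed.

Lemma L2_triangle (k : R) f g : in_L2 mu D f -> in_L2 mu D g ->
  L2norm mu D (k *: f + g) <= `|k| * L2norm mu D f + L2norm mu D g.
Proof.
move=> Lf Lg; rewrite !L2normE.
apply: (@semi_inner_triangle R (pt -> R) (in_L2 mu D)) => //.
- by move=> ? ? ?; exact: L2_linear.
- by move=> ? ? ? ?; exact: L2dot_linear.
- by move=> ? ? _ _; exact: L2dot_sym.
- by move=> ? _; exact: L2dot_ge0.
Qed.

Lemma L2_ae f g : in_L2 mu D f -> measurable_fun D g ->
  {ae mu, forall x, D x -> f x = g x} -> in_L2 mu D g.
Proof.
move=> /L2_sqr_integrable[mf fi] mg fg; apply/L2_sqr_integrable; split=> //.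
apply: ae_le_integrable fi _ => //; first exact: measurable_funX.
by apply: filterS fg => x h Dx; rewrite -h // ger0_norm // sqr_ge0.
Qed.

Lemma L2dot_ae f f' g g' : measurable_fun D f -> measurable_fun D g ->
  measurable_fun D f' -> measurable_fun D g' ->
  {ae mu, forall x, D x -> f x = f' x} -> {ae mu, forall x, D x -> g x = g' x} ->
  L2dot mu D f g = L2dot mu D f' g'.
Proof.
move=> mf mg mf' mg' ff gg; apply: ae_eq_Rintegral => //; try exact: measurable_funM.
by apply: filterS2 ff gg => x h1 h2 Dx; rewrite h1 // h2.
Qed.

Lemma L2_mul_bounded c f (M : R) : 0 <= M -> measurable_fun D c ->
  {ae mu, forall x, D x -> `|c x| <= M} -> in_L2 mu D f ->
  in_L2 mu D (fun x => c x * f x) /\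
  L2norm mu D (fun x => c x * f x) <= M * L2norm mu D f.
Proof.
move=> M0 mc cM /L2_sqr_integrable[mf fi].
have mcf : measurable_fun D (fun x => c x * f x) by exact: measurable_funM.
have le : {ae mu, forall x, D x -> (c x * f x) ^+ 2 <= M ^+ 2 * f x ^+ 2}.
  apply: filterS cM => x h Dx; rewrite exprMn ler_wpM2r ?sqr_ge0 //.
  by rewrite -[c x ^+ 2]real_normK ?num_real // lerXn2r ?nnegrE ?h.
have Mi := integrable_fscale (M ^+ 2) mD fi.
have ci : mu.-integrable D (EFin \o (fun x => (c x * f x) ^+ 2)).
  apply: ae_le_integrable Mi _ => //; first exact: measurable_funX.
  by apply: filterS le => x h Dx; rewrite ger0_norm ?sqr_ge0 // h.
split; first exact/L2_sqr_integrable.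
rewrite /L2norm -{1}(ger0_norm M0) -sqrtr_sqr -sqrtrM ?sqr_ge0 // ler_wsqrtr //.
rewrite -RintegralZl //; exact: ae_le_Rintegral.
Qed.

Hypothesis Doo : (mu D < +oo)%E.

Lemma bounded_L2 f (M : R) : measurable_fun D f ->
  {ae mu, forall x, D x -> `|f x| <= M} -> in_L2 mu D f.
Proof.
move=> mf fM; apply/L2_sqr_integrable; split=> //.
apply: (@integrable_bounded _ _ _ _ _ _ (M ^+ 2)) => //; first exact: measurable_funX.
by apply: filterS fM => x h Dx; rewrite normrX lerXn2r ?nnegrE ?h // (le_trans _ (h Dx)).
Qed.

Lemma L2_integrable f : in_L2 mu D f -> mu.-integrable D (EFin \o f).
Proof.
move=> Lf; have L1 : in_L2 mu D (cst 1).
  by apply: (@bounded_L2 _ 1) => //; apply/aeW => x _; rewrite normr1.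
have := L2_mul_integrable Lf L1; apply: eq_integrable => // x _ /=.
by rewrite mulr1.
Qed.

Lemma L2_L1loc f : in_L2 mu D f -> in_L1loc mu D f.
Proof.
move=> Lf; split; first exact: L2_measurable.
move=> K cK KD; apply: integrableS (L2_integrable Lf) => //; exact: compact_measurable_rV.
Qed.

End L2.

(** * The space H1, its subspace of functions vanishing on the boundary, and the energy forms *)

Section Sobolev1.
Context (R : realType) (d : nat).
Local Notation pt := 'rV[R]_d.
Context (mu : {measure set pt -> \bar R}) (hmu : is_lebesgue mu).
Context (D : set pt) (oD : open D) (Doo : (mu D < +oo)%E).
Implicit Types (f g c u v w z : pt -> R) (i j : 'I_d).
Let mD : measurable D := open_measurable_rV oD.
Local Notation L2 := (in_L2 mu D).
Local Notation H1 := (in_H1 mu D).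
Local Notation H10 := (in_H10 mu D).
Local Notation wd := (wderiv mu D).

Lemma H1_L2 w : H1 w -> L2 w. Proof. by case. Qed.

Lemma H1_wderiv_L2 w i : H1 w -> L2 (wd i w). Proof. by case=> _ /(_ i)[]. Qed.

Lemma H1_weak w i : H1 w -> is_weak_deriv mu D i w (wd i w).
Proof. by case=> _ /(_ i)[/wderivP]. Qed.

Lemma in_H1P w (z : 'I_d -> pt -> R) : L2 w -> (forall i, L2 (z i)) ->
  (forall i, is_weak_deriv mu D i w (z i)) ->
  H1 w /\ forall i, {ae mu, forall x, D x -> wd i w x = z i x}.
Proof.
move=> Lw Lz hz; have zw i : {ae mu, forall x, D x -> wd i w x = z i x} by exact: wderiv_ae.
split=> //; split=> // i; have wi : weakly_derivable mu D i w by exists (z i).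
split=> //; apply: L2_ae (Lz i) _ _ => //; last by apply: filterS (zw i) => x h Dx; rewrite h.
by have [_ [mz _] _] := wderivP wi.
Qed.

Lemma H1_linear (k : R) u v : H1 u -> H1 v -> H1 (k *: u + v) /\
  forall i, {ae mu, forall x, D x -> wd i (k *: u + v) x = (k *: wd i u + wd i v) x}.
Proof.
move=> Hu Hv; apply: in_H1P.
- by apply: L2_linear => //; exact: H1_L2.
- by move=> i; apply: L2_linear => //; exact: H1_wderiv_L2.
- move=> i; have := is_weak_deriv_linear oD k (H1_weak i Hu) (H1_weak i Hv).
  by [].
Qed.

Lemma H1_test f : test_function D f -> H1 f /\
  forall i, {ae mu, forall x, D x -> wd i f x = pderiv [:: i] f x}.
Proof.
have tL2 g : test_function D g -> L2 g.
  move=> tg; have [M _ gM] := test_bounded tg; apply: (@bounded_L2 _ _ _ _ _ _ _ M) => //.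
    exact: (test_measurable mD tg).
  exact/aeW.
move=> tf; apply: in_H1P; first exact: tL2.
- by move=> i; apply: tL2; exact: test_pderiv1.
- by move=> i; exact: weak_deriv_test.
Qed.

Definition H1dot u v : R := L2dot mu D u v + \sum_i L2dot mu D (wd i u) (wd i v).

Lemma wderiv_dot_linear i (k : R) u v w : H1 u -> H1 v -> L2 w ->
  L2dot mu D (wd i (k *: u + v)) w = k * L2dot mu D (wd i u) w + L2dot mu D (wd i v) w.
Proof.
move=> Hu Hv Lw; have [Huv ae] := H1_linear k Hu Hv.
have L1 := H1_wderiv_L2 i Hu; have L2' := H1_wderiv_L2 i Hv; have L3 := H1_wderiv_L2 i Huv.
rewrite -L2dot_linear //; apply: L2dot_ae => //.
- exact: L2_measurable L3.
- exact: L2_measurable Lw.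
- exact: L2_measurable (L2_linear mD k L1 L2').
- exact: L2_measurable Lw.
- exact/aeW.
Qed.

Lemma H1dot_linear (k : R) u v w : H1 u -> H1 v -> H1 w ->
  H1dot (k *: u + v) w = k * H1dot u w + H1dot v w.
Proof.
move=> Hu Hv Hw; rewrite /H1dot L2dot_linear ?H1_L2 //; try exact: H1_L2.
rewrite mulrDr addrACA; congr (_ + _); rewrite mulr_sumr -big_split /=.
by apply: eq_bigr => i _; rewrite wderiv_dot_linear //; exact: H1_wderiv_L2.
Qed.

Lemma H1dot_sym u v : H1dot u v = H1dot v u.
Proof. by rewrite /H1dot L2dot_sym; congr (_ + _); apply: eq_bigr => i _; rewrite L2dot_sym. Qed.

Lemma H1dot_ge0 u : 0 <= H1dot u u.
Proof. by rewrite addr_ge0 ?L2dot_ge0 // sumr_ge0 // => i _; exact: L2dot_ge0. Qed.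

Lemma H1normE u : H1norm mu D u = Num.sqrt (H1dot u u).
Proof.
rewrite /H1norm /H1dot L2norm_sqr; congr (Num.sqrt (_ + _)).
by apply: eq_bigr => i _; rewrite L2norm_sqr.
Qed.

Lemma H1norm_ge0 u : 0 <= H1norm mu D u. Proof. exact: sqrtr_ge0. Qed.

Lemma H1_triangle (k : R) u v : H1 u -> H1 v ->
  H1norm mu D (k *: u + v) <= `|k| * H1norm mu D u + H1norm mu D v.
Proof.
move=> Hu Hv; rewrite !H1normE.
apply: (@semi_inner_triangle R (pt -> R) H1 H1dot _ _ _ _ k u v Hu Hv).
- by move=> c ? ? h1 h2; have [] := H1_linear c h1 h2.
- by move=> ? ? ? ?; exact: H1dot_linear.
- by move=> ? ? _ _; exact: H1dot_sym.
- by move=> ? _; exact: H1dot_ge0.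
Qed.

Lemma L2norm_le_H1norm u : L2norm mu D u <= H1norm mu D u.
Proof.
rewrite /H1norm -[leLHS]ger0_norm ?L2norm_ge0 // -sqrtr_sqr ler_wsqrtr // lerDl.
by apply: sumr_ge0 => i _; exact: sqr_ge0.
Qed.

Lemma L2norm_wderiv_le_H1norm u i : L2norm mu D (wd i u) <= H1norm mu D u.
Proof.
rewrite /H1norm -[leLHS]ger0_norm ?L2norm_ge0 // -sqrtr_sqr ler_wsqrtr //.
rewrite (bigD1 i) //= addrCA lerDl addr_ge0 ?sqr_ge0 //.
by apply: sumr_ge0 => j _; exact: sqr_ge0.
Qed.

Lemma H10_H1 u : H10 u -> H1 u. Proof. by case. Qed.

Lemma H10_linear (k : R) u v : H10 u -> H10 v -> H10 (k *: u + v).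
Proof.
move=> [Hu au] [Hv av]; split; first by have [] := H1_linear k Hu Hv.
move=> e e0.
(* The added 1 covers k = 0. *)
have [f [tf hf]] := au (e / (2 * (`|k| + 1))) (divr_gt0 e0 (mulr_gt0 (ltr0Sn _ _) (ltr_wpDl (normr_ge0 k) ltr01))).
have [g [tg hg]] := av (e / 2) (divr_gt0 e0 (ltr0Sn _ _)).
have [Hf _] := H1_test tf; have [Hg _] := H1_test tg.
exists (fun x => k * f x + g x); split.
  by apply: test_add => //; exact: test_scale.
have -> : (k *: u + v) \- (fun x => k * f x + g x) = k *: (u \- f) + (v \- g).
  by apply/funext => x; rewrite !fctE /GRing.scale /=; ring.
have HB a b : H1 a -> H1 b -> H1 (a \- b).
  move=> Ha Hb; have [] := H1_linear (-1) Hb Ha.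
  by rewrite (_ : -1 *: b + a = a \- b) //; apply/funext => x; rewrite !fctE /GRing.scale /=; ring.
apply: le_lt_trans (H1_triangle _ (HB _ _ Hu Hf) (HB _ _ Hv Hg)) _.
have k1 : 0 < `|k| + 1 by rewrite ltr_wpDl.
have : `|k| * H1norm mu D (u \- f) <= e / 2.
  apply: le_trans (ler_wpM2l (normr_ge0 k) (ltW hf)) _.
  rewrite (_ : `|k| * _ = (`|k| / (`|k| + 1)) * (e / 2)); last first.
    by move: k1; set t := `|k| => k1; field; rewrite gt_eqF.
  rewrite ler_piMl ?divr_ge0 ?(ltW e0) // ler_pdivrMr // mul1r lerDl ler01 //.
by move=> h; rewrite [ltRHS](splitr e); exact: ler_ltD.
Qed.

Section BilinearForm.
Context (c : pt -> R) (M : R) (M0 : 0 <= M) (mc : measurable_fun D c)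
  (cM : {ae mu, forall x, D x -> `|c x| <= M}).

Lemma L2_coef f : L2 f -> L2 (fun x => c x * f x) /\
  L2norm mu D (fun x => c x * f x) <= M * L2norm mu D f.
Proof. exact: L2_mul_bounded. Qed.

Lemma bformE w v : H1 w -> H1 v ->
  bform mu D c w v = \sum_i L2dot mu D (fun x => c x * wd i w x) (wd i v).
Proof.
move=> Hw Hv; rewrite /bform /L2dot.
have ii i : mu.-integrable D (EFin \o (fun x => c x * wd i w x * wd i v x)).
  apply: L2_mul_integrable => //; last exact: H1_wderiv_L2.
  by have [] := L2_coef (H1_wderiv_L2 i Hw).
rewrite /=.
under eq_Rintegral do rewrite mulr_sumr; under eq_Rintegral do under eq_bigr do rewrite mulrA.
elim: (index_enum _) => [|i s ih].
  rewrite big_nil; under eq_Rintegral do rewrite big_nil.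
  by rewrite /Rintegral integral0_eq.
rewrite big_cons -ih -RintegralD //; first by apply: eq_Rintegral => x _; rewrite big_cons.
elim: s {ih} => [|j s ih].
  under eq_fun do rewrite big_nil; exact: integrable0.
have := integrable_fadd mD (ii j) ih; apply: eq_integrable => // x _ /=.
by rewrite big_cons.
Qed.

Lemma bform_sym w v : bform mu D c w v = bform mu D c v w.
Proof.
by apply: eq_Rintegral => x _; congr (_ * _); apply: eq_bigr => i _; rewrite mulrC.
Qed.

Lemma bform_linearr (k : R) u v w : H1 u -> H1 v -> H1 w ->
  bform mu D c w (k *: u + v) = k * bform mu D c w u + bform mu D c w v.
Proof.
move=> Hu Hv Hw; have [Huv _] := H1_linear k Hu Hv.
rewrite !bformE // mulr_sumr -big_split /=; apply: eq_bigr => i _.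
rewrite L2dot_sym wderiv_dot_linear //; last by have [] := L2_coef (H1_wderiv_L2 i Hw).
by congr (_ * _ + _); rewrite L2dot_sym.
Qed.

Lemma bform_linearl (k : R) u v w : H1 u -> H1 v -> H1 w ->
  bform mu D c (k *: u + v) w = k * bform mu D c u w + bform mu D c v w.
Proof. by move=> Hu Hv Hw; rewrite !(bform_sym _ w) bform_linearr. Qed.

Lemma bform_bounded w v : H1 w -> H1 v ->
  `|bform mu D c w v| <= M * H1norm mu D w * H1norm mu D v.
Proof.
move=> Hw Hv; rewrite bformE // -mulrA.
apply: le_trans (ler_norm_sum _ _ _) _.
have h i : `|L2dot mu D (fun x => c x * wd i w x) (wd i v)| <=
   M * (L2norm mu D (wd i w) * L2norm mu D (wd i v)).
  have [L1 L2'] := L2_coef (H1_wderiv_L2 i Hw).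
  apply: le_trans (L2_CS mD L1 (H1_wderiv_L2 i Hv)) _; rewrite mulrA.
  by rewrite ler_wpM2r ?L2norm_ge0.
apply: le_trans (ler_sum _ (fun i _ => h i)) _; rewrite -mulr_sumr ler_wpM2l //.
apply: le_trans (finite_CS (fun i => L2norm_ge0 _ _ _) (fun i => L2norm_ge0 _ _ _)) _.
by apply: ler_pM; rewrite ?sqrtr_ge0 // /H1norm ler_wsqrtr // lerDr sqr_ge0.
Qed.

End BilinearForm.

Lemma bform_coef_sub c c' (M M' : R) w v : 0 <= M -> 0 <= M' ->
  measurable_fun D c -> measurable_fun D c' ->
  {ae mu, forall x, D x -> `|c x| <= M} -> {ae mu, forall x, D x -> `|c' x| <= M'} ->
  H1 w -> H1 v ->
  bform mu D (c \- c') w v = bform mu D c w v - bform mu D c' w v.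
Proof.
move=> M0 M0' mc mc' cM cM' Hw Hv.
have cb : {ae mu, forall x, D x -> `|(c \- c') x| <= M + M'}.
  apply: filterS2 cM cM' => x h1 h2 Dx; apply: le_trans (ler_normB _ _) _.
  by apply: lerD; [exact: h1|exact: h2].
rewrite (bformE (addr_ge0 M0 M0') (measurable_funB mc mc') cb) // (bformE M0 mc cM) // (bformE M0' mc' cM') //.
rewrite -sumrB; apply: eq_bigr => i _.
have Lw := H1_wderiv_L2 i Hw; have Lv := H1_wderiv_L2 i Hv.
have [L1 _] := L2_coef M0 mc cM Lw; have [L1' _] := L2_coef M0' mc' cM' Lw.
have := L2dot_linear mD (-1) L1' L1 Lv; rewrite mulN1r => h; rewrite [RHS]addrC -h.
by congr (L2dot mu D _ _); apply/funext => x; rewrite /= !fctE /GRing.scale /=; ring.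
Qed.

End Sobolev1.

(** * The product rule for weak derivatives *)

(** Fubini is applied to a bundled sigma-finite measure. The pack has [m0] itself as its carrier, so
    integrals against the two are the same. *)
Definition sigma_finite_pack (dT : measure_display) (T : measurableType dT)
    (R : realType) (m0 : {measure set T -> \bar R}) (sf : sigma_finite setT m0) :
    {sigma_finite_measure set T -> \bar R} :=
  HB.pack (Measure.sort m0) (Measure.class m0)
    (isSFinite.Build _ _ _ (Measure.sort m0) (sfinite_measure_sigma_finite sf))
    (isSigmaFinite.Build _ _ _ (Measure.sort m0) sf).

(** * Exchange of integrals for p(x) q(y) k(x, y) with p, q integrable and k bounded *)

Section FubiniKernel.
Context (dT : measure_display) (T : measurableType dT) (R : realType).
Context (m : {sigma_finite_measure set T -> \bar R}).
Context (p q : T -> R) (k : T * T -> R) (M : R).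
Hypotheses (ip : m.-integrable setT (EFin \o p)) (iq : m.-integrable setT (EFin \o q)).
Hypotheses (mk : measurable_fun setT k) (kM : forall z, `|k z| <= M).

Let mp : measurable_fun setT p.
Proof. by apply/measurable_EFinP; exact: measurable_int ip. Qed.

Let mq : measurable_fun setT q.
Proof. by apply/measurable_EFinP; exact: measurable_int iq. Qed.

Let f (z : T * T) : \bar R := (p z.1 * (q z.2 * k z))%:E.

Let mf : measurable_fun setT f.
Proof.
apply/measurable_EFinP; apply: measurable_funM; first exact: measurableT_comp mp measurable_fst.
by apply: measurable_funM => //; exact: measurableT_comp mq measurable_snd.
Qed.

Let ik1 x : m.-integrable setT (EFin \o (fun y => q y * k (x, y))).
Proof.
apply: (@integrableM_bounded _ _ _ _ _ _ _ M) => //; last exact/aeW.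
exact: measurableT_comp mk (pair1_measurable x).
Qed.

Let ik2 y : m.-integrable setT (EFin \o (fun x => p x * k (x, y))).
Proof.
apply: (@integrableM_bounded _ _ _ _ _ _ _ M) => //; last exact/aeW.
exact: measurableT_comp mk (pair2_measurable y).
Qed.

Let imf : (m \x m)%E.-integrable setT f.
Proof.
apply: (@integrable12ltyP _ _ _ _ _ m m f mf).2.
pose Q := \int[m]_y `|q y|.
(* That M is nonnegative follows from [kM] only when there is a point at which to evaluate it; over
   an empty space all integrals are 0. *)
have [xx|xx] := pselect (exists x : T, True); last first.
  rewrite integral0_eq ?ltry // => x _; exfalso; apply: xx; by exists x.
have M0 : 0 <= M by case: xx => x _; apply: le_trans (kM (x, x)).
apply: (@le_lt_trans _ _ (\int[m]_x (`|p x| * (M * Q))%:E)%E).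
  apply: ge0_le_integral => //.
  - by move=> x _; exact: integral_ge0.
  - apply: (@measurable_fun_fubini_tonelli_F _ _ _ _ _ m (abse \o f)).
      exact: measurableT_comp.
    by move=> z /=.
  - by apply/measurable_EFinP; apply: measurable_funM => //; exact: measurableT_comp.
  - move=> x _.
    have i1 := integrable_fscale (`|p x| * M) measurableT (integrable_fnorm measurableT iq).
    apply: (@le_trans _ _ (\int[m]_y ((`|p x| * M * `|q y|)%:E))%E).
      apply: ge0_le_integral => //.
      + by apply: measurableT_comp => //; exact: measurableT_comp mf (pair1_measurable x).
      + by apply/measurable_EFinP; apply: measurable_funM => //; exact: measurableT_comp.
      + move=> y _; rewrite /f /= lee_fin !normrM -mulrA ler_wpM2l // mulrC ler_wpM2r //.
    rewrite -[leLHS]fineK; last by apply: integrable_fin_num => //; exact: i1.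
    rewrite -/(Rintegral _ _ _) RintegralZl ?mulrA //.
    exact: integrable_fnorm.
have i2 := integrable_fscale (M * Q) measurableT (integrable_fnorm measurableT ip).
move/integrableP : i2 => [_]; apply: le_lt_trans.
rewrite le_eqVlt; apply/orP; left; apply/eqP; apply: eq_integral => x _ /=.
congr EFin; have Q0 : 0 <= Q by apply: Rintegral_ge0.
by rewrite (ger0_norm (mulr_ge0 (mulr_ge0 M0 Q0) (normr_ge0 _))) [RHS]mulrC.
Qed.

Lemma Rfubini_kernel :
  \int[m]_x (p x * \int[m]_y (q y * k (x, y))) =
  \int[m]_y (q y * \int[m]_x (p x * k (x, y))).
Proof.
have E1 x : (\int[m]_y f (x, y) = (p x * \int[m]_y (q y * k (x, y)))%:E)%E.
  have <- : \int[m]_y (p x * (q y * k (x, y))) = p x * \int[m]_y (q y * k (x, y)).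
    by rewrite RintegralZl //; exact: (ik1 x).
  rewrite /Rintegral fineK //; apply: integrable_fin_num => //.
  exact: (integrable_fscale (p x) measurableT (ik1 x)).
have E2 y : (\int[m]_x f (x, y) = (q y * \int[m]_x (p x * k (x, y)))%:E)%E.
  have <- : \int[m]_x (q y * (p x * k (x, y))) = q y * \int[m]_x (p x * k (x, y)).
    by rewrite RintegralZl //; exact: (ik2 y).
  rewrite /Rintegral fineK; first by apply: eq_integral => x _; rewrite /f /= mulrCA.
  apply: integrable_fin_num => //.
  exact: (integrable_fscale (q y) measurableT (ik2 y)).
rewrite /Rintegral; congr fine; transitivity (\int[m]_x \int[m]_y f (x, y))%E.
  by apply: eq_integral => x _; exact: esym (E1 x).
by rewrite (Fubini imf); apply: eq_integral => y _; exact: E2 y.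
Qed.

Lemma kernel_average_measurable :
  measurable_fun setT (fun y => \int[m]_x (p x * k (x, y))).
Proof.
pose g (z : T * T) : \bar R := (p z.1 * k z)%:E.
have mg : measurable_fun setT g.
  apply/measurable_EFinP; apply: measurable_funM => //; exact: measurableT_comp mp measurable_fst.
apply: (measurableT_comp (f := fine)) => //.
rewrite (_ : (fun y => _) = (fun y => \int[m]_x g^\+ (x, y) - \int[m]_x g^\- (x, y))%E).
  apply: emeasurable_funB.
    by apply: (@measurable_fun_fubini_tonelli_G _ _ _ _ _ m (g^\+)%E) => //; exact: measurable_funepos.
  by apply: (@measurable_fun_fubini_tonelli_G _ _ _ _ _ m (g^\-)%E) => //; exact: measurable_funeneg.
apply/funext => y; rewrite [LHS]integralE; congr (_ - _)%E; apply: eq_integral => x _.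
  by rewrite (funepos_comp g (fun x => (x, y))).
by rewrite (funeneg_comp g (fun x => (x, y))).
Qed.

Lemma kernel_average_bounded y :
  `|\int[m]_x (p x * k (x, y))| <= M * \int[m]_x `|p x|.
Proof.
apply: le_trans (le_normr_Rintegral measurableT (ik2 y)) _.
rewrite -RintegralZl //; last exact: integrable_fnorm.
apply: le_Rintegral => //; first exact: integrable_fnorm (ik2 y).
  exact: integrable_fscale (integrable_fnorm _ ip).
by move=> x _; rewrite normrM mulrC ler_wpM2r.
Qed.

End FubiniKernel.

(** * Weak-star convergence to 0 of uniformly bounded sequences *)

Section WeakStar.
Context (dT : measure_display) (T : measurableType dT) (R : realType).
Context (mu : {measure set T -> \bar R}) (Q : set T) (mQ : measurable Q) (Qoo : (mu Q < +oo)%E).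
Context (F : nat -> T -> R) (M : R) (M0 : 0 < M).
Hypothesis mF : forall n, measurable_fun Q (F n).
Hypothesis FM : forall n, {ae mu, forall x, Q x -> `|F n x| <= M}.

Let Fint q n : mu.-integrable Q (EFin \o q) ->
  mu.-integrable Q (EFin \o (fun x => q x * F n x)).
Proof. by move=> iq; exact: (@integrableM_bounded _ _ _ _ _ _ _ M). Qed.

Let Fbound q n : mu.-integrable Q (EFin \o q) ->
  `|\int[mu]_(x in Q) (q x * F n x)| <= M * \int[mu]_(x in Q) `|q x|.
Proof.
move=> iq; apply: le_trans (le_normr_Rintegral mQ (Fint n iq)) _.
rewrite -RintegralZl //; last exact: integrable_fnorm.
apply: ae_le_Rintegral => //.
- exact: integrable_fnorm (Fint n iq).
- exact: integrable_fscale (integrable_fnorm _ iq).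
- by apply: filterS (FM n) => x h Qx; rewrite normrM mulrC ler_wpM2r // h.
Qed.

Definition weak_null (q : T -> R) : Prop :=
  \int[mu]_(x in Q) (q x * F n x) @[n --> \oo] --> (0 : R).

Let iI E : measurable E -> mu.-integrable Q (EFin \o (\1_E : T -> R)).
Proof.
move=> mE; apply: (@integrable_bounded _ _ _ _ _ _ 1) => //.
by apply/aeW => x _; rewrite indicE; case: (_ \in _); rewrite ?normr1 ?normr0.
Qed.

Lemma weak_null_lin (k : R) f g : mu.-integrable Q (EFin \o f) -> mu.-integrable Q (EFin \o g) ->
  weak_null f -> weak_null g -> weak_null (fun x => k * f x + g x).
Proof.
move=> fi gi wf wg; rewrite /weak_null.
rewrite (_ : (fun n => _) = (fun n => k * \int[mu]_(x in Q) (f x * F n x) + \int[mu]_(x in Q) (g x * F n x))).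
  by rewrite -[0](addr0 0) -[X in X + _](mulr0 k); apply: cvgD => //; apply: cvgMl_tmp.
apply/funext => n; rewrite -RintegralZl //; last exact: Fint.
rewrite -RintegralD //; [|exact: integrable_fscale (Fint n fi)|exact: Fint].
by apply: eq_Rintegral => x _; ring.
Qed.

(** The uniform bound M on the sequence makes the set of test functions with vanishing limit closed
    in L1: an L1 error of e / (2 M) changes every integral by at most e / 2. *)
Lemma weak_null_approx (q : T -> R) : mu.-integrable Q (EFin \o q) ->
  (forall e : R, 0 < e -> exists g, [/\ mu.-integrable Q (EFin \o g), weak_null g &
     \int[mu]_(x in Q) `|q x - g x| <= e]) -> weak_null q.
Proof.
move=> iq h; apply/cvgr0Pnorm_le => e e0.
have [g [ig wg hg]] := h (e / 2 / M) (divr_gt0 (divr_gt0 e0 (ltr0Sn _ _)) M0).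
have e2 : 0 < e / 2 by rewrite divr_gt0.
move/cvgr0Pnorm_le : wg => /(_ _ e2); apply: filterS => n hn.
have -> : \int[mu]_(x in Q) (q x * F n x) =
   \int[mu]_(x in Q) ((q x - g x) * F n x) + \int[mu]_(x in Q) (g x * F n x).
  rewrite -RintegralD //; [|exact: Fint (integrable_fsub _ iq ig)|exact: Fint].
  by apply: eq_Rintegral => x _; ring.
apply: le_trans (ler_normD _ _) _; rewrite [leRHS](splitr e); apply: lerD => //.
apply: le_trans (Fbound n (integrable_fsub mQ iq ig)) _.
by rewrite mulrC -ler_pdivlMr.
Qed.

Lemma weak_null_setD A B : measurable A -> measurable B -> B `<=` A ->
  weak_null (\1_A : T -> R) -> weak_null (\1_B : T -> R) -> weak_null (\1_(A `\` B) : T -> R).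
Proof.
move=> mA mB BA wA wB.
have := weak_null_lin (-1) (iI mB) (iI mA) wB wA.
by rewrite (_ : (fun x => _) = \1_(A `\` B)) //; apply/funext => x; rewrite indicSD //; ring.
Qed.

Lemma weak_null_bigcup (E : (set T)^nat) : nondecreasing_seq E ->
  (forall n, measurable (E n)) -> (forall n, weak_null (\1_(E n) : T -> R)) ->
  weak_null (\1_(\bigcup_n E n) : T -> R).
Proof.
move=> ndE mE wE; have mU : measurable (\bigcup_n E n) by exact: bigcupT_measurable.
apply: weak_null_approx; first exact: iI.
have : \int[mu]_(x in Q) `|\1_(\bigcup_n E n) x - \1_(E n) x| @[n --> \oo] --> \int[mu]_(x in Q) (0 : R).
  apply: (@Rdominated_convergence _ _ _ _ _ _ _ (cst 1)) => //.
  - move=> n; apply: measurableT_comp => //; apply: measurable_funB; exact: measurable_indic.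
  - apply/aeW => x _; have := @cvg_indic_bigcup _ _ R E x ndE.
    set l : R := \1_(\bigcup_n E n) x => h.
    by have := cvg_norm (cvgB (cvg_cst l) h); rewrite subrr normr0; apply.
  - by apply: (@integrable_bounded _ _ _ _ _ _ 1) => //; apply/aeW => x _; rewrite normr1.
  - apply/aeW => x n _; rewrite normr_id !indicE.
    by case: (_ \in _); case: (_ \in _); rewrite ?subrr ?subr0 ?sub0r ?normrN ?normr0 ?normr1.
rewrite (_ : \int[mu]_(x in Q) 0 = 0); last by rewrite /Rintegral integral0_eq.
move=> /cvgr0Pnorm_le cv e e0; have [n _ hn] := cv _ e0.
exists (\1_(E n)); split; [exact: iI|exact: wE|].
by apply: le_trans (ler_norm _) _; apply: (hn n) => /=.
Qed.

Lemma weak_null_simple (k : nat) (c : nat -> R) (E : nat -> set T) :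
  (forall i, measurable (E i)) -> (forall i, weak_null (\1_(E i) : T -> R)) ->
  mu.-integrable Q (EFin \o (fun x => \sum_(i < k) c i * \1_(E i) x)) /\
  weak_null (fun x => \sum_(i < k) c i * \1_(E i) x).
Proof.
move=> mE wE; elim: k => [|k [ih1 ih2]].
  under eq_fun do rewrite big_ord0; split; first exact: integrable0.
  rewrite /weak_null (_ : (fun _ => _) = cst 0); first exact: cvg_cst.
  by apply/funext => n; rewrite /Rintegral integral0_eq // => x _; rewrite mul0r.
have -> : (fun x => \sum_(i < k.+1) c i * \1_(E i) x : R) =
   (fun x => c k * \1_(E k) x + \sum_(i < k) c i * \1_(E i) x).
  by apply/funext => x; rewrite big_ord_recr addrC.
split; first by apply: integrable_fadd => //; apply: integrable_fscale => //; exact: iI.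
by apply: weak_null_lin => //; exact: iI.
Qed.

Import HBSimple.

(** Simple functions are dense in L1, so convergence against indicators is enough. *)
Lemma weak_null_integrable (q : T -> R) :
  (forall E, measurable E -> weak_null (\1_E : T -> R)) ->
  mu.-integrable Q (EFin \o q) -> weak_null q.
Proof.
move=> wI iq; apply: weak_null_approx => // e e0.
have [g [gi _ gq]] := approximation_sfun_integrable mQ iq.
have gi' n : mu.-integrable Q (EFin \o g n) by exact: gi.
have : \forall n \near \oo, (\int[mu]_(z in Q) `|(EFin \o q) z - (g n z)%:E| < e%:E)%E.
  have := gq; move=> /fine_cvgP[ge_fin /cvgrPdist_lt /(_ _ e0)].
  apply: filterS2 ge_fin => n hf; rewrite sub0r normrN /= => h.
  by rewrite -(fineK hf) lte_fin; apply: le_lt_trans h; exact: ler_norm.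
move=> [n _ /(_ n (leqnn n)) hn]; exists (g n); split=> //; last first.
  rewrite /Rintegral -lee_fin fineK; first exact: ltW.
  by apply: integrable_fin_num => //; exact: integrable_fnorm (integrable_fsub mQ iq (gi' n)).
have E : (g n : T -> R) = _ := funext (fimfunEord (g n)).
rewrite E; set k := (X in 'I_X).
have mg y : measurable (g n @^-1` [set y]).
  by rewrite -[X in measurable X]setTI; exact: measurable_funP.
pose c i := nth 0 (finmap.enum_fset (fset_set (range (g n)))) i.
pose L i := g n @^-1` [set c i].
have mL i : measurable (L i) by exact: mg.
by have [] := @weak_null_simple k c L mL (fun i => wI _ (mL i)).
Qed.

End WeakStar.

(** * Averages over shrinking cubes and their weak limit *)

Section Averages.
Context (R : realType) (d : nat).
Local Notation pt := 'rV[R]_d.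
Context (mu : {measure set pt -> \bar R}) (hmu : is_lebesgue mu).
Implicit Types (x y : pt) (e : R).

Let m : {sigma_finite_measure set pt -> \bar R} := sigma_finite_pack (lebesgue_sigma_finite hmu).

Definition cube_vol e : R := (2 * e) ^+ d.

(** The normalised indicator of the cube of half-side e. Written as a product over the coordinates
    of x - y, it is jointly measurable because each factor is. *)
Definition cube_kernel e (z : pt * pt) : R :=
  (cube_vol e)^-1 * \prod_i (`|z.1 0 i - z.2 0 i| < e)%R%:R.

Lemma cube_vol_gt0 e : 0 < e -> 0 < cube_vol e.
Proof. by move=> e0; rewrite exprn_gt0 // mulr_gt0. Qed.

Lemma cube_kernelC e x y : cube_kernel e (x, y) = cube_kernel e (y, x).
Proof. by congr (_ * _); apply: eq_bigr => i _ /=; rewrite distrC. Qed.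

Lemma cube_kernelE e x y : cube_kernel e (x, y) =
  (cube_vol e)^-1 * \1_(obox (y - const_mx e) (y + const_mx e)) x.
Proof.
congr (_ * _); rewrite indicE /=.
have [xy|/existsNP[i xy]] := pselect (obox (y - const_mx e) (y + const_mx e) x).
  rewrite mem_set // big1 // => i _.
  by have := xy i; rewrite !mxE distrC ltr_distlC => ->.
rewrite memNset; last by move/(_ i).
rewrite (bigD1 i) //= distrC ltr_distlC; move: xy; rewrite !mxE => /negP/negbTE ->.
by rewrite mul0r.
Qed.

Lemma measurable_cube_kernel e : measurable_fun setT (cube_kernel e).
Proof.
apply: measurable_funM => //; apply: measurable_prod => i _.
suff mt : measurable_fun setT (fun t : R => (`|t| < e)%R%:R : R).
  exact: (measurableT_comp mt (measurable_coord_sub i)).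
rewrite (_ : (fun t : R => _) = \1_(`]- e, e[%classic : set R)); first exact: measurable_indic.
apply/funext => t; rewrite indicE; congr (_%:R).
by rewrite mem_setE in_itv /= ltr_norml.
Qed.

Lemma cube_kernel_ge0_le e z : 0 < e -> 0 <= cube_kernel e z <= (cube_vol e)^-1.
Proof.
case: z => x y e0; rewrite cube_kernelE indicE.
have v0 : 0 <= (cube_vol e)^-1 by rewrite invr_ge0 ltW // cube_vol_gt0.
by case: (_ \in _); rewrite ?mulr1 ?mulr0 ?lexx ?v0.
Qed.

Lemma cube_kernel_norm_le e z : 0 < e -> `|cube_kernel e z| <= (cube_vol e)^-1.
Proof. by move=> e0; have /andP[h1 h2] := cube_kernel_ge0_le z e0; rewrite ger0_norm. Qed.

Lemma mu_cube y e : 0 < e -> mu (obox (y - const_mx e) (y + const_mx e)) = (cube_vol e)%:E.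
Proof.
move=> e0; rewrite mu_obox //; last by move=> i; rewrite !mxE; lra.
congr EFin; rewrite /cube_vol -[in RHS](card_ord d) -prodr_const.
by apply: eq_bigr => i _; rewrite !mxE; ring.
Qed.

Lemma integrable_cube_kernel y e : 0 < e ->
  mu.-integrable setT (EFin \o (fun x => cube_kernel e (x, y))).
Proof.
move=> e0; under eq_fun do rewrite cube_kernelE.
apply: integrable_fscale => //.
by apply: integrable_indic_fin => //; [exact: measurable_obox|exact: mu_obox_fin].
Qed.

Lemma Rintegral_cube_kernel y e : 0 < e -> \int[mu]_x cube_kernel e (x, y) = 1.
Proof.
move=> e0; under eq_Rintegral do rewrite cube_kernelE.
rewrite Rintegral_indicr setTI Rintegral_cst //; last exact: measurable_obox.
by rewrite mu_cube //= mulVf // gt_eqF // cube_vol_gt0.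
Qed.

Definition cube_avg (p : pt -> R) e y : R := \int[mu]_x (p x * cube_kernel e (x, y)).

Lemma measurable_cube_avg p e : 0 < e -> mu.-integrable setT (EFin \o p) ->
  measurable_fun setT (cube_avg p e).
Proof.
move=> e0 ip.
exact: (@kernel_average_measurable _ _ _ m p (cube_kernel e) ip (measurable_cube_kernel e)).
Qed.

Lemma cube_avg_bounded p (M : R) e y : 0 < e -> mu.-integrable setT (EFin \o p) ->
  {ae mu, forall x, `|p x| <= M} -> `|cube_avg p e y| <= M.
Proof.
move=> e0 ip pM.
have ik : mu.-integrable setT (EFin \o (fun x => p x * cube_kernel e (x, y))).
  apply: (@integrableM_bounded _ _ _ _ _ _ _ (cube_vol e)^-1) => //.
    exact: (measurableT_comp (measurable_cube_kernel e) (pair2_measurable y)).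
  by apply/aeW => x _; exact: cube_kernel_norm_le.
apply: le_trans (le_normr_Rintegral measurableT ik) _.
rewrite -[leRHS]mulr1 -(Rintegral_cube_kernel y e0) -RintegralZl //; last exact: integrable_cube_kernel.
apply: ae_le_Rintegral => //.
- exact: integrable_fnorm ik.
- exact: integrable_fscale (integrable_cube_kernel y e0).
- apply: filterS pM => x h _; rewrite normrM; have /andP[k0 _] := cube_kernel_ge0_le (x, y) e0.
  by rewrite (ger0_norm k0) ler_wpM2r.
Qed.

(** Off the boundary of the box, a small cube around x lies entirely inside or entirely outside, so
    the averages are eventually constant. *)
Lemma cube_avg_obox a b x : ~ (cbox a b `\` obox a b) x ->
  cube_avg (\1_(obox a b)) (harmonic n) x @[n --> \oo] --> (\1_(obox a b) x : R).
Proof.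
move=> nb; have cvh := @cvg_harmonic R.
have h0 n : 0 < harmonic n :> R by rewrite invr_gt0.
have near_x (e t : R) y : 0 < e -> t < e ->
    y \in obox (x - const_mx t) (x + const_mx t) -> ball x e y.
  move=> e0 hn; rewrite inE ball_rVE // => yx i.
  by move: (yx i); rewrite !mxE => /andP[? ?]; apply/andP; split; lra.
have [xab|xab] := pselect (obox a b x).
  have /nbhs_ballP[e /= e0 xe] : nbhs x (obox a b).
    by apply: open_nbhs_nbhs; split=> //; exact: open_obox.
  rewrite indicE mem_set //; apply: cvg_near_cst.
  move/cvgr0Pnorm_lt : cvh => /(_ _ e0); apply: filterS => n; rewrite (gtr0_norm (h0 n)) => hn.
  transitivity (\int[mu]_y cube_kernel (harmonic n) (y, x)); last exact: Rintegral_cube_kernel.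
  apply: eq_Rintegral => y _; rewrite cube_kernelE !indicE.
  have [yx|yx] := boolP (y \in obox (x - const_mx (harmonic n)) _); last by rewrite !mulr0.
  by rewrite mem_set ?mul1r //; apply: xe; exact: near_x yx.
have /nbhs_ballP[e /= e0 xe] : nbhs x (~` cbox a b).
  apply: open_nbhs_nbhs; split; first by apply: closed_openC; exact: closed_cbox.
  by move=> xc; apply: nb.
rewrite indicE memNset //; apply: cvg_near_cst.
move/cvgr0Pnorm_lt : cvh => /(_ _ e0); apply: filterS => n; rewrite (gtr0_norm (h0 n)) => hn.
rewrite /cube_avg /Rintegral integral0_eq // => y _; congr EFin.
rewrite cube_kernelE !indicE.
have [yx|yx] := boolP (y \in obox (x - const_mx (harmonic n)) _); last by rewrite !mulr0.
by rewrite memNset ?mul0r // => /obox_cbox; apply: xe; exact: near_x yx.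
Qed.

Section WeakLimit.
Context (p : pt -> R) (M : R) (M0 : 0 < M).
Hypotheses (ip : mu.-integrable setT (EFin \o p)) (pM : {ae mu, forall x, `|p x| <= M}).

Let A n := cube_avg p (harmonic n).
Let h0 n : 0 < harmonic n :> R. Proof. by rewrite invr_gt0. Qed.

(** Fubini and the symmetry of the kernel move the averaging from p to the indicator of the box.
    There it converges pointwise off the null boundary, which avoids any differentiation theorem for
    p. *)
Lemma cvg_integral_cube_avg_obox a b :
  \int[mu]_(y in obox a b) A n y @[n --> \oo] --> \int[mu]_(y in obox a b) p y.
Proof.
have iB : mu.-integrable setT (EFin \o (\1_(obox a b) : pt -> R)).
  by apply: integrable_indic_fin => //; [exact: measurable_obox|exact: mu_obox_fin].
pose W n x : R := cube_avg (\1_(obox a b)) (harmonic n) x.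
have W01 n x : `|W n x| <= 1.
  apply: cube_avg_bounded => //; apply/aeW => y; rewrite indicE.
  by case: (_ \in _); rewrite ?normr1 ?normr0.
have E : (fun n => \int[mu]_(y in obox a b) A n y) = (fun n => \int[mu]_x (p x * W n x)).
  apply/funext => n; rewrite -[in LHS](setTI (obox a b)) -Rintegral_indicr.
  rewrite [LHS](_ : _ = \int[mu]_y (\1_(obox a b) y * A n y)); last first.
    by apply: eq_Rintegral => y _; rewrite mulrC.
  apply: etrans (esym (@Rfubini_kernel _ _ _ m p (\1_(obox a b)) (cube_kernel (harmonic n)) (cube_vol (harmonic n))^-1 ip iB
    (measurable_cube_kernel _) (fun z => cube_kernel_norm_le z (h0 n)))) _.
  apply: eq_Rintegral => x _; congr (_ * _); apply: eq_Rintegral => y _.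
  by rewrite cube_kernelC.
rewrite E -[in X in _ --> X](setTI (obox a b)) -Rintegral_indicr.
have mp : measurable_fun setT p by apply/measurable_EFinP; exact: measurable_int ip.
apply: (@Rdominated_convergence _ _ _ _ _ _ _ (fun x => `|p x|)) => //.
- by move=> n; apply: measurable_funM => //; exact: measurable_cube_avg.
- by apply: measurable_funM => //; apply: measurable_indic; exact: measurable_obox.
- have [N [mN N0 bN]] := negligible_boundary hmu a b.
  exists N; split=> // x /= nx; apply: bN; apply: contrapT => nb; apply: nx => _.
  by apply: cvgMl_tmp; exact: cube_avg_obox.
- exact: integrable_fnorm.
- by apply/aeW => x n _; rewrite normrM ler_piMr.
Qed.

(** The differences [A n - p] are bounded by 2 M. Their weak limit is 0 against boxes, then against
    Borel sets by Dynkin's lemma, then against integrable q. *)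
Lemma cvg_integral_cube_avg a b (q : pt -> R) : mu.-integrable (obox a b) (EFin \o q) ->
  \int[mu]_(y in obox a b) (q y * A n y) @[n --> \oo] --> \int[mu]_(y in obox a b) (q y * p y).
Proof.
move=> iq; have mB := measurable_obox a b; have Boo := mu_obox_fin hmu a b.
pose F n y := A n y - p y.
have mp : measurable_fun setT p by apply/measurable_EFinP; exact: measurable_int ip.
have mA n : measurable_fun setT (A n) by exact: measurable_cube_avg.
have mF n : measurable_fun (obox a b) (F n).
  by apply: measurable_funTS; exact: measurable_funB.
have AM n y : `|A n y| <= M by exact: cube_avg_bounded.
have FM n : {ae mu, forall x, obox a b x -> `|F n x| <= 2 * M}.
  apply: filterS pM => x h _; apply: le_trans (ler_normB _ _) _.
  by have := AM n x; move: h; rewrite /F; set u := `|p x|; set v := `|A n x|; lra.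
have M20 : 0 < 2 * M by rewrite mulr_gt0.
have iA n : mu.-integrable (obox a b) (EFin \o A n).
  apply: (@integrable_bounded _ _ _ _ _ _ M) => //; first exact: measurable_funTS.
  by apply/aeW.
have ipB : mu.-integrable (obox a b) (EFin \o p) by apply: integrableS ip.
have wI E : measurable E -> measurable E /\ weak_null mu (obox a b) F (\1_E : pt -> R).
  have box a' b' : weak_null mu (obox a b) F (\1_(obox a' b') : pt -> R).
    rewrite /weak_null; pose a2 := \row_i Num.max (a 0 i) (a' 0 i); pose b2 := \row_i Num.min (b 0 i) (b' 0 i).
    have E2 : obox a b `&` obox a' b' = obox a2 b2 by exact: oboxI.
    rewrite (_ : (fun n => _) = (fun n => \int[mu]_(y in obox a2 b2) A n y - \int[mu]_(y in obox a2 b2) p y)).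
      rewrite -[X in _ --> X](subrr (\int[mu]_(y in obox a2 b2) p y)).
      by apply: cvgB; [exact: cvg_integral_cube_avg_obox|exact: cvg_cst].
    have sub : obox a2 b2 `<=` obox a b by rewrite -E2; exact: subIsetl.
    apply/funext => n; rewrite -RintegralB //; first last.
    - by apply: integrableS ipB => //; exact: measurable_obox.
    - by apply: integrableS (iA n) => //; exact: measurable_obox.
    - exact: measurable_obox.
    by rewrite -E2 -Rintegral_indicr; apply: eq_Rintegral => y _; rewrite mulrC.
  apply: (@obox_induction _ _ (fun E => measurable E /\ weak_null mu (obox a b) F (\1_E : pt -> R))).
  - by move=> a' b'; split; [exact: measurable_obox|exact: box].
  - split=> //; have := box a b; rewrite /weak_null.
    rewrite (_ : (fun n => _) = (fun n => \int[mu]_(x in obox a b) (\1_setT x * F n x))) //.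
    apply/funext => n; apply: eq_Rintegral => x xB; rewrite !indicE in_setT.
    by move: xB => ->.
  - move=> U V VU [mU wU] [mV wV]; split; first exact: measurableD.
    exact: (weak_null_setD mB Boo mF FM).
  - move=> U ndU hU; split; first by apply: bigcupT_measurable => k; have [] := hU k.
    by apply: (weak_null_bigcup mB Boo M20 mF FM) => // k; have [] := hU k.
have := weak_null_integrable mB Boo M20 mF FM (fun E mE => (wI E mE).2) iq.
rewrite /weak_null => cv.
have iqp : mu.-integrable (obox a b) (EFin \o (fun y => q y * p y)).
  apply: (@integrableM_bounded _ _ _ _ _ _ _ M) => //; first exact: measurable_funTS.
  by apply: filterS pM => x h _.
rewrite (_ : (fun n => \int[mu]_(y in obox a b) (q y * A n y)) =
  (fun n => \int[mu]_(x in obox a b) (q x * F n x) + \int[mu]_(y in obox a b) (q y * p y))).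
  by rewrite -[X in _ --> X]add0r; apply: cvgD => //; exact: cvg_cst.
apply/funext => n; rewrite -RintegralD //.
- by apply: eq_Rintegral => y _; rewrite /F; ring.
- by apply: (@integrableM_bounded _ _ _ _ _ _ _ (2 * M)).
Qed.

End WeakLimit.
End Averages.

(** * A bounded function with bounded weak derivative times an integrable one *)

Section ProductRule.
Context (R : realType) (d : nat).
Local Notation pt := 'rV[R]_d.
Context (mu : {measure set pt -> \bar R}) (hmu : is_lebesgue mu).
Context (D : set pt) (oD : open D) (bD : exists2 N : R, 0 < N & D `<=` obox (const_mx (- N)) (const_mx N)).
Implicit Types (c f w z : pt -> R) (i : 'I_d).
Let mD : measurable D := open_measurable_rV oD.
Let m : {sigma_finite_measure set pt -> \bar R} := sigma_finite_pack (lebesgue_sigma_finite hmu).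

Lemma bounded_domain_mu_fin : (mu D < +oo)%E.
Proof.
have [N _ DN] := bD; apply: le_lt_trans (mu_obox_fin hmu (const_mx (- N)) (const_mx N)).
by apply: le_measure; rewrite ?inE //; exact: measurable_obox.
Qed.

(** The room e around the support of the test function keeps the kernel, as a function of y, a test
    function of D. *)
Lemma compact_thickening (K : set pt) : compact K -> K `<=` D ->
  exists2 e : R, 0 < e & forall x, K x -> cbox (x - const_mx e) (x + const_mx e) `<=` D.
Proof.
move=> cK KD.
have H : \forall e \near 0^'+, forall x, K x -> ball x e `<=` D.
  move/compact_near_coveringP : cK => cK.
  apply: (cK _ (0 : R)^'+ (fun e x => ball x e `<=` D)) => x Kx.
  have /nbhs_ballP[e /= e0 xe] : nbhs x D by apply: open_nbhs_nbhs; split=> //; exact: KD.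
  exists (ball x (e / 2), [set t : R | t < e / 2]) => /=.
    split; first by apply: nbhsx_ballx; rewrite divr_gt0.
    by apply: nbhs_right_lt; rewrite divr_gt0.
  move=> [y t] /= [xy te] z yz; apply: xe.
  exact: (ball_split xy (le_ball (ltW te) yz)).
have [e [he e0]] := filter_ex (filterI H (nbhs_right_gt 0)).
exists (e / 2); first by rewrite divr_gt0.
move=> x Kx y hy; apply: (he x Kx); rewrite ball_rVE // => i.
by have := hy i; rewrite !mxE => /andP[? ?]; apply/andP; split; lra.
Qed.

Section Fixed.
Context (c c' w w' : pt -> R) (i : 'I_d) (phi : pt -> R) (M : R) (M0 : 0 < M).
Hypotheses (wc : is_weak_deriv mu D i c c') (cM : {ae mu, forall x, D x -> `|c x| <= M})
  (c'M : {ae mu, forall x, D x -> `|c' x| <= M}).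
Hypotheses (ww : is_weak_deriv mu D i w w') (iw : mu.-integrable D (EFin \o w))
  (iw' : mu.-integrable D (EFin \o w')).
Hypothesis tphi : test_function D phi.

Let Doo := bounded_domain_mu_fin.
Let P1 x := c x * pderiv [:: i] phi x.
Let P2 x := c x * phi x.
Let P3 x := c' x * phi x.

Let I n e (p q : pt -> R) :=
  \int[mu]_(y in D) (q y * \int[mu]_(x in D) (p x * eta n e x y)).

Let mc : measurable_fun D c. Proof. by case: wc => -[]. Qed.
Let mc' : measurable_fun D c'. Proof. by case: wc => _ []. Qed.

Let bnd f g : measurable_fun D f -> {ae mu, forall x, D x -> `|f x| <= M} -> test_function D g ->
  exists2 M' : R, 0 < M' & {ae mu, forall x, D x -> `|f x * g x| <= M'}.
Proof.
move=> mf fM tg; have [N N0 gN] := test_bounded tg.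
exists (M * N); first exact: mulr_gt0.
by apply: filterS fM => x h Dx; rewrite normrM ler_pM ?h.
Qed.

Let ibnd f g : measurable_fun D f -> {ae mu, forall x, D x -> `|f x| <= M} -> test_function D g ->
  mu.-integrable D (EFin \o (fun x => f x * g x)).
Proof.
move=> mf fM tg; have [M' _ h] := bnd mf fM tg.
by apply: integrable_bounded h => //; apply: measurable_funM => //; exact: (test_measurable mD tg).
Qed.

Let iP1 : mu.-integrable D (EFin \o P1). Proof. by apply: ibnd => //; exact: test_pderiv1. Qed.
Let iP2 : mu.-integrable D (EFin \o P2). Proof. exact: ibnd. Qed.
Let iP3 : mu.-integrable D (EFin \o P3). Proof. exact: ibnd. Qed.

Let fubD p q (k : pt * pt -> R) (N : R) : mu.-integrable D (EFin \o p) -> mu.-integrable D (EFin \o q) ->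
  measurable_fun setT k -> (forall zz, `|k zz| <= N) ->
  \int[mu]_(x in D) (p x * \int[mu]_(y in D) (q y * k (x, y))) =
  \int[mu]_(y in D) (q y * \int[mu]_(x in D) (p x * k (x, y))).
Proof.
move=> /(integrable_mkcond _ mD); rewrite restrict_EFin => ip.
move=> /(integrable_mkcond _ mD); rewrite restrict_EFin => iq mk kN.
have E (f g : pt -> R) : \int[mu]_(x in D) (f x * g x) = \int[mu]_x ((f \_ D) x * g x).
  rewrite Rintegral_mkcond; apply: eq_Rintegral => x _; rewrite !patchE.
  by case: ifP => // _; rewrite mul0r.
rewrite !E.
under eq_Rintegral do rewrite E; under [RHS]eq_Rintegral do rewrite E.
exact: (@Rfubini_kernel _ _ _ m _ _ k N ip iq mk kN).
Qed.

Let etaN n e (zz : pt * pt) : `|eta n e zz.1 zz.2| <= 1.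
Proof. by have /andP[h1 h2] := prod_plateau_ge0_le1 n e zz.1 zz.2 predT; rewrite ger0_norm. Qed.

(* Doubling of variables: only derivatives of the kernel eta(x - y) are moved, c is tested in x and w in y. *)
Lemma mollified_product_rule n (e : R) : 0 < e ->
  (forall x, phi x != 0 -> cbox (x - const_mx e) (x + const_mx e) `<=` D) ->
  I n e P1 w + I n e P2 w' = - I n e P3 w.
Proof.
move=> e0 he.
have meta := @measurable_eta R d n e; have mdeta := @measurable_deta R d n e i.
have [N N0 dN] := deta_bounded n e i.
(* the weak derivative of c tested against phi * eta(., y) *)
have stepA y : \int[mu]_(x in D) (P1 x * eta n e x y) + \int[mu]_(x in D) (P2 x * deta n e i x y) =
   - \int[mu]_(x in D) (P3 x * eta n e x y).
  have se : smooth (eta n e ^~ y).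
    rewrite (_ : eta n e ^~ y = boxbump n (y - const_mx e) (y + const_mx e)); first exact: smooth_boxbump.
    by apply/funext => x; rewrite eta_boxbumpl.
  have tp := test_mul se tphi.
  have [_ _ /(_ _ tp)] := wc.
  rewrite (_ : pderiv [:: i] _ = fun x => phi x * deta n e i x y + eta n e x y * pderiv [:: i] phi x).
    have -> : \int[mu]_(x in D) (c' x * (phi x * eta n e x y)) = \int[mu]_(x in D) (P3 x * eta n e x y).
      by apply: eq_Rintegral => x _; rewrite /P3 mulrA.
    move=> <-; rewrite -RintegralD //; first by apply: eq_Rintegral => x _; rewrite /P1 /P2; ring.
      apply: (@integrableM_bounded _ _ _ _ _ _ _ 1) => //.
        by apply: measurable_funTS; exact: (measurableT_comp meta (pair2_measurable y)).
      by apply/aeW => x _; exact: (etaN n e (x, y)).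
    apply: (@integrableM_bounded _ _ _ _ _ _ _ N) => //.
      by apply: measurable_funTS; exact: (measurableT_comp mdeta (pair2_measurable y)).
    by apply/aeW => x _.
  apply/funext => x /=; have [D1 D2] := is_derive_etal n e i x y.
  have := deriveM (@smooth_derivable _ _ _ x i (test_smooth tphi)) D1.
  by rewrite D2 => <-.
(* the weak derivative of w tested against eta(x, .) *)
have stepB x : P2 x * \int[mu]_(y in D) (w y * deta n e i x y) =
    P2 x * \int[mu]_(y in D) (w' y * eta n e x y).
  have [px|px] := eqVneq (phi x) 0; first by rewrite /P2 px mulr0 !mul0r.
  congr (_ * _); have te : test_function D (eta n e x).
    rewrite (_ : eta n e x = boxbump n (x - const_mx e) (x + const_mx e)); first exact/test_boxbump/he.
    by apply/funext => y; rewrite eta_boxbumpr.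
  have [_ _ /(_ _ te) H] := ww; apply/eqP; rewrite -eqr_opp -H; apply/eqP.
  rewrite -mulN1r -RintegralZl //.
    apply: eq_Rintegral => y _ /=; have [_ ->] := is_derive_etar n e i x y; ring.
  apply: (@integrableM_bounded _ _ _ _ _ _ _ N) => //.
    by apply: measurable_funTS; exact: (measurableT_comp mdeta (pair1_measurable x)).
  by apply/aeW => y _.
(* Fubini puts the integral in y inside, [stepB] passes the derivative of the kernel to w for each
   fixed x, and Fubini restores the order. *)
have E2 : \int[mu]_(y in D) (w y * \int[mu]_(x in D) (P2 x * deta n e i x y)) = I n e P2 w'.
  have F1 := fubD iP2 iw mdeta (fun zz : pt * pt => dN zz.1 zz.2); have F2 := fubD iP2 iw' meta (etaN n e).
  rewrite /I -F1 -F2; apply: eq_Rintegral => x _; exact: stepB.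
have intq (p q : pt -> R) (k : pt * pt -> R) (N' : R) : mu.-integrable D (EFin \o p) -> mu.-integrable D (EFin \o q) ->
   measurable_fun setT k -> (forall zz, `|k zz| <= N') ->
   mu.-integrable D (EFin \o (fun y => q y * \int[mu]_(x in D) (p x * k (x, y)))).
  move=> ip iq mk kN.
  have ip' := ip; move/(integrable_mkcond _ mD) : ip'; rewrite restrict_EFin => ip'.
  have E y : \int[mu]_(x in D) (p x * k (x, y)) = \int[mu]_x ((p \_ D) x * k (x, y)).
    rewrite Rintegral_mkcond; apply: eq_Rintegral => x _; rewrite !patchE.
    by case: ifP => // _; rewrite mul0r.
  apply: (@integrableM_bounded _ _ _ _ _ _ _ (N' * \int[mu]_x `|(p \_ D) x|)) => //.
    under eq_fun do rewrite E; apply: measurable_funTS.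
    exact: (@kernel_average_measurable _ _ _ m _ k ip' mk).
  apply/aeW => y _; rewrite E.
  exact: (@kernel_average_bounded _ _ _ m _ k N' ip' mk kN).
rewrite -E2 /I -RintegralD //; first last.
- exact: (intq _ _ _ _ iP2 iw mdeta (fun zz : pt * pt => dN zz.1 zz.2)).
- exact: (intq _ _ _ _ iP1 iw meta (etaN n e)).
rewrite -mulN1r -RintegralZl //; last exact: (intq _ _ _ _ iP3 iw meta (etaN n e)).
by apply: eq_Rintegral => y _; rewrite -mulrDr stepA; ring.
Qed.

Let patch_mul (f g : pt -> R) : \int[mu]_(x in D) (f x * g x) = \int[mu]_x ((f \_ D) x * g x).
Proof.
rewrite Rintegral_mkcond; apply: eq_Rintegral => x _; rewrite !patchE.
by case: ifP => // _; rewrite mul0r.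
Qed.

Let patch_int (p : pt -> R) : mu.-integrable D (EFin \o p) -> mu.-integrable setT (EFin \o (p \_ D)).
Proof. by move=> /(integrable_mkcond _ mD); rewrite restrict_EFin. Qed.

(** For fixed e the smooth kernel tends to the indicator of the cube, that is to [cube_vol d e]
    times the normalised kernel. Dominated convergence is used twice, in x and then in y. *)
Let cvg_mollified (p q : pt -> R) e : 0 < e -> mu.-integrable D (EFin \o p) -> mu.-integrable D (EFin \o q) ->
  I n e p q @[n --> \oo] --> cube_vol d e * \int[mu]_(y in D) (q y * cube_avg mu (p \_ D) e y).
Proof.
move=> e0 ip iq; have ip' := patch_int ip.
have v0 := cube_vol_gt0 d e0.
have mq : measurable_fun D q by apply/measurable_EFinP; exact: measurable_int iq.
have mp' : measurable_fun setT (p \_ D) by apply/measurable_EFinP; exact: measurable_int ip'.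
have mA : measurable_fun setT (cube_avg mu (p \_ D) e) by exact: measurable_cube_avg.
have iqA : mu.-integrable D (EFin \o (fun y => q y * cube_avg mu (p \_ D) e y)).
  apply: (@integrableM_bounded _ _ _ _ _ _ _ ((cube_vol d e)^-1 * \int[mu]_x `|(p \_ D) x|)) => //.
    exact: measurable_funTS.
  apply/aeW => y _.
  exact: (@kernel_average_bounded _ _ _ m (p \_ D) (cube_kernel e) (cube_vol d e)^-1 ip' (@measurable_cube_kernel R d e) (fun zz => cube_kernel_norm_le zz e0) y).
rewrite -RintegralZl //.
apply: (@Rdominated_convergence _ _ _ _ _ _ _ (fun y => `|q y| * \int[mu]_x `|(p \_ D) x|)) => //.
- move=> n; apply: measurable_funM => //; apply: measurable_funTS.
  under eq_fun do rewrite patch_mul.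
  exact: (@kernel_average_measurable _ _ _ m _ _ ip' (@measurable_eta R d n e)).
- by apply: measurable_funM => //; apply: measurable_funM => //; exact: measurable_funTS.
- apply/aeW => y _; rewrite mulrCA; apply: cvgMl_tmp.
  under eq_fun do rewrite patch_mul.
  rewrite -RintegralZl //; last first.
    apply: (@integrableM_bounded _ _ _ _ _ _ _ (cube_vol d e)^-1) => //.
      exact: (measurableT_comp (@measurable_cube_kernel R d e) (pair2_measurable y)).
    by apply/aeW => x _; exact: cube_kernel_norm_le.
  apply: (@Rdominated_convergence _ _ _ _ _ _ _ (fun x => `|(p \_ D) x|)) => //.
  + move=> n; apply: measurable_funM => //.
    exact: (measurableT_comp (@measurable_eta R d n e) (pair2_measurable y)).
  + apply: measurable_funM => //; apply: measurable_funM => //.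
    exact: (measurableT_comp (@measurable_cube_kernel R d e) (pair2_measurable y)).
  + apply/aeW => x _; rewrite mulrCA; apply: cvgMl_tmp; rewrite cube_kernelE mulrA divff ?gt_eqF // mul1r.
    under eq_fun do rewrite eta_boxbumpl; exact: cvg_boxbump.
  + exact: integrable_fnorm.
  + by apply/aeW => x n _; rewrite normrM ler_piMr //; exact: (etaN n e (x, y)).
- have := integrable_fscale (\int[mu]_x `|(p \_ D) x|) mD (integrable_fnorm mD iq).
  by apply: eq_integrable => // y _; rewrite /= mulrC.
- apply/aeW => y n _; rewrite normrM ler_wpM2l // patch_mul.
  rewrite -[leRHS]mul1r.
  exact: (@kernel_average_bounded _ _ _ m _ _ 1 ip' (@measurable_eta R d n e) (etaN n e)).
Qed.

Let cube_product_rule (e : R) : 0 < e ->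
  (forall x, phi x != 0 -> cbox (x - const_mx e) (x + const_mx e) `<=` D) ->
  \int[mu]_(y in D) (w y * cube_avg mu (P1 \_ D) e y) +
  \int[mu]_(y in D) (w' y * cube_avg mu (P2 \_ D) e y) =
  - \int[mu]_(y in D) (w y * cube_avg mu (P3 \_ D) e y).
Proof.
move=> e0 he; have v0 := cube_vol_gt0 d e0.
apply: (mulfI (lt0r_neq0 v0)); rewrite mulrDr mulrN.
have c1 : I n e P1 w + I n e P2 w' @[n --> \oo] --> _ :=
  cvgD (cvg_mollified e0 iP1 iw) (cvg_mollified e0 iP2 iw').
have c2 : - I n e P3 w @[n --> \oo] --> _ := cvgN (cvg_mollified e0 iP3 iw).
have {}c1 := c1 eventually_filter; have {}c2 := c2 eventually_filter.
have E : \forall n \near \oo, (- I n e P3 w = I n e P1 w + I n e P2 w').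
  by apply: nearW => n; rewrite mollified_product_rule.
have c3 := cvg_trans (near_eq_cvg E) c2; have {}c3 := c3 eventually_filter; exact: (cvg_unique (@Rhausdorff R) c1 c3).
Qed.

(** The averages are handled on a box, so the bounded set D is enclosed in a cube and all functions
    are extended by 0. *)
Let cvg_cube (f g q : pt -> R) : measurable_fun D f -> {ae mu, forall x, D x -> `|f x| <= M} ->
  test_function D g -> mu.-integrable D (EFin \o q) ->
  \int[mu]_(y in D) (q y * cube_avg mu ((fun x => f x * g x) \_ D) (harmonic n) y) @[n --> \oo] -->
  \int[mu]_(y in D) (q y * (f y * g y)).
Proof.
move=> mf fM tg iq; have [M' M'0 hM'] := bnd mf fM tg.
have ip' := patch_int (ibnd mf fM tg).
have pM : {ae mu, forall x, `|((fun x => f x * g x) \_ D) x| <= M'}.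
  apply: filterS hM' => x h; rewrite patchE; case: ifPn => [|_]; last by rewrite normr0 ltW.
  by rewrite inE => /h.
have [N N0 DN] := bD.
have mQ := measurable_obox (const_mx (- N) : pt) (const_mx N).
have E (h : pt -> R) : \int[mu]_(y in D) (q y * h y) =
   \int[mu]_(y in obox (const_mx (- N)) (const_mx N)) ((q \_ D) y * h y).
  rewrite Rintegral_mkcond [RHS]Rintegral_mkcond; apply: eq_Rintegral => y _; rewrite !patchE.
  have [yD|yD] := boolP (y \in D); last by rewrite mul0r; case: ifP.
  by rewrite mem_set //; apply: DN; rewrite -inE.
under eq_fun do rewrite E.
rewrite E (_ : \int[mu]_(y in _) (_ * (f y * g y)) =
   \int[mu]_(y in obox (const_mx (- N)) (const_mx N)) ((q \_ D) y * ((fun x => f x * g x) \_ D) y)).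
  apply: (cvg_integral_cube_avg hmu M'0 ip' pM).
  by apply: integrableS (patch_int iq).
by apply: eq_Rintegral => y _; rewrite !patchE; case: ifP => // _; rewrite !mul0r.
Qed.

(** The second limit: the cube of half-side [harmonic n] shrinks. The averaged factors contain c or
    c' times a smooth function, hence are bounded, and w, w' serve as the fixed integrable test
    functions. *)
Lemma weak_product_test : \int[mu]_(x in D) (c x * w x * pderiv [:: i] phi x) =
  - \int[mu]_(x in D) ((c' x * w x + c x * w' x) * phi x).
Proof.
have [K [cK KD fK]] : exists K, [/\ compact K, K `<=` D & forall x, ~ K x -> phi x = 0] by case: tphi.
have [e e0 he] := compact_thickening cK KD.
have h0 n : 0 < harmonic n :> R by rewrite invr_gt0.
pose T (p q : pt -> R) (n : nat) : R := \int[mu]_(y in D) (q y * cube_avg mu (p \_ D) (harmonic n) y).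
have c1 : T P1 w n + T P2 w' n @[n --> \oo] --> _ :=
  cvgD (cvg_cube mc cM (test_pderiv1 i tphi) iw) (cvg_cube mc cM tphi iw').
have c2 : - T P3 w n @[n --> \oo] --> _ := cvgN (cvg_cube mc' c'M tphi iw).
have {}c1 := c1 eventually_filter; have {}c2 := c2 eventually_filter.
(* The identity is available once the cube is smaller than the room e around the support of phi. *)
have E : \forall n \near \oo, (- T P3 w n = T P1 w n + T P2 w' n).
  move/cvgr0Pnorm_lt : (@cvg_harmonic R) => /(_ _ e0); apply: filterS => n; rewrite (gtr0_norm (h0 n)) => hn.
  apply/esym; apply: cube_product_rule => // x px.
  have Kx : K x by apply: contrapT => /fK; apply/eqP.
  apply: subset_trans (he x Kx) => y hy j; have := hy j; rewrite !mxE.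
  by move: hn; move: (harmonic n) => t ht /andP[? ?]; apply/andP; split; lra.
have c3 := cvg_trans (near_eq_cvg E) c2; have {}c3 := c3 eventually_filter; have H : \int[mu]_(y in D) (w y * (c y * pderiv [:: i] phi y)) + \int[mu]_(y in D) (w' y * (c y * phi y)) =
    - \int[mu]_(y in D) (w y * (c' y * phi y)) by exact: (cvg_unique (@Rhausdorff R) c1 c3).
have ii1 (q f : pt -> R) g : mu.-integrable D (EFin \o q) -> measurable_fun D f -> {ae mu, forall x, D x -> `|f x| <= M} ->
  test_function D g -> mu.-integrable D (EFin \o (fun y => q y * (f y * g y))).
  move=> iq mf fM tg; have [M' _ hM'] := bnd mf fM tg.
  apply: integrableM_bounded iq _ hM' => //; apply: measurable_funM => //; exact: (test_measurable mD tg).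
transitivity (\int[mu]_(y in D) (w y * (c y * pderiv [:: i] phi y))).
  by apply: eq_Rintegral => x _; rewrite mulrCA mulrA.
move/eqP: H; rewrite -subr_eq0 opprK -addrA addr_eq0 => /eqP ->.
congr (- _); rewrite -RintegralD //; [|exact: ii1|exact: ii1].
by apply: eq_Rintegral => x _; ring.
Qed.

End Fixed.

Lemma weak_product_rule i c c' w w' (M : R) : is_weak_deriv mu D i c c' ->
  {ae mu, forall x, D x -> `|c x| <= M} -> {ae mu, forall x, D x -> `|c' x| <= M} ->
  is_weak_deriv mu D i w w' ->
  mu.-integrable D (EFin \o w) -> mu.-integrable D (EFin \o w') ->
  is_weak_deriv mu D i (fun x => c x * w x) (fun x => c' x * w x + c x * w' x).
Proof.
move=> wc cM c'M ww iw iw'.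
have cM1 : {ae mu, forall x, D x -> `|c x| <= Num.max 1 M}.
  by apply: filterS cM => x h Dx; rewrite le_max h ?orbT.
have c'M1 : {ae mu, forall x, D x -> `|c' x| <= Num.max 1 M}.
  by apply: filterS c'M => x h Dx; rewrite le_max h ?orbT.
have M0 : 0 < Num.max 1 M by rewrite lt_max ltr01.
have [[mc _] [mc' _] _] := wc.
have i1 (f q : pt -> R) : measurable_fun D f -> {ae mu, forall x, D x -> `|f x| <= Num.max 1 M} ->
    mu.-integrable D (EFin \o q) -> mu.-integrable D (EFin \o (fun x => f x * q x)).
  move=> mf fM iq; have := integrableM_bounded mD iq mf fM; apply: eq_integrable => // x _ /=.
  by rewrite mulrC.
have L (f : pt -> R) : mu.-integrable D (EFin \o f) -> in_L1loc mu D f.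
  move=> fi; split; first by apply/measurable_EFinP; exact: measurable_int fi.
  by move=> K cK KD; apply: integrableS fi => //; exact: compact_measurable_rV.
split; [exact/L/i1|apply: L; apply: integrable_fadd => //; exact: i1|].
by move=> phi tphi; exact: (weak_product_test M0 wc cM1 c'M1 ww iw iw' tphi).
Qed.

End ProductRule.

(** * Coefficients in W1inf *)

Section W1inf.
Context (R : realType) (d : nat).
Local Notation pt := 'rV[R]_d.
Context (mu : {measure set pt -> \bar R}) (hmu : is_lebesgue mu).
Context (D : set pt) (oD : open D) (bD : exists2 N : R, 0 < N & D `<=` obox (const_mx (- N)) (const_mx N)).
Implicit Types (f c u v w z : pt -> R) (i j : 'I_d) (k : R).
Let mD : measurable D := open_measurable_rV oD.
Let Doo : (mu D < +oo)%E := bounded_domain_mu_fin hmu oD bD.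
Local Notation L2 := (in_L2 mu D).
Local Notation H1 := (in_H1 mu D).
Local Notation H10 := (in_H10 mu D).
Local Notation wd := (wderiv mu D).

Lemma Linfnorm_leP f (M : R) : 0 <= M ->
  (Linfnorm mu D f <= M%:E)%E <-> {ae mu, forall x, D x -> `|f x| <= M}.
Proof.
move=> M0; split.
  move/ess_supP; apply: filterS => x; rewrite lee_fin patchE => h Dx.
  by move: h; rewrite mem_set.
move=> h; apply/ess_supP; apply: filterS h => x h; rewrite lee_fin patchE.
by case: ifPn => [|_]; [rewrite inE|rewrite normr0].
Qed.

Lemma W1infnorm_ge0 f : (0 <= W1infnorm mu D f)%E.
Proof.
rewrite /W1infnorm le_max; apply/orP; right.
by elim/big_rec : _ => // i x _ x0; rewrite le_max x0 orbT.
Qed.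

(* the ball of radius [k] of W^{1,oo}(D), without reference to the chosen representatives [wderiv] *)
Definition W1le c k : Prop := [/\ measurable_fun D c, {ae mu, forall x, D x -> `|c x| <= k} &
  forall i, exists2 z, is_weak_deriv mu D i c z & {ae mu, forall x, D x -> `|z x| <= k}].

Lemma W1infnorm_leP c k : 0 <= k ->
  (in_W1inf mu D c /\ (W1infnorm mu D c <= k%:E)%E) <-> W1le c k.
Proof.
move=> k0; split.
  move=> [[[mc _] hc] ]; rewrite /W1infnorm ge_max => /andP[ck dk]; split=> //.
    exact/Linfnorm_leP.
  move=> i; have [wi _] := hc i; exists (wd i c); first exact: wderivP.
  apply/Linfnorm_leP => //; apply: le_trans dk.
  by rewrite (bigD1 i) //= le_max lexx.
move=> [mc ck hc].
have hi i : (Linfnorm mu D (wd i c) <= k%:E)%E.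
  have [z wz zk] := hc i; apply/Linfnorm_leP => //.
  by apply: filterS2 (wderiv_ae oD wz) zk => x e h Dx; rewrite e ?h.
have mi i : weakly_derivable mu D i c by have [z wz _] := hc i; exists z.
split.
  split; first by split=> //; apply: le_lt_trans (ltry k); apply/Linfnorm_leP.
  move=> i; split=> //; split; last by apply: le_lt_trans (ltry k).
  by have [_ [] ] := wderivP (mi i).
rewrite /W1infnorm ge_max; apply/andP; split; first exact/Linfnorm_leP.
by elim/big_rec : _ => [|i x _ xk]; rewrite ?lee_fin // ge_max hi.
Qed.

Lemma W1inf_bounded c : in_W1inf mu D c -> exists2 k, 0 <= k & W1le c k.
Proof.
move=> hc; have [] := hc => -[mc coo] hi.
have : (W1infnorm mu D c < +oo)%E.
  rewrite /W1infnorm gt_max coo /=; elim/big_rec : _ => [|i x _ xoo]; first exact: ltry.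
  by rewrite gt_max xoo andbT; case: (hi i) => _ [].
have := W1infnorm_ge0 c; case E : (W1infnorm mu D c) => [k| |] // k0 _.
by exists k; rewrite ?lee_fin // in k0 *; apply/W1infnorm_leP => //; split=> //; rewrite E.
Qed.

Lemma W1le_linear k c c' m m' : W1le c m -> W1le c' m' -> W1le (k *: c + c') (`|k| * m + m').
Proof.
have A f g : {ae mu, forall x, D x -> `|f x| <= m} -> {ae mu, forall x, D x -> `|g x| <= m'} ->
    {ae mu, forall x, D x -> `|k * f x + g x| <= `|k| * m + m'}.
  apply: filterS2 => x fm gm Dx; apply: le_trans (ler_normD _ _) _.
  by rewrite normrM lerD ?ler_wpM2l ?fm ?gm.
move=> [mc cm dc] [mc' cm' dc']; split.
- by apply: measurable_funD => //; exact: measurable_funM.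
- exact: A.
- move=> i; have [z wz zm] := dc i; have [z' wz' zm'] := dc' i.
  exists (fun x => k * z x + z' x); last exact: A.
  exact: (is_weak_deriv_linear oD k wz wz').
Qed.

Lemma W1le_mono c m m' : m <= m' -> W1le c m -> W1le c m'.
Proof.
move=> mm' [mc cm dc]; split=> //.
  by apply: filterS cm => x h Dx; apply: le_trans mm'; exact: h.
move=> i; have [z wz zm] := dc i; exists z => //.
by apply: filterS zm => x h Dx; apply: le_trans mm'; exact: h.
Qed.

Lemma W1le_sub c c' m m' : W1le c m -> W1le c' m' -> W1le (c \- c') (m + m').
Proof.
move=> cm cm'; have := W1le_linear (-1) cm' cm; rewrite normrN normr1 mul1r [m' + m]addrC.
by rewrite (_ : -1 *: c' + c = c \- c') //; apply/funext => x; rewrite fctE /= fctE scaleN1r addrC.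
Qed.

Lemma L2dot0l v : L2dot mu D 0 v = 0.
Proof.
rewrite /L2dot (_ : (fun x => _) = cst 0); last by apply/funext => x; rewrite mul0r.
by rewrite Rintegral_cst // mul0r.
Qed.

Lemma L2_sum (s : seq 'I_d) (F : 'I_d -> pt -> R) (b : R) :
  (forall i, L2 (F i)) -> (forall i, L2norm mu D (F i) <= b) ->
  [/\ L2 (\sum_(i <- s) F i), L2norm mu D (\sum_(i <- s) F i) <= (size s)%:R * b &
    forall v, L2 v -> L2dot mu D (\sum_(i <- s) F i) v = \sum_(i <- s) L2dot mu D (F i) v].
Proof.
move=> LF Fb; elim: s => [|i s [IH1 IH2 IH3]].
  rewrite big_nil mul0r; split; first exact: L2_0.
    by rewrite L2normE L2dot0l sqrtr0.
  by move=> v _; rewrite big_nil L2dot0l.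
have E : \sum_(j <- i :: s) F j = 1 *: F i + \sum_(j <- s) F j by rewrite big_cons scale1r.
rewrite E; split; first exact: L2_linear.
  apply: le_trans (L2_triangle _ _ _ _) _ => //; rewrite normr1 mul1r /= -natr1 mulrDl mul1r addrC.
  exact: lerD.
by move=> v Lv; rewrite L2dot_linear // mul1r IH3 // big_cons.
Qed.

Lemma H1norm_le_H2norm u : H1norm mu D u <= H2norm mu D u.
Proof.
rewrite -[leLHS]ger0_norm ?H1norm_ge0 // -sqrtr_sqr ler_sqrt.
  by rewrite lerDl sumr_ge0 // => i _; rewrite sumr_ge0 // => j _; exact: sqr_ge0.
by rewrite addr_ge0 ?sqr_ge0 // sumr_ge0 // => i _; rewrite sumr_ge0 // => j _; exact: sqr_ge0.
Qed.

Lemma H2norm_ge0 u : 0 <= H2norm mu D u.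
Proof. exact: sqrtr_ge0. Qed.

Lemma L2norm_wderiv2_le_H2norm u i j : L2norm mu D (wd j (wd i u)) <= H2norm mu D u.
Proof.
pose f a b := L2norm mu D (wd b (wd a u)) ^+ 2.
have f0 a b : 0 <= f a b by exact: sqr_ge0.
have F0 a : 0 <= \sum_b f a b by apply: sumr_ge0 => b _.
have S0 : 0 <= \sum_a \sum_b f a b by apply: sumr_ge0.
rewrite -[leLHS]ger0_norm ?L2norm_ge0 // -sqrtr_sqr ler_sqrt; last by rewrite addr_ge0 ?sqr_ge0.
apply: (@le_trans _ _ (\sum_a \sum_b f a b)); last by rewrite lerDr sqr_ge0.
apply: (@le_trans _ _ (\sum_b f i b)).
  by rewrite (bigD1 j) //= lerDl sumr_ge0.
by rewrite [leRHS](bigD1 i) //= lerDl sumr_ge0.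
Qed.

(* [F] is [- div (c grad u)] *)
Lemma W1le_divergence c k u : 0 <= k -> W1le c k -> in_H2 mu D u ->
  exists F, [/\ L2 F, L2norm mu D F <= 2 * d%:R * k * H2norm mu D u &
    forall v, H10 v -> bform mu D c u v = L2dot mu D F v].
Proof.
move=> k0 [mc ck dc] [Hu Hui].
pose c' i := xget (fun=> 0) [set z | is_weak_deriv mu D i c z /\ {ae mu, forall x, D x -> `|z x| <= k}].
have hc' i : is_weak_deriv mu D i c (c' i) /\ {ae mu, forall x, D x -> `|c' i x| <= k}.
  rewrite /c'; case: xgetP => [z -> //|/(_ _) h].
  by have [z wz zk] := dc i; case: (h z).
pose Fi i := (-1) *: ((fun x => c' i x * wd i u x) + (fun x => c x * wd i (wd i u) x)).
have mc' i : measurable_fun D (c' i) by have [[_ []]] := hc' i.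
have B1 i := L2_mul_bounded mD k0 (mc' i) (hc' i).2 (H1_wderiv_L2 i Hu).
have B2 i := L2_mul_bounded mD k0 mc ck (H1_wderiv_L2 i (Hui i)).
have FE i : Fi i = (-1) *: (fun x => c' i x * wd i u x) + ((-1) *: (fun x => c x * wd i (wd i u) x) + 0).
  by rewrite addr0 -scalerDr.
have L0 : L2 0 by exact: L2_0.
have N0 : L2norm mu D 0 = 0.
  by rewrite L2normE L2dot0l sqrtr0.
have LF i : L2 (Fi i).
  rewrite FE; apply: L2_linear => //; first exact: (B1 i).1.
  by apply: L2_linear => //; exact: (B2 i).1.
(* Each direction contributes a term with a derivative of c and one with a second derivative of u,
   whence the 2; the d directions supply the other factor. *)
have NF i : L2norm mu D (Fi i) <= 2 * k * H2norm mu D u.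
  rewrite FE; apply: le_trans (L2_triangle _ _ _ _) _ => //; first exact: (B1 i).1.
    by apply: L2_linear => //; exact: (B2 i).1.
  rewrite normrN1 mul1r.
  have := L2_triangle mD (-1) (B2 i).1 L0; rewrite normrN1 mul1r N0.
  rewrite [X in _ <= X]addr0 => h.
  rewrite -mulrA mulr_natl mulr2n.
  apply: lerD.
    apply: le_trans (B1 i).2 _; rewrite ler_wpM2l //.
    exact: le_trans (L2norm_wderiv_le_H1norm mu D u i) (H1norm_le_H2norm u).
  by apply: le_trans h _; apply: le_trans (B2 i).2 _; rewrite ler_wpM2l // L2norm_wderiv2_le_H2norm.
have [LS NS SS] := L2_sum (index_enum 'I_d) LF NF.
exists (\sum_i Fi i); split=> //.
  apply: le_trans NS _; rewrite -[size _]/(size (index_enum _)).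
  have -> : size (index_enum 'I_d) = d by rewrite [index_enum _]unlock -enumT size_enum_ord.
  by rewrite !mulrA [_ * 2]mulrC.
have T v : test_function D v -> bform mu D c u v = L2dot mu D (\sum_i Fi i) v.
  move=> tv; have [Hv Hvi] := H1_test hmu oD Doo tv.
  rewrite SS; last exact: H1_L2.
  rewrite (bformE oD k0 mc ck) //; apply: eq_bigr => i _.
  have mci : measurable_fun D (fun x => c x * wd i u x).
    by apply: measurable_funM => //; exact: L2_measurable (H1_wderiv_L2 i Hu).
  transitivity (L2dot mu D (fun x => c x * wd i u x) (pderiv [:: i] v)).
    apply: L2dot_ae => //; first exact: L2_measurable (H1_wderiv_L2 i Hv).
    - exact: (test_measurable mD (test_pderiv1 i tv)).
    - by apply/aeW.
  have := weak_product_rule hmu oD bD (hc' i).1 ck (hc' i).2 (H1_weak i (Hui i))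
    (L2_integrable mD Doo (H1_wderiv_L2 i Hu)) (L2_integrable mD Doo (H1_wderiv_L2 i (Hui i))).
  move=> [_ _ /(_ _ tv)]; rewrite /L2dot => ->.
  rewrite -mulN1r -RintegralZl //.
    by apply: eq_Rintegral => x _; rewrite /Fi /= fctE /= fctE mulrA mulN1r scaleN1r.
  have h := integrable_fadd mD (L2_mul_integrable mD (B1 i).1 (H1_L2 Hv)) (L2_mul_integrable mD (B2 i).1 (H1_L2 Hv)).
  by apply: eq_integrable h => // x _ /=; rewrite mulrDl.
move=> v Hv; have H1v := H10_H1 Hv; have [_ app] := Hv.
apply/eqP; rewrite -subr_eq0 -normr_eq0; apply/eqP/le_anti; rewrite normr_ge0 andbT.
(* K is the H1-continuity constant of the difference of the two sides as a functional of v. This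
   functional vanishes on test functions, which are dense in [H10]. *)
set K := k * H1norm mu D u + L2norm mu D (\sum_i Fi i).
have K0 : 0 <= K by rewrite addr_ge0 ?L2norm_ge0 // mulr_ge0 ?H1norm_ge0.
apply/ler_addgt0Pl => e e0; rewrite addr0.
have [phi [tphi hphi]] := app (e / (K + 1)) (divr_gt0 e0 (ltr_wpDl K0 ltr01)).
have [Hp _] := H1_test hmu oD Doo tphi.
pose z := (-1) *: phi + v.
have zE : v \- phi = z by apply/funext => x; rewrite /z fctE /= scaleN1r addrC.
rewrite zE in hphi.
have Hz : H1 z by exact: (H1_linear oD (-1) Hp H1v).1.
have E1 := bform_linearr oD k0 mc ck (-1) Hp H1v Hu.
have E2 := L2dot_linearr mD (-1) (H1_L2 Hp) (H1_L2 H1v) LS.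
have -> : bform mu D c u v - L2dot mu D (\sum_i Fi i) v = bform mu D c u z - L2dot mu D (\sum_i Fi i) z.
  by rewrite /z E1 E2 (T _ tphi) !mulN1r opprD opprK addrACA addNr add0r.
apply: le_trans (ler_normB _ _) _.
have h1 := bform_bounded oD k0 mc ck Hu Hz.
have h2 := L2_CS mD LS (H1_L2 Hz).
apply: (@le_trans _ _ (K * H1norm mu D z)).
  rewrite /K mulrDl; apply: lerD => //; apply: le_trans h2 _.
  by rewrite ler_wpM2l ?L2norm_ge0 ?L2norm_le_H1norm.
apply: (@le_trans _ _ (K * (e / (K + 1)))); first by rewrite ler_wpM2l // ltW.
rewrite mulrCA ler_piMr ?(ltW e0) // ler_pdivrMr ?ltr_wpDl // mul1r.
by rewrite lerDl.
Qed.

End W1inf.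

(** * Galerkin approximation *)

Section Galerkin.
Context (R : realType) (E : lmodType R) (V X : set E) (N : E -> R).
Context (Amin Amax : R) (Amin0 : 0 < Amin) (Amin1 : Amin <= 1) (Amax0 : 0 <= Amax).
Hypothesis Vlin : forall (k : R) u v, V u -> V v -> V (k *: u + v).
Hypothesis Xlin : forall (k : R) u v, X u -> X v -> X (k *: u + v).
Hypothesis XV : X `<=` V.
Hypothesis N_ge0 : forall u, V u -> 0 <= N u.
Hypothesis N_triangle : forall (k : R) u v, V u -> V v -> N (k *: u + v) <= `|k| * N u + N v.

Definition energy_form (a : E -> E -> R) : Prop :=
  [/\ forall (k : R) u v w, V u -> V v -> V w -> a (k *: u + v) w = k * a u w + a v w,
      forall u v, V u -> V v -> a u v = a v u,
      forall u, V u -> Amin * N u ^+ 2 <= a u u &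
      forall u v, V u -> V v -> `|a u v| <= Amax * N u * N v].

(** The distance from u to X is at most t. A best approximation need not exist, hence the slack
    e. *)
Definition approximable u (t : R) : Prop :=
  forall e : R, 0 < e -> exists2 v, X v & N (u - v) <= t + e.

Lemma subspace_sub u v : V u -> V v -> V (u - v).
Proof. by move=> Vu Vv; rewrite addrC -scaleN1r; exact: Vlin. Qed.

Let Xsub u v : X u -> X v -> X (u - v).
Proof. by move=> Vu Vv; rewrite addrC -scaleN1r; exact: Xlin. Qed.

Let Nsub u v : V u -> V v -> N (u - v) <= N u + N v.
Proof.
by move=> Vu Vv; rewrite addrC -scaleN1r (le_trans (N_triangle _ _ _)) // normrN1 mul1r addrC.
Qed.

Lemma approximable_le u t (Q c b : R) : V u -> 0 <= c -> approximable u t ->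
  (forall v, X v -> Q <= c * N (u - v) + b) -> Q <= c * t + b.
Proof.
move=> Vu c0 ap h; apply/ler_addgt0Pr => e e0.
have c1 : 0 < c + 1 by exact: ltr_wpDl.
have [v Xv hv] := ap _ (divr_gt0 e0 c1).
apply: le_trans (h v Xv) _; rewrite addrAC lerD2r.
apply: (@le_trans _ _ (c * (t + e / (c + 1)))); first exact: ler_wpM2l.
rewrite mulrDr lerD2l mulrCA ler_piMr ?(ltW e0) // ler_pdivrMr // mul1r.
by rewrite lerDl.
Qed.

Lemma approximable_ge0 u t : V u -> approximable u t -> 0 <= t.
Proof.
move=> Vu ap; apply/ler_addgt0Pr => e e0; have [v Xv h] := ap e e0.
by apply: le_trans h; apply/N_ge0/subspace_sub => //; exact: XV.
Qed.

Lemma form_sub a u v w : energy_form a -> V u -> V v -> V w -> a (u - v) w = a u w - a v w.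
Proof.
by move=> [lin _ _ _] Vu Vv Vw; rewrite addrC -scaleN1r lin // mulN1r addrC.
Qed.

Lemma form_subr a u v w : energy_form a -> V u -> V v -> V w -> a w (u - v) = a w u - a w v.
Proof.
move=> ea Vu Vv Vw; have [_ sym _ _] := ea.
by rewrite sym //; [rewrite form_sub // !(sym _ w)|exact: subspace_sub].
Qed.

Lemma energy_stability a u (F : R) : energy_form a -> V u -> 0 <= F ->
  a u u <= F * N u -> N u <= F / Amin.
Proof.
move=> [_ _ co _] Vu F0 h; have := le_trans (co u Vu) h; have := N_ge0 Vu.
rewrite le_eqVlt => /predU1P[<- _|n0]; first by rewrite divr_ge0 // ltW.
by rewrite expr2 mulrA ler_pM2r // mulrC ler_pdivlMr // mulrC.
Qed.

(** Orthogonality lets the second argument of a(u - uh, u - uh) be replaced by u - v for any v in X;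
    coercivity divides out one norm. *)
Lemma cea a u uh t : energy_form a -> V u -> X uh ->
  (forall v, X v -> a (u - uh) v = 0) -> approximable u t -> N (u - uh) <= Amax * t / Amin.
Proof.
move=> ea Vu Xuh ort ap; have [_ sym co bd] := ea.
have Ve : V (u - uh) by apply: subspace_sub => //; exact: XV.
have t0 := approximable_ge0 Vu ap.
apply: (energy_stability ea Ve); first exact: mulr_ge0.
rewrite -[leRHS]addr0 mulrAC.
apply: (approximable_le Vu _ ap); first by rewrite mulr_ge0 // N_ge0.
move=> v Xv; rewrite addr0.
have -> : a (u - uh) (u - uh) = a (u - uh) (u - v).
  by rewrite (form_subr ea Vu (XV Xuh) Ve) (form_subr ea Vu (XV Xv) Ve) (ort uh) // (ort v).
apply: le_trans (ler_norm _) _; apply: bd => //.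
by apply: subspace_sub => //; exact: XV.
Qed.

(** The Aubin-Nitsche step: since e is orthogonal to X, the dual solution z enters only through its
    distance to X. *)
Lemma dual_bound a z e t : energy_form a -> V z -> V e ->
  (forall v, X v -> a e v = 0) -> approximable z t -> `|a z e| <= Amax * N e * t.
Proof.
move=> ea Vz Ve ort ap; have [_ sym _ bd] := ea; rewrite -[leRHS]addr0.
apply: (approximable_le Vz _ ap); first by rewrite mulr_ge0 // N_ge0.
move=> v Xv; rewrite addr0; have Vv := XV Xv.
have -> : a z e = a (z - v) e by rewrite (form_sub ea) // (sym v) // ort // subr0.
by rewrite mulrAC; apply: bd => //; exact: subspace_sub.
Qed.

Section TwoForms.
Context (a b : E -> E -> R) (ea : energy_form a) (eb : energy_form b).
Context (kappa : R) (kappa0 : 0 <= kappa).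
Hypothesis ab : forall u v, V u -> V v -> `|a u v - b u v| <= kappa * N u * N v.

(** On W the form a maps u - v to (b - a)(v, .), so testing with u - v itself gives the bound. The
    space W may be the full space or a finite element space. *)
Lemma coefficient_perturbation (W : set E) u v (F : R) : W `<=` V ->
  (forall (k : R) x y, W x -> W y -> W (k *: x + y)) -> W u -> W v -> 0 <= F ->
  (forall x, W x -> a u x = b v x) -> b v v <= F * N v ->
  N (u - v) <= kappa * (F / Amin) / Amin.
Proof.
move=> WV Wlin Wu Wv F0 uv hF; have [Vu Vv] := (WV _ Wu, WV _ Wv).
have Wd : W (u - v) by rewrite addrC -scaleN1r; exact: Wlin.
have Vd := WV _ Wd.
apply: (energy_stability ea Vd); first by rewrite mulr_ge0 // divr_ge0 // ltW.
rewrite (form_sub ea Vu Vv Vd) (uv _ Wd) -opprB.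
apply: le_trans (ler_norm _) _; rewrite normrN; apply: le_trans (ab Vv Vd) _.
by rewrite ler_wpM2r ?N_ge0 // ler_wpM2l //; exact: (energy_stability eb).
Qed.

Context (u v uh vh : E) (Vu : V u) (Vv : V v) (Xuh : X uh) (Xvh : X vh).
Hypothesis ort_a : forall x, X x -> a (u - uh) x = 0.
Hypothesis ort_b : forall x, X x -> b (v - vh) x = 0.

Let Vuh : V uh. Proof. exact: XV. Qed.
Let Vvh : V vh. Proof. exact: XV. Qed.
Let eu := u - uh.
Let ev := v - vh.
Let Veu : V eu. Proof. exact: subspace_sub. Qed.
Let Vev : V ev. Proof. exact: subspace_sub. Qed.
Let VE : V (eu - ev). Proof. exact: subspace_sub. Qed.

Let mixed_orthogonality x : X x -> a (eu - ev) x = - (a ev x - b ev x).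
Proof. by move=> Xx; rewrite (form_sub ea) ?ort_a ?ort_b ?subr0 ?sub0r //; exact: XV. Qed.

(** The difference of the two Galerkin errors is not orthogonal to X: a residual of size kappa N(ev)
    remains. A Cea argument with this residual gives a quadratic inequality for the norm n of the
    difference, which is then solved for n. *)
Lemma mixed_energy t : approximable (u - v) t ->
  N (eu - ev) <= 2 * ((Amax + 1) * t + kappa * N ev) / Amin.
Proof.
move=> ap; have t0 := approximable_ge0 (subspace_sub Vu Vv) ap.
set n := N (eu - ev); set m := N ev.
have n0 : 0 <= n by exact: N_ge0.
have m0 : 0 <= m by exact: N_ge0.
have km0 : 0 <= kappa * m by exact: mulr_ge0.
have H : Amin * n ^+ 2 <= (Amax * n + kappa * m) * t + kappa * m * n.
  apply: (approximable_le (subspace_sub Vu Vv) _ ap); first by rewrite addr_ge0 // mulr_ge0.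
  move=> x Xx; have Vx := XV Xx.
  have [_ _ co bd] := ea; apply: le_trans (co _ VE) _.
  (* The discrete part of the error difference when u - v is approximated by x; the residual
     identity applies to it. *)
  pose y := x - (uh - vh).
  have Xy : X y by exact: Xsub Xx (Xsub Xuh Xvh).
  have Vy := XV Xy; have Vd : V (u - v - x) by exact: subspace_sub (subspace_sub Vu Vv) Vx.
  have yE : y = (eu - ev) - (u - v - x).
    rewrite /y /eu /ev [- (v - vh)]opprB [vh - v]addrC [u - uh + (- v + vh)]addrACA [- uh + vh]addrC.
    by rewrite [- (u - v - x)]opprB [x - (u - v)]addrC addrACA subrr add0r addrC opprB.
  have -> : a (eu - ev) (eu - ev) = a (eu - ev) (u - v - x) + a (eu - ev) y.
    by rewrite yE (form_subr ea VE Vd VE) [RHS]addrC subrK.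
  rewrite (mixed_orthogonality Xy).
  have [_ syma _ _] := ea; have [_ symb _ _] := eb.
  have h1 := bd _ _ VE Vd.
  have h2 := ab Vev Vy.
  have h3 : N y <= n + N (u - v - x) by rewrite yE; exact: Nsub.
  have h4 : kappa * m * N y <= kappa * m * (n + N (u - v - x)) by exact: ler_wpM2l.
  rewrite -/n in h1; rewrite -/m in h2.
  apply: le_trans (lerD (ler_norm _) (ler_norm _)) _; rewrite normrN.
  apply: le_trans (lerD h1 h2) _; apply: le_trans (lerD (lexx _) h4) _.
  by rewrite le_eqVlt; apply/orP; left; apply/eqP; ring.
(* p dominates t, kappa m and Amax t + kappa m at once, which is why 1 is added to Amax. The
   inequality becomes Amin n^2 <= p n + p^2. If Amin n > 2 p, then n >= 2 p because Amin <= 1, and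
   the right side is at most 3/2 p n, a contradiction. *)
set p := (Amax + 1) * t + kappa * m.
have p0 : 0 <= p by rewrite addr_ge0 // mulr_ge0 // addr_ge0.
rewrite ler_pdivlMr // mulrC leNgt; apply/negP => hp.
have n1 : 0 < n.
  rewrite lt_neqAle n0 andbT eq_sym; apply: contraTN hp => /eqP ->.
  by rewrite mulr0 -leNgt mulr_ge0.
have An : Amin * n <= n by rewrite ler_piMl // ltW.
have tp : t <= p by rewrite /p mulrDl mul1r; have := mulr_ge0 Amax0 t0; lra.
have kp : kappa * m <= p by rewrite /p lerDr mulr_ge0 // addr_ge0.
have ip : Amax * t + kappa * m <= p by rewrite /p mulrDl mul1r; lra.
have h5 : kappa * m * t <= p * p by exact: ler_pM.
have h6 : (Amax * t + kappa * m) * n <= p * n by rewrite ler_wpM2r.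
have h7 : 2 * p * n < Amin * n ^+ 2 by rewrite expr2 mulrA ltr_pM2r.
have h8 : p * (2 * p) <= p * n by rewrite ler_wpM2l //; apply/ltW/(lt_le_trans hp).
have h9 : Amin * n ^+ 2 <= p * n + p * p.
  apply: le_trans H _; rewrite [leLHS](_ : _ = (Amax * t + kappa * m) * n + kappa * m * t); last by ring.
  exact: lerD.
have h10 := mulr_ge0 p0 n0.
nra.
Qed.

(* Galerkin orthogonality with respect to two different forms leaves the consistency term (a - b)(z, ev),
   which is again treated by duality: [zeta] is the b-solution with right-hand side (a - b)(z, .). *)
Lemma mixed_functional z zeta tz tzeta : V z -> V zeta ->
  (forall x, V x -> b zeta x = a z x - b z x) -> approximable z tz -> approximable zeta tzeta ->
  `|a z eu - a z ev| <= (Amax * N (eu - ev) + kappa * N ev) * tz + Amax * N ev * tzeta.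
Proof.
move=> Vz Vzeta hz apz apzeta; have [_ syma _ bda] := ea; have [_ symb _ bdb] := eb.
rewrite -(form_subr ea Veu Vev Vz).
apply: (approximable_le Vz _ apz); first by rewrite addr_ge0 // mulr_ge0 ?N_ge0.
move=> x Xx; have Vx := XV Xx; have Vzx : V (z - x) by exact: subspace_sub.
have -> : a z (eu - ev) = a (z - x) (eu - ev) + (a (z - x) ev - b (z - x) ev) - b zeta ev.
  rewrite hz // (form_sub ea Vz Vx VE) (syma x) // mixed_orthogonality //.
  by rewrite (form_sub ea) // (form_sub eb) // (syma x) // (symb x) //; ring.
apply: le_trans (ler_normB _ _) _; apply: lerD.
  apply: le_trans (ler_normD _ _) _; rewrite mulrDl; apply: lerD.
    by rewrite mulrAC; exact: bda.
  by rewrite mulrAC; exact: ab.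
exact: (dual_bound eb).
Qed.

End TwoForms.
End Galerkin.

(** * Galerkin estimates under H^2-regularity *)

Section RegularProblems.
Context (R : realType) (d : nat).
Local Notation pt := 'rV[R]_d.
Context (mu : {measure set pt -> \bar R}) (hmu : is_lebesgue mu).
Context (D : set pt) (oD : open D) (bD : exists2 N : R, 0 < N & D `<=` obox (const_mx (- N)) (const_mx N)).
Context (Amin Amax Cr Ca : R) (Amin0 : 0 < Amin) (Amin1 : Amin <= 1) (Amax0 : 0 <= Amax)
  (Cr0 : 0 <= Cr) (Ca0 : 0 <= Ca).
Implicit Types (f g c u v w z : pt -> R) (X : set (pt -> R)) (h k : R).
Let mD : measurable D := open_measurable_rV oD.
Let Doo : (mu D < +oo)%E := bounded_domain_mu_fin hmu oD bD.
Local Notation L2 := (in_L2 mu D).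
Local Notation H10 := (in_H10 mu D).
Local Notation N := (H1norm mu D).
Local Notation nL2 := (L2norm mu D).

Local Opaque in_H10 in_H2 in_L2 H1norm H2norm L2norm bform.

Definition regular_coef c : Prop :=
  [/\ exists2 k, 0 <= k & W1le mu D c k,
      forall v, H10 v -> Amin * N v ^+ 2 <= bform mu D c v v,
      forall u v, H10 u -> H10 v -> `|bform mu D c u v| <= Amax * N u * N v &
      forall f, L2 f -> exists u, [/\ solves mu D c f H10 u, in_H2 mu D u &
        H2norm mu D u <= Cr * nL2 f]].

Definition fe_approx X h : Prop :=
  [/\ X `<=` H10, X 0, forall k u v, X u -> X v -> X (k *: u + v) &
      forall w, in_H2 mu D w -> H10 w ->
        inf [set N (w \- v) | v in X] <= Ca * h * H2norm mu D w].

Lemma energy_form_bform c : regular_coef c ->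
  energy_form H10 N Amin Amax (bform mu D c).
Proof.
move=> [[k k0 [mc ck _]] co bd _]; split; [| |exact: co|exact: bd].
  by move=> a u v w /H10_H1 Hu /H10_H1 Hv /H10_H1 Hw; exact: (bform_linearl oD k0 mc ck).
by move=> u v _ _; exact: bform_sym.
Qed.

Let H10lin k u v : H10 u -> H10 v -> H10 (k *: u + v) := @H10_linear R d mu hmu D oD Doo k u v.
Let Nge0 u : H10 u -> 0 <= N u. Proof. by move=> _; exact: H1norm_ge0. Qed.
Let Ntri k u v : H10 u -> H10 v -> N (k *: u + v) <= `|k| * N u + N v.
Proof. by move=> /H10_H1 Hu /H10_H1 Hv; exact: (H1_triangle oD). Qed.

Let Hsub u v : H10 u -> H10 v -> H10 (u - v) := @subspace_sub R _ H10 H10lin u v.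

Lemma approximable_H2 X h w : fe_approx X h -> in_H2 mu D w -> H10 w ->
  approximable X N w (Ca * h * H2norm mu D w).
Proof.
move=> [XH X0 _ ap] H2w H10w e e0.
have hi : has_inf [set N (w \- v) | v in X].
  by split; [exists (N (w \- 0)), 0|exists 0 => _ [v _ <-]; exact: H1norm_ge0].
have [_ [v Xv <-] hv] := inf_adherent e0 hi; exists v; [exact: Xv|].
by apply/ltW/(lt_le_trans hv); rewrite lerD2r; exact: ap.
Qed.

(** A given solution and the regular one supplied by the hypothesis agree only up to norm 0.
    Approximability, unlike membership in H^2, passes from one to the other by the triangle
    inequality alone. *)
Lemma approximable_N0 X u u' t : H10 u -> H10 u' -> X `<=` H10 ->
  N (u' - u) = 0 -> approximable X N u t -> approximable X N u' t.
Proof.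
move=> Hu Hu' XH uu' ap e e0; have [v Xv hv] := ap e e0; exists v; [exact: Xv|].
have Hv := XH _ Xv; rewrite (_ : u' - v = 1 *: (u' - u) + (u - v)); last by rewrite scale1r addrA subrK.
apply: (le_trans (Ntri 1 (Hsub Hu' Hu) (Hsub Hu Hv))).
by rewrite uu' mulr0 add0r.
Qed.

Lemma solves_energy c f V u : V `<=` H10 -> L2 f -> solves mu D c f V u ->
  bform mu D c u u <= nL2 f * N u.
Proof.
move=> VH Lf [Vu su]; rewrite su //.
have Lu := H1_L2 (H10_H1 (VH _ Vu)).
apply: le_trans (ler_norm _) _; apply: le_trans (L2_CS mD Lf Lu) _.
by rewrite ler_wpM2l ?L2norm_ge0 ?L2norm_le_H1norm.
Qed.

Lemma solves_functional_bound c f g V u : V `<=` H10 -> regular_coef c -> L2 f -> L2 g ->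
  solves mu D c f V u -> `|L2dot mu D g u| <= nL2 f * nL2 g / Amin.
Proof.
move=> VH rc Lf Lg su; have [Vu _] := su; have Hu := VH _ Vu.
apply: le_trans (L2_CS mD Lg (H1_L2 (H10_H1 Hu))) _.
rewrite mulrAC mulrC ler_wpM2r ?L2norm_ge0 //.
apply: le_trans (L2norm_le_H1norm _ _ _) _.
apply: (energy_stability Amin0 Nge0 (energy_form_bform rc) Hu (L2norm_ge0 _ _ _)).
exact: solves_energy su.
Qed.

Section Estimates.
Context (X : set (pt -> R)) (h : R) (fX : fe_approx X h) (h0 : 0 <= h).
Context (f g : pt -> R) (Lf : L2 f) (Lg : L2 g).
Let XH : X `<=` H10. Proof. by case: fX. Qed.
Let Xlin k u v : X u -> X v -> X (k *: u + v). Proof. by case: fX => _ _ h1 _; exact: h1. Qed.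
Let G v := L2dot mu D g v.
Let nf0 : 0 <= nL2 f := L2norm_ge0 _ _ _.
Let ng0 : 0 <= nL2 g := L2norm_ge0 _ _ _.

Let solves_sub c u uh v : regular_coef c -> solves mu D c f H10 u -> solves mu D c f X uh ->
  X v -> bform mu D c (u - uh) v = 0.
Proof.
move=> rc [Hu su] [Xuh suh] Xv.
have ec := energy_form_bform rc.
by rewrite (form_sub ec Hu (XH Xuh) (XH Xv)) (su _ (XH Xv)) (suh _ Xv) subrr.
Qed.

Let dual_solution c : regular_coef c -> exists z, [/\ H10 z, in_H2 mu D z,
  forall v, H10 v -> bform mu D c z v = G v & H2norm mu D z <= Cr * nL2 g].
Proof. by move=> [_ _ _ /(_ _ Lg)] [z [[Hz sz] H2z nz]]; exists z. Qed.

Let solves_H2 c u : regular_coef c -> solves mu D c f H10 u ->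
  exists u', [/\ H10 u', in_H2 mu D u', solves mu D c f H10 u', N (u - u') = 0 & H2norm mu D u' <= Cr * nL2 f].
Proof.
move=> rc su; have [_ _ _ /(_ _ Lf)] := rc => -[u' [su' H2u' nu']].
have [Hu eu] := su; have [Hu' eu'] := su'; exists u'; split=> //.
have ec := energy_form_bform rc; have Hd := Hsub Hu Hu'.
apply/le_anti; rewrite H1norm_ge0 andbT.
have := energy_stability Amin0 Nge0 ec Hd (lexx 0); rewrite !mul0r; apply.
by rewrite (form_sub ec Hu Hu' Hd) (eu _ Hd) (eu' _ Hd) subrr.
Qed.

Let hC k w : 0 <= k -> H2norm mu D w <= k -> Ca * h * H2norm mu D w <= Ca * h * k.
Proof. by move=> k0 wk; rewrite ler_wpM2l // mulr_ge0. Qed.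

Let approximable_mono u t t' : t <= t' -> approximable X N u t -> approximable X N u t'.
Proof.
by move=> tt' ap e e0; have [v Xv hv] := ap e e0; exists v; [exact: Xv|]; apply: le_trans hv _; rewrite lerD2r.
Qed.

Let approximable_solution c u : regular_coef c -> solves mu D c f H10 u ->
  approximable X N u (Ca * h * (Cr * nL2 f)).
Proof.
move=> rc su; have [u' [Hu' H2u' _ uu' nu']] := solves_H2 rc su.
apply: (approximable_N0 Hu' (proj1 su) XH uu').
by apply: approximable_mono (approximable_H2 fX H2u' Hu'); apply: hC => //; exact: mulr_ge0.
Qed.

Let discretization_energy c u uh : regular_coef c -> solves mu D c f H10 u -> solves mu D c f X uh ->
  N (u - uh) <= Amax * (Ca * h * (Cr * nL2 f)) / Amin.
Proof.
move=> rc su suh.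
apply: (cea Amin0 Amax0 H10lin XH Nge0 (energy_form_bform rc) (proj1 su) (proj1 suh)).
  by move=> v; exact: solves_sub su suh.
exact: approximable_solution su.
Qed.

(** Duality for one coefficient: the energy error supplies one power of h and the approximation of
    the dual solution the other. *)
Lemma discretization_error c u uh : regular_coef c -> solves mu D c f H10 u -> solves mu D c f X uh ->
  `|G u - G uh| <= Amax ^+ 2 * Ca ^+ 2 * Cr ^+ 2 / Amin * h ^+ 2 * (nL2 f * nL2 g).
Proof.
move=> rc su suh; have ec := energy_form_bform rc.
have [z [Hz H2z dz nz]] := dual_solution rc.
have Hu := proj1 su; have Huh := XH (proj1 suh).
have He := Hsub Hu Huh.
rewrite -(dz _ Hu) -(dz _ Huh) -(form_subr H10lin ec Hu Huh Hz).
apply: le_trans (dual_bound Amax0 H10lin XH Nge0 ec Hz He _ (approximable_H2 fX H2z Hz)) _.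
  by move=> v; exact: solves_sub su suh.
have e1 := discretization_energy rc su suh.
have e2 := hC (mulr_ge0 Cr0 ng0) nz.
apply: (@le_trans _ _ (Amax * (Amax * (Ca * h * (Cr * nL2 f)) / Amin) * (Ca * h * (Cr * nL2 g)))).
  apply: ler_pM => //; first by rewrite mulr_ge0 ?H1norm_ge0.
    by rewrite mulr_ge0 ?H2norm_ge0 // mulr_ge0.
  by rewrite ler_wpM2l.
by rewrite le_eqVlt; apply/orP; left; apply/eqP; ring.
Qed.

Section TwoCoefficients.
Context (c c' : pt -> R) (rc : regular_coef c) (rc' : regular_coef c').
Context (k : R) (k0 : 0 <= k) (cc' : W1le mu D (c \- c') k).

Let bform_diff u v : H10 u -> H10 v -> bform mu D c u v - bform mu D c' u v = bform mu D (c \- c') u v.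
Proof.
move=> /H10_H1 Hu /H10_H1 Hv; have [[m m0 [mc cm _]] _ _ _] := rc; have [[m' m'0 [mc' cm' _]] _ _ _] := rc'.
by rewrite (bform_coef_sub oD m0 m'0 mc mc' cm cm' Hu Hv).
Qed.

Let bform_diff_le u v : H10 u -> H10 v -> `|bform mu D c u v - bform mu D c' u v| <= k * N u * N v.
Proof.
move=> Hu Hv; rewrite (bform_diff Hu Hv); have [mc ck _] := cc'.
exact: (bform_bounded oD k0 mc ck (H10_H1 Hu) (H10_H1 Hv)).
Qed.

(** Stated for any subspace V: with V = [H10] it compares exact solutions of successive truncations,
    with a finite element space it gives the Lipschitz dependence of discrete solutions on the
    parameter. *)
Lemma coefficient_error V u v : V `<=` H10 -> (forall a x y, V x -> V y -> V (a *: x + y)) ->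
  solves mu D c f V u -> solves mu D c' f V v ->
  `|G u - G v| <= Amin ^- 2 * k * (nL2 f * nL2 g).
Proof.
move=> VH Vlin su sv; have ec := energy_form_bform rc; have ec' := energy_form_bform rc'.
have uv x : V x -> bform mu D c u x = bform mu D c' v x.
  by move=> Hx; rewrite (proj2 su _ Hx) (proj2 sv _ Hx).
have := coefficient_perturbation Amin0 Nge0 ec ec' k0 bform_diff_le VH Vlin (proj1 su) (proj1 sv)
  nf0 uv (solves_energy VH Lf sv).
have [Hu Hv] := (VH _ (proj1 su), VH _ (proj1 sv)).
have Hd := Hsub Hu Hv.
have -> : G u - G v = G (u - v).
  rewrite (_ : u - v = -1 *: v + u); last by rewrite scaleN1r addrC.
  rewrite /G (L2dot_linearr mD (-1) (H1_L2 (H10_H1 Hv)) (H1_L2 (H10_H1 Hu)) Lg).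
  by rewrite mulN1r addrC.
move=> h1; apply: (le_trans (L2_CS mD Lg (H1_L2 (H10_H1 Hd)))).
apply: (@le_trans _ _ (nL2 g * (k * (nL2 f / Amin) / Amin))).
  by rewrite ler_wpM2l //; apply: le_trans (L2norm_le_H1norm _ _ _) h1.
by rewrite le_eqVlt; apply/orP; left; apply/eqP; rewrite expr2 invfM; ring.
Qed.

Context (u v : pt -> R) (su : solves mu D c f H10 u) (sv : solves mu D c' f H10 v).
Let Hu : H10 u := proj1 su.
Let Hv : H10 v := proj1 sv.

Context (uh vh : pt -> R) (suh : solves mu D c f X uh) (svh : solves mu D c' f X vh).

Let Cd := 2 * d%:R : R.
Let Cd0 : 0 <= Cd. Proof. by rewrite mulr_ge0. Qed.

(* the difference of two solutions is itself the solution for an L2 right-hand side of size O(k) *)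
Let approximable_difference : approximable X N (u - v) (Ca * h * (Cr * (Cd * k * (Cr * nL2 f)))).
Proof.
have ec := energy_form_bform rc.
have [v' [Hv' H2v' sv' vv' nv']] := solves_H2 rc' sv.
have c'c : W1le mu D (c' \- c) k.
  have := W1le_linear oD (-1) cc' (_ : W1le mu D 0 0).
  rewrite normrN1 mul1r !addr0 (_ : -1 *: (c \- c') = c' \- c); last first.
    by apply/funext => x; rewrite fctE scaleN1r /= opprB.
  apply; split; first exact: measurable_cst.
    by apply/aeW => x _; rewrite normr0.
  move=> i; exists 0; last by apply/aeW => x _; rewrite normr0.
  have L0 : in_L1loc mu D 0 by apply: (L2_L1loc mD Doo); exact: L2_0.
  split=> // phi tphi; rewrite -[LHS]/(L2dot mu D 0 _) -[X in _ = - X]/(L2dot mu D 0 _).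
  rewrite (L2dot0l mu oD (pderiv [:: i] phi)) (L2dot0l mu oD phi); apply/esym; exact: oppr0.
(* The c-form sends u - v to the form of c' - c at v, so u - v has right-hand side - div((c' - c)
   grad v). The regular representative v' stands in for v here. *)
have [F [LF nF dF]] := W1le_divergence hmu oD bD k0 c'c H2v'.
have [_ _ _ /(_ _ LF)] := rc => -[w [[Hw sw] H2w nw]].
have Huv := Hsub Hu Hv.
apply: (approximable_N0 Hw Huv XH).
  have Hd := Hsub Huv Hw.
  apply/le_anti; rewrite H1norm_ge0 andbT.
  have := energy_stability Amin0 Nge0 ec Hd (lexx 0); rewrite !mul0r; apply.
  set y := u - v - w.
  have Hy : H10 y by exact: Hd.
  rewrite {1}/y (form_sub ec Huv Hw Hy) (form_sub ec Hu Hv Hy) (sw _ Hy) -(dF _ Hy).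
  have <- : bform mu D c' v' y - bform mu D c v' y = bform mu D (c' \- c) v' y.
    have [[m m0 [mc cm _]] _ _ _] := rc; have [[m' m'0 [mc' cm' _]] _ _ _] := rc'.
    by rewrite (bform_coef_sub oD m'0 m0 mc' mc cm' cm (H10_H1 Hv') (H10_H1 Hy)).
  have -> : bform mu D c v y = bform mu D c v' y.
    have [[m m0 [mc cm _]] _ _ _] := rc.
    have Hvv' := Hsub Hv Hv'; apply/eqP; rewrite -subr_eq0 -(form_sub ec Hv Hv' Hy) -normr_eq0.
    apply/eqP/le_anti; rewrite normr_ge0 andbT.
    have [_ _ bd _] := rc; apply: (le_trans (bd _ _ Hvv' Hy)).
    by rewrite vv' mulr0 mul0r.
  by rewrite (proj2 su _ Hy) (proj2 sv' _ Hy) opprB addrA subrK subrr.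
apply: approximable_mono (approximable_H2 fX H2w Hw); apply: hC.
  by rewrite !mulr_ge0.
apply: le_trans nw _; rewrite ler_wpM2l //; apply: le_trans nF _.
by rewrite ler_wpM2l // mulr_ge0.
Qed.

(** q bounds the energy error in units of h ||f||, and p bounds the difference of the two energy
    errors in units of k h ||f||. The factors Ca Cr and Ca Cr Cd Cr come from approximating the dual
    solution z and the second dual solution. *)
Definition mixed_constant : R :=
  let q := Amax * Ca * Cr / Amin in
  let p := 2 * ((Amax + 1) * (Ca * Cr * Cd * Cr) + q) / Amin in
  (Amax * p + q) * (Ca * Cr) + Amax * q * (Ca * Cr * Cd * Cr).

Lemma mixed_error : `|(G u - G uh) - (G v - G vh)| <= mixed_constant * k * h ^+ 2 * (nL2 f * nL2 g).
Proof.
have ec := energy_form_bform rc; have ec' := energy_form_bform rc'.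
have [z [Hz H2z dz nz]] := dual_solution rc.
have Huh := XH (proj1 suh); have Hvh := XH (proj1 svh).
have Heu := Hsub Hu Huh.
have Hev := Hsub Hv Hvh.
have [F [LF nF dF]] := W1le_divergence hmu oD bD k0 cc' H2z.
have [_ _ _ /(_ _ LF)] := rc' => -[zeta [[Hzeta szeta] H2zeta nzeta]].
have hz x : H10 x -> bform mu D c' zeta x = bform mu D c z x - bform mu D c' z x.
  by move=> Hx; rewrite (szeta _ Hx) -(dF _ Hx) (bform_diff Hz Hx).
have oa x : X x -> bform mu D c (u - uh) x = 0 by exact: solves_sub su suh.
have ob x : X x -> bform mu D c' (v - vh) x = 0 by exact: solves_sub sv svh.
have apz : approximable X N z (Ca * h * (Cr * nL2 g)).
  by apply: approximable_mono (approximable_H2 fX H2z Hz); apply: hC => //; exact: mulr_ge0.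
have apzeta : approximable X N zeta (Ca * h * (Cr * (Cd * k * (Cr * nL2 g)))).
  apply: approximable_mono (approximable_H2 fX H2zeta Hzeta); apply: hC; first by rewrite !mulr_ge0.
  apply: le_trans nzeta _; rewrite ler_wpM2l //; apply: le_trans nF _.
  by rewrite ler_wpM2l // mulr_ge0.
have nE := mixed_energy Amin0 Amin1 Amax0 H10lin Xlin XH Nge0 Ntri ec ec' k0 bform_diff_le Hu Hv
  (proj1 suh) (proj1 svh) oa ob approximable_difference.
have main := mixed_functional Amax0 H10lin XH Nge0 ec ec' k0 bform_diff_le Hu Hv
  (proj1 suh) (proj1 svh) oa ob Hz Hzeta hz apz apzeta.
have nev := discretization_energy rc' sv svh.
have -> : (G u - G uh) - (G v - G vh) = bform mu D c z (u - uh) - bform mu D c z (v - vh).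
  by rewrite (form_subr H10lin ec Hu Huh Hz) (form_subr H10lin ec Hv Hvh Hz) !dz.
apply: le_trans main _.
set e := N (v - vh) in nE nev *; set n := N _ in nE *.
have e0 : 0 <= e by exact: H1norm_ge0.
pose q := Amax * Ca * Cr / Amin.
pose p := 2 * ((Amax + 1) * (Ca * Cr * Cd * Cr) + q) / Amin.
have {}nev : e <= q * h * nL2 f.
  by apply: le_trans nev _; rewrite le_eqVlt; apply/orP; left; apply/eqP; rewrite /q; ring.
have ke : k * e <= k * (q * h * nL2 f) by rewrite ler_wpM2l.
have {}nE : n <= p * (k * h * nL2 f).
  apply: le_trans nE _.
  apply: (@le_trans _ _ (2 * ((Amax + 1) * (Ca * h * (Cr * (Cd * k * (Cr * nL2 f)))) + k * (q * h * nL2 f)) / Amin)).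
    by rewrite ler_pM2r ?invr_gt0 // ler_wpM2l // lerD2l.
  by rewrite le_eqVlt; apply/orP; left; apply/eqP; rewrite /p; ring.
apply: (@le_trans _ _ ((Amax * (p * (k * h * nL2 f)) + k * (q * h * nL2 f)) * (Ca * h * (Cr * nL2 g)) +
  Amax * (q * h * nL2 f) * (Ca * h * (Cr * (Cd * k * (Cr * nL2 g)))))).
  apply: lerD.
    apply: ler_wpM2r; first by rewrite !mulr_ge0.
    by apply: lerD => //; rewrite ler_wpM2l.
  by apply: ler_wpM2r; [rewrite !mulr_ge0|rewrite ler_wpM2l].
rewrite /mixed_constant -/q -/p.
by rewrite le_eqVlt; apply/orP; left; apply/eqP; ring.
Qed.

End TwoCoefficients.
End Estimates.
End RegularProblems.

(** * Double differences *)

Section DoubleDifferences.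
Context (R : realType).
Implicit Types (F : nat -> nat -> R).

Lemma sum_triangle F (n : nat) :
  \sum_(l < n.+1) \sum_(v < n.+1 | (l + v <= n)%N) F l v = \sum_(v < n.+1) \sum_(l < (n - v).+1) F l v.
Proof.
rewrite (exchange_big_dep predT) //=; apply: eq_bigr => v _.
have hv : ((n - v).+1 <= n.+1)%N by rewrite ltnS leq_subr.
rewrite (big_ord_widen _ (F ^~ v) hv); apply: eq_bigl => l.
by rewrite ltnS leq_subRL 1?addnC // -ltnS.
Qed.

Lemma sum_backward_diff (x : nat -> R) n : \sum_(l < n.+1) backward_diff x l = x n.
Proof.
elim: n => [|n IH]; first by rewrite big_ord_recl big_ord0 addr0 /backward_diff subr0.
by rewrite big_ord_recr /= IH /backward_diff addrC subrK.
Qed.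

(** For fixed v the sum over l up to n - v telescopes, and only the finest mesh level n - v
    survives. *)
Lemma double_diff_sum (U : nat -> nat -> R) (n : nat) :
  \sum_(l < n.+1) \sum_(v < n.+1 | (l + v <= n)%N) double_diff U l v =
  \sum_(v < n.+1) backward_diff (fun v' => U v' (n - v)%N) v.
Proof.
rewrite sum_triangle; apply: eq_bigr => v _.
rewrite /double_diff; case: (v : nat) => [|k]; rewrite /backward_diff -/(backward_diff _ _).
  under eq_bigr do rewrite -/(backward_diff (U 0%N) _) subr0.
  by rewrite sum_backward_diff subr0.
under eq_bigr do rewrite -/(backward_diff (U k) _) -/(backward_diff (U k.+1) _).
by rewrite sumrB !sum_backward_diff.
Qed.

Section Bounds.
Context (U : nat -> nat -> R) (V : nat -> R) (Voo K : R) (K0 : 0 <= K).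
(** V v stands for the functional of the exact solution with the v-th coefficient and U v l for that
    of its discretization. The estimates are known for e, in terms of which double differences are
    rewritten. *)
Let e v l := V v - U v l.
Hypotheses (V_bound : forall v, `|V v| <= K)
  (V_diff : forall v, `|V v.+1 - V v| <= K * 4 ^- v)
  (e_bound : forall v l, `|e v l| <= K * 4 ^- l)
  (e_diff : forall v l, `|e v.+1 l - e v l| <= K * 4 ^- (v + l))
  (V_limit : forall v, `|Voo - V v| <= K * 4 ^- v).

Let q (n : nat) : R := 4 ^- n.
Let q0 n : 0 <= q n. Proof. by rewrite invr_ge0 exprn_ge0. Qed.
Let qS n : q n = 4 * q n.+1.
Proof. by rewrite /q exprS invfM mulrA divff ?mul1r. Qed.
Let q1 : q 0 = 1. Proof. by rewrite /q expr0 invr1. Qed.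

(** Index 0 needs separate cases because the term with index -1 is 0: there the exact values V enter
    and not just e. The worst case has both indices positive and costs 16 + 4 = 20, which 32
    covers. *)
Lemma double_diff_bound l v : `|double_diff U l v| <= 32 * K * 4 ^- (l + v).
Proof.
rewrite -/(q _).
have UE v' l' : U v' l' = V v' - e v' l' by rewrite /e subKr.
case: v => [|v].
  rewrite addn0 /double_diff {1}/backward_diff subr0 /backward_diff.
  case: l => [|l].
    rewrite subr0 q1 UE; apply: le_trans (ler_normB _ _) _.
    by have := lerD (V_bound 0) (e_bound 0 0); rewrite -/(q 0) q1 !mulr1; move: (_ + _) => x; move: K0; lra.
  rewrite [X in `|X|](_ : _ = e 0 l - e 0 l.+1); last by rewrite /e; ring.
  apply: le_trans (ler_normB _ _) _.
  have := e_bound 0 l; have := e_bound 0 l.+1; rewrite -/(q l) -/(q l.+1) (qS l).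
  have := mulr_ge0 K0 (q0 l.+1); move: (q l.+1) => x; nra.
rewrite /double_diff {1}/backward_diff /backward_diff.
case: l => [|l].
  rewrite !subr0 add0n [X in `|X|](_ : _ = (V v.+1 - V v) - (e v.+1 0 - e v 0)); last by rewrite /e; ring.
  apply: le_trans (ler_normB _ _) _.
  have := V_diff v; have := e_diff v 0; rewrite addn0 -/(q v) (qS v).
  have := mulr_ge0 K0 (q0 v.+1); move: (q v.+1) => x; nra.
rewrite [X in `|X|](_ : _ = (e v.+1 l - e v l) - (e v.+1 l.+1 - e v l.+1)); last by rewrite /e; ring.
apply: le_trans (ler_normB _ _) _.
have := e_diff v l; have := e_diff v l.+1; rewrite -/(q (v + l.+1)) -/(q (v + l)) addSn !addnS.
rewrite (addnC l v) (qS (v + l)) (qS (v + l).+1).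
by have := mulr_ge0 K0 (q0 (v + l).+2); move: (q (v + l).+2) => x; nra.
Qed.

Lemma sparse_grid_bias n :
  `|Voo - \sum_(l < n.+1) \sum_(v < n.+1 | (l + v <= n)%N) double_diff U l v|
  <= 6 * K * n.+1%:R * 4 ^- n.
Proof.
rewrite double_diff_sum.
have -> : Voo - \sum_(v < n.+1) backward_diff (fun v' => U v' (n - v)%N) v =
   (Voo - V n) + \sum_(v < n.+1) backward_diff (fun v' => e v' (n - v)%N) v.
  rewrite -[in RHS](sum_backward_diff V n) -addrA; congr (_ + _).
  rewrite -sumrN -sumrN -big_split /=; apply: eq_bigr => v _.
  by rewrite /backward_diff /e; case: (v : nat) => [|k]; ring.
apply: le_trans (ler_normD _ _) _.
(* For positive v, [e_diff] is used with indices of sum n - 1, whence the factor 4. *)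
have h v : (v <= n)%N -> `|backward_diff (fun v' => e v' (n - v)%N) v| <= 4 * K * q n.
  case: v => [_|v vn]; rewrite /backward_diff ?subr0 ?subn0.
    by have := e_bound 0 n; rewrite -/(q n); have := mulr_ge0 K0 (q0 n); nra.
  apply: le_trans (e_diff _ _) _; rewrite subnS -/(q _).
  have -> : (v + (n - v).-1)%N = n.-1 by lia.
  by rewrite -{2}(ltn_predK vn) [q n.-1]qS mulrCA mulrA.
have hS : `|\sum_(v < n.+1) backward_diff (fun v' => e v' (n - v)%N) v| <= n.+1%:R * (4 * K * q n).
  apply: le_trans (ler_norm_sum _ _ _) _.
  apply: (@le_trans _ _ (\sum_(v < n.+1) (4 * K * q n))).
    by apply: ler_sum => v _; apply: h; rewrite -ltnS.
  by rewrite sumr_const card_ord -[leLHS]mulr_natl.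
have := V_limit n; rewrite -/(q n) => h1.
apply: le_trans (lerD h1 hS) _; have := mulr_ge0 K0 (q0 n).
have : 1 <= n.+1%:R :> R by rewrite ler1n.
move: (n.+1%:R : R) => t; move: (q n) => x; nra.
Qed.

End Bounds.
End DoubleDifferences.

(** * Karhunen-Loeve coefficients *)

Section SampleSizes.
Context (R : realType).
Implicit Types (x r : R).

Lemma natr_ceil x : 0 <= x -> x <= `|Num.ceil x|%N%:R :> R /\ `|Num.ceil x|%N%:R <= x + 1.
Proof.
move=> x0; have c0 : 0 <= Num.ceil x by rewrite ceil_ge0 (lt_le_trans _ x0) ?oppr_lt0.
rewrite natr_absz ger0_norm // ceil_ge; split=> //.
by have := ceilB1_lt x; rewrite intrB; lra.
Qed.

Lemma m_E j : m_ R j = (4 * j)%N.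
Proof.
by rewrite /m_ -natrM (_ : (4 * j)%:R = (Posz (4 * j))%:~R) ?intrKceil.
Qed.

(** The power is at least 1 when r > 1, so rounding up at most doubles it. *)
Lemma s_bounds r nu : 2 `^ (2 * nu%:R / (r - 1)) <= (s_ r nu)%:R /\
  (1 < r -> (s_ r nu)%:R <= 2 * 2 `^ (2 * nu%:R / (r - 1))).
Proof.
have [h1 h2] := @natr_ceil (2 `^ (2 * nu%:R / (r - 1))) (powR_ge0 _ _).
split=> // r1; apply: le_trans h2 _.
have : 1 <= 2 `^ (2 * nu%:R / (r - 1)); last by move: (2 `^ _) => x; lra.
by rewrite -[leLHS](powRr0 2) ler_powR ?ler1n // divr_ge0 ?subr_ge0 ?(ltW r1) // mulr_ge0.
Qed.

Lemma s_gt0 r nu : (0 < s_ r nu)%N.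
Proof.
have [h _] := s_bounds r nu; rewrite -(ltr_nat R); apply: lt_le_trans h.
by rewrite powR_gt0.
Qed.

Lemma s_mono r nu : 1 < r -> (s_ r nu <= s_ r nu.+1)%N.
Proof.
move=> r1; have r0 : 0 < r - 1 by rewrite subr_gt0.
rewrite /s_ -lez_nat !gez0_abs ?ceil_ge0 ?(lt_le_trans _ (powR_ge0 _ _)) ?oppr_lt0 //.
by rewrite le_ceil // ler_powR ?ler1n // ler_pM2r ?invr_gt0 // ler_pM2l // ler_nat.
Qed.

(** The origin of the exponent in [s_]: the series tail is of order s^(1-r), and this choice of s
    makes it of the order of two mesh powers. *)
Lemma s_powR_le r nu : 1 < r -> (s_ r nu)%:R `^ (1 - r) <= 4 ^- nu.
Proof.
move=> r1; have [h _] := s_bounds r nu.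
have r0 : 0 < r - 1 by rewrite subr_gt0.
rewrite -opprB powRN lef_pV2 ?posrE ?exprn_gt0 ?powR_gt0 ?ltr0n ?s_gt0 //.
have -> : 4 ^+ nu = (2 `^ (2 * nu%:R / (r - 1))) `^ (r - 1) :> R.
  rewrite -powRrM divfK ?gt_eqF // (_ : 2 * nu%:R = (2 * nu)%:R); last by rewrite natrM.
  by rewrite powR_mulrn // exprM; congr (_ ^+ nu); rewrite expr2 -natrM.
by apply: ge0_ler_powR => //; rewrite ?nnegrE ?powR_ge0 // ltW.
Qed.

(* from t = e^(ln t) >= 1 + ln t and ln (j / (j+1)) <= -1 / (j+1) *)
Lemma powRN_le_telescope r j : 1 < r -> (0 < j)%N ->
  j.+1%:R `^ (- r) <= (j%:R `^ (1 - r) - j.+1%:R `^ (1 - r)) / (r - 1).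
Proof.
move=> r1 j0; have r0 : 0 < r - 1 by rewrite subr_gt0.
have j0' : 0 < j%:R :> R by rewrite ltr0n.
rewrite ler_pdivlMr //.
pose t : R := j%:R / j.+1%:R.
have t0 : 0 < t by rewrite divr_gt0.
have jE : j%:R = j.+1%:R * t by rewrite mulrC divfK // pnatr_eq0.
have -> : j%:R `^ (1 - r) = j.+1%:R `^ (1 - r) * t `^ (1 - r) by rewrite jE powRM // ltW.
have -> : j.+1%:R `^ (- r) = j.+1%:R `^ (1 - r) * j.+1%:R^-1.
  rewrite -[X in _ * X]powR_inv1 // -powRD; first by congr (_ `^ _); ring.
  by rewrite pnatr_eq0 implybT.
rewrite -{3}[j.+1%:R `^ (1 - r)]mulr1 -mulrBr -mulrA ler_wpM2l ?powR_ge0 //.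
have lt : ln t <= - (j.+1%:R^-1).
  have -> : t = 1 + (- j.+1%:R^-1).
    by apply: (mulIf (_ : j.+1%:R != 0 :> R)); rewrite ?pnatr_eq0 // /t mulrDl mulNr !mulVf ?pnatr_eq0 // divfK ?pnatr_eq0 // mul1r -natr1 addrK.
  by apply: le_ln1Dx; rewrite ltrN2 invf_lt1 // ltr1n.
rewrite /powR gt_eqF //.
apply: le_trans (_ : (1 - r) * ln t <= _); last first.
  by have := expR_ge1Dx ((1 - r) * ln t); lra.
rewrite (_ : (1 - r) * ln t = (- ln t) * (r - 1)); last by ring.
by rewrite ler_wpM2r ?(ltW r0) // lerNr.
Qed.

(** Bound for the sum of (j+1)^(-r) over j >= s. For s = 0 the comparison with an integral breaks
    down, so the first term 1 is split off. *)
Definition KL_tail r (s : nat) : R :=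
  if s is 0%N then 1 + (r - 1)^-1 else s%:R `^ (1 - r) / (r - 1).

Lemma KL_tail_ge0 r s : 1 < r -> 0 <= KL_tail r s.
Proof.
move=> r1; have r0 : 0 <= r - 1 by rewrite subr_ge0 ltW.
by case: s => [|s]; rewrite /KL_tail ?addr_ge0 ?invr_ge0 // divr_ge0 ?powR_ge0.
Qed.

Lemma sum_powRN_le r s n : 1 < r -> (s <= n)%N ->
  \sum_(s <= j < n) j.+1%:R `^ (- r) <= KL_tail r s.
Proof.
move=> r1 sn; have r0 : 0 < r - 1 by rewrite subr_gt0.
have pos a b : (0 < a)%N -> (a <= b)%N -> \sum_(a <= j < b) j.+1%:R `^ (- r) <= a%:R `^ (1 - r) / (r - 1).
  move=> a0 ab.
  apply: (@le_trans _ _ (\sum_(a <= j < b) (- (j.+1%:R `^ (1 - r) / (r - 1)) - (- (j%:R `^ (1 - r) / (r - 1)))))).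
    rewrite !big_nat; apply: ler_sum => j /andP[aj _].
    by rewrite opprK addrC -mulrBl; apply: powRN_le_telescope => //; exact: leq_trans aj.
  rewrite (telescope_sumr (fun j => - (j%:R `^ (1 - r) / (r - 1)))) // opprK addrC.
  by rewrite lerBlDr lerDl divr_ge0 ?powR_ge0 ?ltW.
case: s sn => [|s] sn; last exact: pos.
case: n sn => [|n] _; first by rewrite big_geq // KL_tail_ge0.
rewrite big_ltn // powR1 /= lerD2l.
by apply: le_trans (pos 1%N n.+1 _ _) _ => //; rewrite powR1 mul1r.
Qed.

End SampleSizes.

Section Coefficients.
Context (R : realType) (d : nat).
Local Notation pt := 'rV[R]_d.
Context (mu : {measure set pt -> \bar R}) (hmu : is_lebesgue mu).
Context (D : set pt) (oD : open D) (bD : exists2 N : R, 0 < N & D `<=` obox (const_mx (- N)) (const_mx N)).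
Let mD : measurable D := open_measurable_rV oD.
Let Doo : (mu D < +oo)%E := bounded_domain_mu_fin hmu oD bD.
Context (phi : nat -> pt -> R) (psi : nat -> R -> R) (r CKL Cpsi : R) (r1 : 1 < r) (Cpsi0 : 0 <= Cpsi).
Hypotheses (hphi : forall j, in_W1inf mu D (phi j))
  (hpsi : forall j t, 0 <= t <= 1 -> `|psi j t| <= Cpsi)
  (hKL : forall j, (W1infnorm mu D (phi j.+1) <= (CKL * j.+1%:R `^ (- r))%:E)%E)
  (hseries : forall w : seqR R, cube w -> in_W1inf mu D (coef_lim psi phi w) /\
     W1infnorm mu D (coef_lim psi phi w \- coef_trunc psi phi n w) @[n --> \oo] --> (0 : \bar R)%E).
Implicit Types (w : seqR R) (s n : nat).

Let fsubE (f g : pt -> R) : f \- g = f - g. Proof. by apply/funext. Qed.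

(** The absolute value makes the weight nonnegative without a sign assumption on [CKL]. *)
Definition KL_weight (j : nat) : R := `|CKL| * j.+1%:R `^ (- r).

Lemma KL_weight_ge0 j : 0 <= KL_weight j.
Proof. by rewrite mulr_ge0 ?powR_ge0. Qed.

Lemma W1le_phi j : W1le mu D (phi j.+1) (KL_weight j).
Proof.
apply/(W1infnorm_leP mu oD _ (KL_weight_ge0 j)); split=> //; apply: le_trans (hKL j) _; rewrite lee_fin ler_wpM2r ?powR_ge0 //.
exact: ler_norm.
Qed.

Lemma W1le_0 : W1le mu D 0 0.
Proof.
split; first exact: measurable_cst.
  by apply/aeW => x _; rewrite normr0.
move=> i; exists 0; last by apply/aeW => x _; rewrite normr0.
have L0 : in_L1loc mu D 0 by apply: (L2_L1loc mD Doo); exact: L2_0.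
split=> // f _; rewrite -[LHS]/(L2dot mu D 0 _) -[X in _ = - X]/(L2dot mu D 0 _).
by rewrite !(L2dot0l mu oD) oppr0.
Qed.

Lemma W1le_KL_sum (t : nat -> R) s n :
  W1le mu D (\sum_(s <= j < n) t j *: phi j.+1) (\sum_(s <= j < n) `|t j| * KL_weight j).
Proof.
elim: n => [|n IH]; first by rewrite !big_geq //; exact: W1le_0.
have [sn|sn] := leqP s n; last by rewrite !big_geq //; exact: W1le_0.
rewrite !big_nat_recr //= addrC [X in W1le _ _ _ X]addrC.
exact: (W1le_linear oD _ (W1le_phi n)).
Qed.

Lemma coef_truncE s w : coef_trunc psi phi s w = phi 0 + \sum_(0 <= j < s) psi j ((w : nat -> R) j) *: phi j.+1.
Proof.
apply/funext => x; rewrite /coef_trunc big_mkord /= fctE; congr (_ + _).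
by rewrite fct_sumE.
Qed.

Lemma W1le_coef_trunc_sub s w w' :
  W1le mu D (coef_trunc psi phi s w \- coef_trunc psi phi s w')
    (\sum_(0 <= j < s) `|psi j ((w : nat -> R) j) - psi j ((w' : nat -> R) j)| * KL_weight j).
Proof.
have -> : coef_trunc psi phi s w \- coef_trunc psi phi s w' =
    \sum_(0 <= j < s) (psi j ((w : nat -> R) j) - psi j ((w' : nat -> R) j)) *: phi j.+1.
  rewrite !coef_truncE fsubE addrC opprD addrACA addNr add0r addrC -sumrB.
  by apply: eq_bigr => j _; rewrite scalerBl.
exact: W1le_KL_sum.
Qed.

Lemma KL_sum_le s n w : cube w -> (s <= n)%N ->
  \sum_(s <= j < n) `|psi j ((w : nat -> R) j)| * KL_weight j <= Cpsi * `|CKL| * KL_tail r s.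
Proof.
move=> cw sn; apply: (@le_trans _ _ (\sum_(s <= j < n) Cpsi * `|CKL| * j.+1%:R `^ (- r))).
  by apply: ler_sum => j _; rewrite -mulrA ler_pM ?KL_weight_ge0 // hpsi.
by rewrite -mulr_sumr ler_wpM2l ?mulr_ge0 // sum_powRN_le.
Qed.

Lemma W1le_coef_trunc_diff s n w : cube w -> (s <= n)%N ->
  W1le mu D (coef_trunc psi phi n w \- coef_trunc psi phi s w) (Cpsi * `|CKL| * KL_tail r s).
Proof.
move=> cw sn.
have -> : coef_trunc psi phi n w \- coef_trunc psi phi s w =
    \sum_(s <= j < n) psi j ((w : nat -> R) j) *: phi j.+1.
  rewrite !coef_truncE fsubE addrC opprD addrACA addNr add0r.
  by rewrite (big_cat_nat (leq0n s) sn) /= addrA addNr add0r.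
by apply: W1le_mono (W1le_KL_sum _ s n); exact: KL_sum_le.
Qed.

Lemma coef_bounded : exists2 K : R, 0 <= K & forall n w, cube w -> W1le mu D (coef_trunc psi phi n w) K.
Proof.
have [K K0 hK] := W1inf_bounded oD (hphi 0).
exists (K + Cpsi * `|CKL| * KL_tail r 0); first by rewrite addr_ge0 // !mulr_ge0 // KL_tail_ge0.
move=> n w cw; rewrite coef_truncE -[phi 0]scale1r.
have := W1le_linear oD 1 hK (W1le_KL_sum (fun j => psi j ((w : nat -> R) j)) 0 n).
rewrite normr1 mul1r; apply: W1le_mono; rewrite lerD2l; exact: KL_sum_le.
Qed.

(** The tail bound for finite sums is uniform in the upper index n. Going through an n that is both
    beyond s and so large that the truncation is within e of the limit adds only e. *)
Lemma W1le_coef_lim_diff s w : cube w ->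
  W1le mu D (coef_lim psi phi w \- coef_trunc psi phi s w) (Cpsi * `|CKL| * KL_tail r s).
Proof.
move=> cw; set K := Cpsi * _ * _.
have K0 : 0 <= K by rewrite !mulr_ge0 // KL_tail_ge0.
have [hlim hcvg] := hseries cw.
have [K1 K10 hK1] := W1inf_bounded oD hlim.
have [K2 K20 hK2] := coef_bounded.
have sub n : W1le mu D (coef_lim psi phi w \- coef_trunc psi phi n w) (K1 + K2).
  by apply: W1le_sub => //; exact: hK2.
apply/(W1infnorm_leP mu oD _ K0); split.
  by have /(W1infnorm_leP mu oD _ (addr_ge0 K10 K20)) [] := sub s.
apply/lee_addgt0Pr => e e0.
have : \forall n \near \oo, (W1infnorm mu D (coef_lim psi phi w \- coef_trunc psi phi n w)%R <= e%:E)%E.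
  have : nbhs (0 : \bar R)%E [set x | (x <= e%:E)%E].
    apply: (@filterS _ _ _ [set x | (x < e%:E)%E]) => [x /= /ltW //|].
    by apply: open_nbhs_nbhs; split; [exact: open_ereal_lt_ereal|rewrite /= lte_fin].
  by move/hcvg.
move=> [n0 _ hn0]; pose n := maxn n0 s.
have h1 : W1le mu D (coef_lim psi phi w \- coef_trunc psi phi n w) e.
  apply/(W1infnorm_leP mu oD _ (ltW e0)); split; last by apply: hn0; exact: leq_maxl.
  by have /(W1infnorm_leP mu oD _ (addr_ge0 K10 K20)) [] := sub n.
have h2 := W1le_coef_trunc_diff cw (leq_maxr n0 s).
have := W1le_linear oD 1 h1 h2; rewrite normr1 mul1r scale1r.
have -> : (coef_lim psi phi w \- coef_trunc psi phi n w) + (coef_trunc psi phi n w \- coef_trunc psi phi s w) =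
    coef_lim psi phi w \- coef_trunc psi phi s w.
  by apply/funext => x; rewrite fctE /= addrA subrK.
by move/(W1infnorm_leP mu oD _ (addr_ge0 (ltW e0) K0)) => -[_]; rewrite addrC EFinD.
Qed.

End Coefficients.

(** * Uniform constants for the parametric problem *)

Section ModelProblem.
Context (R : realType) (d : nat).
Local Notation pt := 'rV[R]_d.
Context (mu : {measure set pt -> \bar R}) (hmu : is_lebesgue mu).
Context (D : set pt) (oD : open D) (bD : exists2 N : R, 0 < N & D `<=` obox (const_mx (- N)) (const_mx N)).
Let mD : measurable D := open_measurable_rV oD.
Let Doo : (mu D < +oo)%E := bounded_domain_mu_fin hmu oD bD.
Context (phi : nat -> pt -> R) (psi : nat -> R -> R) (r CKL Cpsi : R) (r1 : 1 < r) (Cpsi0 : 0 <= Cpsi).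
Hypotheses (hphi : forall j, in_W1inf mu D (phi j))
  (hpsi : forall j t, 0 <= t <= 1 -> `|psi j t| <= Cpsi)
  (hKL : forall j, (W1infnorm mu D (phi j.+1) <= (CKL * j.+1%:R `^ (- r))%:E)%E)
  (hseries : forall w : seqR R, cube w -> in_W1inf mu D (coef_lim psi phi w) /\
     W1infnorm mu D (coef_lim psi phi w \- coef_trunc psi phi n w) @[n --> \oo] --> (0 : \bar R)%E).
Let A := coef psi phi (s_ r).
Context (Amin Amax Creg : R) (Amin0 : 0 < Amin) (Amin1 : Amin <= 1).
Hypotheses (hcoercive : forall nu w v, cube w -> in_H10 mu D v ->
     Amin * H1norm mu D v ^+ 2 <= bform mu D (A nu w) v v)
  (hbounded : forall nu w u v, cube w -> in_H10 mu D u -> in_H10 mu D v ->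
     `|bform mu D (A nu w) u v| <= Amax * H1norm mu D u * H1norm mu D v)
  (hreg : forall nu w f, cube w -> in_L2 mu D f ->
     exists u, [/\ solves mu D (A nu w) f (in_H10 mu D) u, in_H2 mu D u &
       ((H2norm mu D u)%:E <= (Creg * Amin ^- 2)%:E
          * (1 + W1infnorm mu D (A nu w)) * (L2norm mu D f)%:E)%E]).
Context (X : nat -> set (pt -> R)) (h : nat -> R) (Capprox Ch : R).
Hypotheses (XH : forall l, X l `<=` in_H10 mu D) (X0 : forall l, X l (fun=> 0))
  (Xlin : forall l (c : R) v w, X l v -> X l w -> X l (fun x => c * v x + w x))
  (h_pos : forall l, 0 < h l) (h_rate : forall l, h l <= Ch * 2 ^- l)
  (happrox : forall l w, in_H2 mu D w -> in_H10 mu D w ->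
     inf [set H1norm mu D (w \- v) | v in X l] <= Capprox * h l * H2norm mu D w).

Lemma W1le_coef : exists2 K : R, 0 <= K & forall nu w, cube w -> W1le mu D (A nu w) K.
Proof.
have [K K0 hK] := coef_bounded hmu oD bD r1 Cpsi0 hphi hpsi hKL.
pose K' := Cpsi * `|CKL| * KL_tail r 0.
exists (K + K'); first by rewrite addr_ge0 // !mulr_ge0 // KL_tail_ge0.
have K'0 : 0 <= K' by rewrite !mulr_ge0 // KL_tail_ge0.
case=> [nu|] w cw.
  by apply: (@W1le_mono _ _ _ _ _ K); [rewrite lerDl|exact: hK].
have h1 := W1le_coef_lim_diff hmu oD bD r1 Cpsi0 hphi hpsi hKL hseries 0 cw.
have := W1le_linear oD 1 h1 (hK 0%N w cw); rewrite normr1 mul1r scale1r addrC.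
rewrite (_ : coef_trunc psi phi 0 w + (coef_lim psi phi w \- coef_trunc psi phi 0 w) = A None w); last first.
  by apply/funext => x; rewrite fctE /= addrC subrK.
by rewrite -/K' [X in W1le _ _ _ X]addrC.
Qed.

(** The W^{1,oo} bound K is uniform in the level and the parameter, so the coefficient-dependent
    regularity constant becomes a single number. Absolute values replace sign assumptions on the
    given constants. *)
Lemma regular_coef_A : exists2 Cr : R, 0 <= Cr &
  forall nu w, cube w -> regular_coef mu D Amin `|Amax| Cr (A nu w).
Proof.
have [K K0 hK] := W1le_coef.
exists (`|Creg| * Amin ^- 2 * (1 + K)).
  by rewrite !mulr_ge0 ?addr_ge0 // invr_ge0 exprn_ge0 // ltW.
move=> nu w cw; split.
- by exists K => //; exact: hK.
- by move=> v; exact: hcoercive.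
- move=> u v Hu Hv; apply: le_trans (hbounded _ cw Hu Hv) _.
  by rewrite ler_wpM2r ?H1norm_ge0 // ler_wpM2r ?H1norm_ge0 // ler_norm.
move=> f Lf; have [u [su H2u nu_]] := hreg nu cw Lf; exists u; split=> //.
have [_ wK] := (proj2 (W1infnorm_leP mu oD (A nu w) K0)) (hK nu w cw).
rewrite -lee_fin; apply: le_trans nu_ _.
have w0 := W1infnorm_ge0 mu D (A nu w).
move: wK w0; case: (W1infnorm mu D (A nu w)) => [k| |] // wK w0.
rewrite !lee_fin in wK w0 *.
rewrite ler_wpM2r ?L2norm_ge0 //.
apply: (@le_trans _ _ (`|Creg| * Amin ^- 2 * (1 + k))).
  by rewrite ler_wpM2r ?addr_ge0 // ler_wpM2r ?invr_ge0 ?exprn_ge0 ?(ltW Amin0) // ler_norm.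
by rewrite ler_wpM2l ?lerD2l // mulr_ge0 // invr_ge0 exprn_ge0 // ltW.
Qed.

Lemma fe_approx_X l : fe_approx mu D `|Capprox| (X l) (h l).
Proof.
split; [exact: XH|exact: X0|by move=> k u v; exact: Xlin|move=> w H2w Hw].
apply: le_trans (happrox l H2w Hw) _.
by rewrite ler_wpM2r ?H2norm_ge0 // ler_wpM2r ?(ltW (h_pos l)) // ler_norm.
Qed.

Section Fixed.
Context (f g : pt -> R) (Lf : in_L2 mu D f) (Lg : in_L2 mu D g).

(** The functional G is linear on L2 functions only, where the integrals converge; hence the
    hypothesis on all levels. *)
Lemma L2dot_double_diff (U : nat -> nat -> pt -> R) l nu : (forall l nu, in_L2 mu D (U nu l)) ->
  L2dot mu D g (double_diff U l nu) = double_diff (fun nu' l' => L2dot mu D g (U nu' l')) l nu.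
Proof.
move=> LU.
have sub u v : in_L2 mu D u -> in_L2 mu D v -> in_L2 mu D (u - v) /\
    L2dot mu D g (u - v) = L2dot mu D g u - L2dot mu D g v.
  move=> Lu Lv; rewrite (_ : u - v = -1 *: v + u); last by rewrite scaleN1r addrC.
  split; first exact: L2_linear.
  by rewrite (L2dot_linearr mD (-1) Lv Lu Lg) mulN1r addrC.
have L0 : in_L2 mu D 0 by exact: L2_0.
have D0 : L2dot mu D g 0 = 0 by rewrite L2dot_sym (L2dot0l mu oD).
have bd (x : nat -> pt -> R) n : (forall n, in_L2 mu D (x n)) -> in_L2 mu D (backward_diff x n) /\
    L2dot mu D g (backward_diff x n) = backward_diff (fun n => L2dot mu D g (x n)) n.
  move=> Lx; case: n => [|n]; rewrite /backward_diff.
    by have [h1 ->] := sub (x 0%N) 0 (Lx _) L0; rewrite D0.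
  exact: (sub (x n.+1) (x n) (Lx _) (Lx _)).
rewrite /double_diff.
have [_ ->] := bd (fun n => backward_diff (U n) l) nu (fun n => (bd (U n) l (LU^~ n)).1).
congr (backward_diff _ nu); apply/funext => n.
by have [] := bd (U n) l (LU^~ n).
Qed.

Context (uh : nat -> nat -> seqR R -> pt -> R) (u : seqR R -> pt -> R).
Hypotheses (suh : forall nu l w, cube w -> solves mu D (A (Some nu) w) f (X l) (uh nu l w))
  (su : forall w, cube w -> solves mu D (A None w) f (in_H10 mu D) (u w)).

Let nfg := L2norm mu D f * L2norm mu D g.
Let nfg0 : 0 <= nfg. Proof. by rewrite mulr_ge0 ?L2norm_ge0. Qed.

(** [coefficient_error] on the finite element space, for two parameters. It makes the discrete
    quantity measurable and a function of the first [s_ r nu] coordinates only. *)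
Lemma quantity_lipschitz nu l w w' : cube w -> cube w' ->
  `|L2dot mu D g (uh nu l w) - L2dot mu D g (uh nu l w')| <=
  Amin ^- 2 * (\sum_(0 <= j < s_ r nu)
     `|psi j ((w : nat -> R) j) - psi j ((w' : nat -> R) j)| * KL_weight r CKL j) * nfg.
Proof.
move=> cw cw'; have [Cr _ rA] := regular_coef_A.
have K0 : 0 <= \sum_(0 <= j < s_ r nu) `|psi j ((w : nat -> R) j) - psi j ((w' : nat -> R) j)| * KL_weight r CKL j.
  by apply: sumr_ge0 => j _; rewrite mulr_ge0 ?KL_weight_ge0.
have Kw := W1le_coef_trunc_sub hmu oD bD psi hphi hKL (s_ r nu) w w'.
have Xl a x y : X l x -> X l y -> X l (a *: x + y) by exact: Xlin.
exact: (coefficient_error hmu oD bD Amin0 Lf Lg (rA (Some nu) _ cw) (rA (Some nu) _ cw') K0 Kw (XH (l := l)) Xl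
  (suh nu l cw) (suh nu l cw')).
Qed.

(** The exact solutions for truncated coefficients are not among the data, so V selects one for each
    level by [xget]. *)
Lemma quantity_bounds_fixed w (K : R) : cube w -> 0 <= K ->
  (let V nu := L2dot mu D g (xget (fun=> 0) [set v | solves mu D (A (Some nu) w) f (in_H10 mu D) v]) in
   let U nu l := L2dot mu D g (uh nu l w) in
   [/\ forall v, `|V v| <= K * nfg, forall v, `|V v.+1 - V v| <= K * nfg * 4 ^- v,
     forall v l, `|V v - U v l| <= K * nfg * 4 ^- l,
     forall v l, `|(V v.+1 - U v.+1 l) - (V v - U v l)| <= K * nfg * 4 ^- (v + l) &
     forall v, `|L2dot mu D g (u w) - V v| <= K * nfg * 4 ^- v] ->
   (forall l nu, `|L2dot mu D g (double_diff (fun nu' l' => uh nu' l' w) l nu)| <= 32 * K * 4 ^- (l + nu) * nfg) /\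
   (forall n, `|L2dot mu D g (u w) - \sum_(l < n.+1) \sum_(nu < n.+1 | (l + nu <= n)%N)
       L2dot mu D g (double_diff (fun nu' l' => uh nu' l' w) l nu)| <= 6 * K * n.+1%:R * 4 ^- n * nfg)).
Proof.
move=> cw K0 V U [h1 h2 h3 h4 h5].
have LU l nu : in_L2 mu D (uh nu l w) by apply/H1_L2/H10_H1/(XH (l := l)); case: (suh nu l cw).
have K0' : 0 <= K * nfg by exact: mulr_ge0.
have E l nu : L2dot mu D g (double_diff (fun nu' l' => uh nu' l' w) l nu) = double_diff U l nu.
  exact: L2dot_double_diff.
split=> [l nu|n].
  rewrite E; apply: le_trans (double_diff_bound K0' h1 h2 h3 h4 l nu) _.
  by rewrite le_eqVlt; apply/orP; left; apply/eqP; ring.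
under eq_bigr do under eq_bigr do rewrite E.
apply: le_trans (sparse_grid_bias K0' h3 h4 h5 n) _.
by rewrite le_eqVlt; apply/orP; left; apply/eqP; ring.
Qed.

End Fixed.

(** K precedes f, g, the solutions and the parameter. It collects [C1] for the mesh error, [C2] for
    the mixed error, [C3] for the coefficient error and [Amin^-1] for stability. *)
Lemma quantity_bounds : exists2 K : R, 0 < K & forall (f g : pt -> R) uh u,
  in_L2 mu D f -> in_L2 mu D g ->
  (forall nu l w, cube w -> solves mu D (A (Some nu) w) f (X l) (uh nu l w)) ->
  (forall w, cube w -> solves mu D (A None w) f (in_H10 mu D) (u w)) ->
  forall w, cube w ->
  (forall l nu, `|L2dot mu D g (double_diff (fun nu' l' => uh nu' l' w) l nu)| <=
     K * 4 ^- (l + nu) * (L2norm mu D f * L2norm mu D g)) /\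
  (forall n, `|L2dot mu D g (u w) - \sum_(l < n.+1) \sum_(nu < n.+1 | (l + nu <= n)%N)
      L2dot mu D g (double_diff (fun nu' l' => uh nu' l' w) l nu)| <=
     K * n.+1%:R * 4 ^- n * (L2norm mu D f * L2norm mu D g)).
Proof.
have [Cr Cr0 rA] := regular_coef_A.
have r0 : 0 < r - 1 by rewrite subr_gt0.
have Am0 : 0 <= `|Amax| by []. have Ca0 : 0 <= `|Capprox| by [].
pose k0 := Cpsi * `|CKL| / (r - 1).
have k00 : 0 <= k0 by rewrite divr_ge0 ?mulr_ge0 // ltW.
pose k (v : nat) := k0 * 4 ^- v.
have q0 v : 0 <= 4 ^- v :> R by rewrite invr_ge0 exprn_ge0.
have kk v : 0 <= k v by exact: mulr_ge0.
have tail v : Cpsi * `|CKL| * KL_tail r (s_ r v) <= k v.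
  have -> : KL_tail r (s_ r v) = (s_ r v)%:R `^ (1 - r) / (r - 1).
    by rewrite /KL_tail; case: (s_ r v) (s_gt0 r v).
  rewrite /k /k0 -!mulrA ler_wpM2l // ler_wpM2l // mulrC ler_wpM2l ?invr_ge0 ?(ltW r0) //.
  exact: s_powR_le.
have dk v w : cube w -> W1le mu D (A (Some v.+1) w \- A (Some v) w) (k v).
  move=> cw; apply: W1le_mono (tail v) _.
  apply: (W1le_coef_trunc_diff hmu oD bD r1 Cpsi0 hphi hpsi hKL cw).
  exact: s_mono.
have dlim v w : cube w -> W1le mu D (A None w \- A (Some v) w) (k v).
  move=> cw; apply: W1le_mono (tail v) _.
  exact: (W1le_coef_lim_diff hmu oD bD r1 Cpsi0 hphi hpsi hKL hseries _ cw).
pose C1 := `|Amax| ^+ 2 * `|Capprox| ^+ 2 * Cr ^+ 2 / Amin * Ch ^+ 2.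
pose C2 := mixed_constant d Amin `|Amax| Cr `|Capprox| * k0 * Ch ^+ 2.
pose C3 := Amin ^- 2 * k0.
have mc0 : 0 <= mixed_constant d Amin `|Amax| Cr `|Capprox|.
  have Ai : 0 <= Amin^-1 by rewrite invr_ge0 ltW.
  by rewrite /mixed_constant !(addr_ge0, mulr_ge0).
have [C10 C20 C30] : [/\ 0 <= C1, 0 <= C2 & 0 <= C3].
  have Ai : 0 <= Amin^-1 by rewrite invr_ge0 ltW.
  have hC : 0 <= Ch ^+ 2 by exact: sqr_ge0.
  split; first by rewrite /C1 mulr_ge0 // mulr_ge0 // mulr_ge0 ?sqr_ge0 // mulr_ge0 ?sqr_ge0.
    by rewrite /C2 mulr_ge0 // mulr_ge0.
  by rewrite /C3 mulr_ge0 // invr_ge0 sqr_ge0.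
have C40 : 0 <= Amin^-1 by rewrite invr_ge0 ltW.
pose K := C1 + C2 + C3 + Amin^-1.
have K0 : 0 <= K by rewrite !addr_ge0.
have [K1 K2 K3 K4] : [/\ C1 <= K, C2 <= K, C3 <= K & Amin^-1 <= K].
  by rewrite /K; move: C10 C20 C30 C40; move: (C1) (C2) (C3) (Amin^-1) => a b c e; split; lra.
have h2 l : h l ^+ 2 <= Ch ^+ 2 * 4 ^- l.
  have -> : Ch ^+ 2 * 4 ^- l = (Ch * 2 ^- l) ^+ 2 :> R.
    by rewrite exprMn exprVn -exprM mulnC exprM; congr (_ * (_ ^+ l)^-1); rewrite expr2 -natrM.
  by rewrite lerXn2r // ?nnegrE ?(ltW (h_pos l)) // (le_trans (ltW (h_pos l))).
exists (32 * K + 1); first by rewrite ltr_wpDl // mulr_ge0.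
move=> f g uh u Lf Lg suh su w cw.
set nfg := L2norm mu D f * L2norm mu D g.
have nfg0 : 0 <= nfg by rewrite mulr_ge0 ?L2norm_ge0.
pose v0 nu := xget (fun=> 0) [set v | solves mu D (A (Some nu) w) f (in_H10 mu D) v].
have sv nu : solves mu D (A (Some nu) w) f (in_H10 mu D) (v0 nu).
  have [v [sv _ _]] := hreg (Some nu) cw Lf.
  by rewrite /v0; case: xgetP => [z -> //|/(_ v)].
have H10lin a x y : in_H10 mu D x -> in_H10 mu D y -> in_H10 mu D (a *: x + y).
  exact: (H10_linear hmu oD Doo).
have up (C x : R) : C <= K -> 0 <= x -> C * nfg * x <= K * nfg * x.
  by move=> CK x0; rewrite ler_wpM2r // ler_wpM2r.
have [|D1 D2] := quantity_bounds_fixed Lg suh (u := u) cw K0.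
  split.
  - move=> v; apply: le_trans (solves_functional_bound oD Amin0 (fun _ => id) (rA _ _ cw) Lf Lg (sv v)) _.
    by rewrite -/nfg mulrC ler_wpM2r.
  - move=> v; apply: le_trans (coefficient_error hmu oD bD Amin0 Lf Lg (rA _ _ cw) (rA _ _ cw) (kk v) (dk v w cw) (fun _ => id) H10lin (sv v.+1) (sv v)) _.
    apply: le_trans (up _ _ K3 (q0 v)); rewrite -/nfg /C3 /k.
    by rewrite le_eqVlt; apply/orP; left; apply/eqP; ring.
  - move=> v l; apply: le_trans (discretization_error hmu oD bD Amin0 Am0 Cr0 Ca0 (fe_approx_X l) (ltW (h_pos l)) Lf Lg (rA _ _ cw) (sv v) (suh v l w cw)) _.
    apply: le_trans (up _ _ K1 (q0 l)); rewrite -/nfg /C1.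
    rewrite [leRHS]mulrAC ler_wpM2r // -[leRHS]mulrA ler_wpM2l //.
    by rewrite !mulr_ge0 // exprn_ge0.
  - move=> v l; apply: le_trans (mixed_error hmu oD bD Amin0 Amin1 Am0 Cr0 Ca0 (fe_approx_X l) (ltW (h_pos l)) Lf Lg (rA _ _ cw) (rA _ _ cw) (kk v) (dk v w cw) (sv v.+1) (sv v) (suh v.+1 l w cw) (suh v l w cw)) _.
    apply: le_trans (up _ _ K2 (q0 (v + l)%N)); rewrite -/nfg /C2 /k.
    rewrite exprD invfM [leRHS]mulrAC ler_wpM2r //.
    rewrite (_ : _ * (4 ^- v * 4 ^- l) = mixed_constant d Amin `|Amax| Cr `|Capprox| * (k0 * 4 ^- v) * (Ch ^+ 2 * 4 ^- l)); last by ring.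
    by rewrite ler_wpM2l //; exact: mulr_ge0 mc0 (kk v).
  - move=> v; apply: le_trans (coefficient_error hmu oD bD Amin0 Lf Lg (rA _ _ cw) (rA _ _ cw) (kk v) (dlim v w cw) (fun _ => id) H10lin (su w cw) (sv v)) _.
    apply: le_trans (up _ _ K3 (q0 v)); rewrite -/nfg /C3 /k.
    by rewrite le_eqVlt; apply/orP; left; apply/eqP; ring.
split=> [l nu|n].
  apply: le_trans (D1 l nu) _; rewrite -/nfg ler_wpM2r // ler_wpM2r // lerDl //.
apply: le_trans (D2 n) _; rewrite -/nfg ler_wpM2r // ler_wpM2r // ler_wpM2r //.
by move: K0; lra.
Qed.

End ModelProblem.

(** * Random samples *)

Section SequenceSpace.
Context (R : realType).
Local Notation Seq := (seqR R).
Implicit Types (w : Seq) (s j : nat).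

Lemma measurable_cylinder j (B : set R) : measurable B ->
  measurable [set w : Seq | B ((w : nat -> R) j)].
Proof. by move=> mB; apply: sub_sigma_algebra; exists j, B. Qed.

Lemma measurable_cube : measurable (@cube R).
Proof.
rewrite (_ : cube = \bigcap_j [set w : Seq | `[0, 1]%classic ((w : nat -> R) j)]); last first.
  by apply/seteqP; split=> w /= h j; [move=> _; rewrite /= in_itv; exact: h|have := h j I; rewrite /= in_itv].
by apply: bigcapT_measurable => j; apply: measurable_cylinder; exact: measurable_itv.
Qed.

Lemma measurable_fun_seqR dT (Th : measurableType dT) (f : Th -> Seq) :
  (forall j, measurable_fun setT (fun t => (f t : nat -> R) j)) -> measurable_fun setT f.
Proof.
move=> mf; apply: (@measurability _ _ Th (seqR R) setT f (@cylinders R)) => //.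
move=> _ [_ [j [B [mB ->]]] <-]; rewrite setTI.
by have := mf j measurableT B mB; rewrite setTI.
Qed.

Lemma measurable_extend s : measurable_fun setT (@extend R s).
Proof.
apply: measurable_fun_seqR => j; have [js|sj] := ltnP j s.
  rewrite (_ : (fun t => _) = @tnth s R ^~ (Ordinal js)); first exact: measurable_tnth.
  by apply/funext => x; rewrite /extend (tnth_nth 0).
rewrite (_ : (fun t => _) = cst 0); first exact: measurable_cst.
by apply/funext => x; rewrite /extend nth_default // size_tuple.
Qed.

Definition truncate s (w : Seq) : s.-tuple R := [tuple (w : nat -> R) i | i < s].

Lemma measurable_truncate s : measurable_fun setT (truncate s).
Proof.
apply/measurable_fun_tnthP => i.
rewrite (_ : _ \o _ = (fun w : Seq => (w : nat -> R) i)); last first.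
  by apply/funext => w; rewrite /= tnth_mktuple.
by move=> _ B mB; rewrite setTI; exact: measurable_cylinder.
Qed.

Lemma extend_truncate s w j : (j < s)%N -> (extend (truncate s w) : nat -> R) j = (w : nat -> R) j.
Proof. by move=> js; rewrite /extend -(tnth_nth 0 _ (Ordinal js)) tnth_mktuple. Qed.

Lemma cube_extend_truncate s w : cube w -> cube (extend (truncate s w)).
Proof.
move=> cw j; have [js|sj] := ltnP j s; first by rewrite extend_truncate.
by rewrite /extend nth_default ?size_tuple // lexx ler01.
Qed.

(* { F < x } is a countable union of cells on which the integer parts of n * psi_j are constant. *)
Lemma measurable_separable_lipschitz s (F : Seq -> R) (c : nat -> R) (psi : nat -> R -> R) :
  (forall j, 0 <= c j) -> (forall j, measurable_fun (`[0, 1]%classic : set R) (psi j)) ->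
  (forall w w', cube w -> cube w' -> `|F w - F w'| <=
     \sum_(0 <= j < s) c j * `|psi j ((w : nat -> R) j) - psi j ((w' : nat -> R) j)|) ->
  measurable_fun cube F.
Proof.
move=> c0 mpsi hF.
pose B n j (z : int) : set R := `[0, 1]%classic `&` psi j @^-1` [set t | Num.floor (n%:R * t) = z].
have mB n j z : measurable (B n j z).
  apply: mpsi; first exact: measurable_itv.
  have mn : measurable_fun setT (fun t : R => n%:R * t) by exact: measurable_funM.
  rewrite (_ : [set t | _] = setT `&` (fun t : R => n%:R * t) @^-1` `[z%:~R, (z + 1)%:~R[%classic).
    by apply: mn => //; exact: measurable_itv.
  rewrite setTI; apply/seteqP; split=> t /=; rewrite in_itv /=; last by move=> h; exact/floor_def.
  by move=> <-; rewrite floor_le floorD1_gt.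
pose S (i : nat * seq int) : set Seq := cube `&` \bigcap_(j in `I_s) [set w : Seq | B i.1 j (nth 0 i.2 j) ((w : nat -> R) j)].
have mS i : measurable (S i).
  apply: measurableI; first exact: measurable_cube.
  by apply: bigcap_measurableType => j _; exact: (measurable_cylinder j (mB i.1 j (nth 0 i.2 j))).
pose C := \sum_(0 <= j < s) c j.
have C0 : 0 <= C by exact: sumr_ge0.
have dS n k w w' : (0 < n)%N -> S (n, k) w -> S (n, k) w' -> `|F w - F w'| <= C / n%:R.
  move=> n0 [cw Sw] [cw' Sw']; apply: le_trans (hF _ _ cw cw') _.
  rewrite /C mulr_suml !big_nat; apply: ler_sum => j /andP[_ js].
  rewrite ler_wpM2l //.
  have [_ /= e] := Sw j js; have [_ /= e'] := Sw' j js.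
  have n0' : 0 < n%:R :> R by rewrite ltr0n.
  rewrite -[leRHS]mul1r ler_pdivlMr // -[X in _ * X]gtr0_norm // -normrM mulrC mulrBr.
  have := floor_le (n%:R * psi j ((w : nat -> R) j)); have := floorD1_gt (n%:R * psi j ((w : nat -> R) j)).
  have := floor_le (n%:R * psi j ((w' : nat -> R) j)); have := floorD1_gt (n%:R * psi j ((w' : nat -> R) j)).
  by rewrite e e' intrD ler_norml; move: (n%:R * _) (n%:R * _) => a b; lra.
apply: (@measurability _ _ _ _ _ _ (@RGenInftyO.G R)); first exact: RGenInftyO.measurableE.
move=> _ [_ [x ->] <-].
pose Q := [set i | S i `<=` [set w | F w < x]].
rewrite (_ : _ `&` _ = \bigcup_i (if i \in Q then S i else set0)).
  apply: countable_bigcupT_measurable => [|i]; first exact: countableP.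
  by case: ifP.
apply/seteqP; split=> [w [cw]|w [i _]]; last first.
  case: ifPn => // iQ Siw; split; first by case: Siw.
  by rewrite /= in_itv /=; exact: (set_mem iQ).
rewrite /= in_itv /= => Fx.
(* F oscillates by at most C / n on a cell. This n makes the oscillation smaller than the gap x - F
   w, so the cell of w stays below x. *)
have [n hn] : exists n : nat, (C + 1) / (x - F w) < n%:R.
  by exists (Num.truncn ((C + 1) / (x - F w))).+1; exact: truncnS_gt.
have xF : 0 < x - F w by rewrite subr_gt0.
have n0 : (0 < n)%N.
  by rewrite -(ltr_nat R); apply: le_lt_trans hn; apply: divr_ge0; [exact: addr_ge0|exact: ltW].
pose k := mkseq (fun j => Num.floor (n%:R * psi j ((w : nat -> R) j))) s.
have Sw : S (n, k) w.
  split=> // j js; split; first by rewrite /= in_itv; exact: cw.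
  by rewrite /= nth_mkseq.
exists (n, k) => //; rewrite mem_set // => w' Sw' /=.
have := dS n k w' w n0 Sw' Sw.
have n0' : 0 < n%:R :> R by rewrite ltr0n.
have : C / n%:R < x - F w.
  rewrite ltr_pdivrMr // mulrC -ltr_pdivrMr //; apply: le_lt_trans hn.
  by rewrite ler_pM2r ?invr_gt0 // lerDl.
by rewrite ler_norml; move: (C / _) => y; lra.
Qed.

End SequenceSpace.

(** * Independence and the variance of a sample mean *)

Section Independence.
Context (dT : measure_display) (Th : measurableType dT) (R : realType) (Q : probability Th R).
Context (dS : measure_display) (S : measurableType dS).
Implicit Types (Y : {mfun Th >-> S}) (h : S -> R) (B : R).

Definition independent_maps Y1 Y2 : Prop := forall A C : set S, measurable A -> measurable C ->
  (Q (Y1 @^-1` A `&` Y2 @^-1` C) = Q (Y1 @^-1` A) * Q (Y2 @^-1` C))%E.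

Lemma bounded_integrable (f : Th -> R) B : measurable_fun setT f -> (forall t, `|f t| <= B) ->
  Q.-integrable setT (EFin \o f).
Proof.
move=> mf fB; apply: (@integrable_bounded _ _ _ _ _ _ B) => //; last exact/aeW.
exact: le_lt_trans (probability_le1 _ measurableT) (ltry _).
Qed.

Lemma expectation_cst (k : R) : \int[Q]_t k = k.
Proof.
rewrite Rintegral_cst // [X in fine X](_ : _ = 1%E) ?mulr1 //.
exact: probability_setT.
Qed.

(** By uniqueness of product measures, the joint law of the pair is the product of the two laws;
    Fubini then factors the integral. *)
Lemma expectation_product Y1 Y2 h1 h2 B : independent_maps Y1 Y2 ->
  measurable_fun setT h1 -> measurable_fun setT h2 ->
  (forall x, `|h1 x| <= B) -> (forall x, `|h2 x| <= B) ->
  \int[Q]_t (h1 (Y1 t) * h2 (Y2 t)) = \int[Q]_t h1 (Y1 t) * \int[Q]_t h2 (Y2 t).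
Proof.
move=> ind mh1 mh2 b1 b2.
have mZ : measurable_fun setT (fun t => (Y1 t, Y2 t)) by exact: measurable_fun_pair.
pose Z : {mfun Th >-> (S * S)%type} := HB.pack (fun t => (Y1 t, Y2 t)) (isMeasurableFun.Build _ _ _ _ _ mZ).
pose m1 : probability S R := distribution Q Y1; pose m2 : probability S R := distribution Q Y2.
pose f (z : S * S) : \bar R := (h1 z.1 * h2 z.2)%:E.
have mf' : measurable_fun setT (fun z : S * S => h1 z.1 * h2 z.2).
  by apply: measurable_funM; [exact: measurableT_comp mh1 measurable_fst|exact: measurableT_comp mh2 measurable_snd].
have mf : measurable_fun setT f by exact/measurable_EFinP.
have fB z : `|h1 z.1 * h2 z.2| <= B * B by rewrite normrM ler_pM.
have E1 : (\int[m1 \x m2]_z f z = \int[distribution Q Z]_z f z)%E.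
  by apply: eq_measure_integral => A mA _; apply: product_measure_unique => //.
have i12 : (m1 \x m2)%E.-integrable setT f.
  apply: (@integrable_bounded _ _ _ _ _ _ (B * B)) => //; last exact/aeW.
  have h1T : m1 setT = 1%E := probability_setT m1.
  have h2T : m2 setT = 1%E := probability_setT m2.
  have e1 : ((m1 \x m2) setT = 1)%E.
    transitivity (m1 setT * m2 setT)%E; last by rewrite h1T h2T mule1.
    by rewrite -setXTT; exact: product_measure1E.
  by rewrite [X in (X < _)%E]e1 ltry.
have iZ : Q.-integrable setT (f \o Z).
  by apply: (@bounded_integrable _ (B * B)) => //; exact: measurableT_comp mf' mZ.
have ib (Y : {mfun Th >-> S}) h : measurable_fun setT h -> (forall x, `|h x| <= B) ->
    Q.-integrable setT (EFin \o (h \o Y)).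
  by move=> mh hB; apply: (@bounded_integrable (h \o Y) B); [exact: measurableT_comp|move=> t; exact: hB].
have E2 Y h : measurable_fun setT h -> (forall x, `|h x| <= B) ->
    \int[distribution Q Y]_x h x = \int[Q]_t h (Y t).
  by move=> mh hB; rewrite /Rintegral integral_distribution //; [exact/measurable_EFinP|exact: ib].
have id (Y : {mfun Th >-> S}) h : measurable_fun setT h -> (forall x, `|h x| <= B) ->
    (distribution Q Y).-integrable setT (EFin \o h).
  move=> mh hB; apply: (@integrable_bounded _ _ _ _ _ _ B) => //; last exact/aeW.
  exact: le_lt_trans (probability_le1 _ measurableT) (ltry _).
transitivity (fine (\int[m1 \x m2]_z f z)).
  by rewrite E1 integral_distribution.
rewrite -integral12_prod_meas1 // /fubini_F /= -(E2 Y1 h1) // -(E2 Y2 h2) // -/m1 -/m2.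
transitivity (\int[m1]_x ((\int[m2]_y h2 y) * h1 x)).
  rewrite /Rintegral; congr fine; apply: eq_integral => x _.
  have <- : \int[m2]_y (h1 x * h2 y) = (\int[m2]_y h2 y) * h1 x.
    by rewrite [RHS]mulrC; apply: RintegralZl => //; exact: (id Y2 h2 mh2 b2).
  rewrite /Rintegral fineK //; apply: integrable_fin_num => //.
  exact: (integrable_fscale (h1 x) measurableT (id Y2 h2 mh2 b2)).
by rewrite [RHS]mulrC; apply: RintegralZl => //; exact: (id Y1 h1 mh1 b1).
Qed.

Lemma Rintegral_finite_sum (I : Type) (s : seq I) (f : I -> Th -> R) :
  (forall i, Q.-integrable setT (EFin \o f i)) ->
  Q.-integrable setT (EFin \o (fun t => \sum_(i <- s) f i t)) /\
  \int[Q]_t (\sum_(i <- s) f i t) = \sum_(i <- s) \int[Q]_t f i t.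
Proof.
move=> fi; elim: s => [|i s [IH1 IH2]].
  rewrite big_nil (_ : (fun t => _) = cst 0); last by apply/funext => t; rewrite big_nil.
  by split; [exact: integrable0|rewrite Rintegral_cst // mul0r].
rewrite big_cons (_ : (fun t => _) = (fun t => f i t + \sum_(j <- s) f j t)); last first.
  by apply/funext => t; rewrite big_cons.
by split; [exact: integrable_fadd|rewrite RintegralD // IH2].
Qed.

(** The square of the centred sum is expanded over pairs. Pairwise independence kills the
    off-diagonal terms, and each of the M diagonal terms is at most (2 B)^2, since centring doubles
    the bound. *)
Lemma monte_carlo_variance (M : nat) (Y : 'I_M -> {mfun Th >-> S}) h B (e : R) : (0 < M)%N ->
  (forall i j, i != j -> independent_maps (Y i) (Y j)) ->
  measurable_fun setT h -> (forall x, `|h x| <= B) ->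
  (forall i, \int[Q]_t h (Y i t) = e) ->
  Q.-integrable setT (EFin \o (fun t => (e - M%:R^-1 * \sum_i h (Y i t)) ^+ 2)) /\
  \int[Q]_t ((e - M%:R^-1 * \sum_i h (Y i t)) ^+ 2) <= 4 * B ^+ 2 / M%:R.
Proof.
move=> M0 ind mh hB he.
have M0' : 0 < M%:R :> R by rewrite ltr0n.
have ih i : Q.-integrable setT (EFin \o (fun t => h (Y i t))).
  by apply: (@bounded_integrable _ B) => //; exact: measurableT_comp.
have eB : `|e| <= B.
  rewrite -(he (Ordinal M0)); apply: le_trans (le_normr_Rintegral measurableT (ih _)) _.
  apply: (@le_trans _ _ (\int[Q]_t B)).
    by apply: le_Rintegral => //; [exact: integrable_fnorm|exact: (@bounded_integrable _ `|B|)].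
  by rewrite expectation_cst.
pose g x := h x - e.
have mg : measurable_fun setT g by exact: measurable_funB.
have gB x : `|g x| <= 2 * B.
  by apply: le_trans (ler_normB _ _) _; rewrite mulr_natl mulr2n lerD.
have ig i : Q.-integrable setT (EFin \o (fun t => g (Y i t))).
  by apply: (@bounded_integrable _ (2 * B)) => //; exact: measurableT_comp.
have eg i : \int[Q]_t g (Y i t) = 0.
  rewrite RintegralB //; last exact: (@bounded_integrable _ `|e|).
  by rewrite he expectation_cst subrr.
have B20 : 0 <= 2 * B by apply: le_trans (gB (Y (Ordinal M0) point)); exact: normr_ge0.
have mgg i j : measurable_fun setT (fun t => g (Y i t) * g (Y j t)).
  by apply: measurable_funM; exact: measurableT_comp.
have ggB i j t : `|g (Y i t) * g (Y j t)| <= 4 * B ^+ 2.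
  rewrite normrM (_ : 4 * B ^+ 2 = (2 * B) * (2 * B)); last by ring.
  exact: ler_pM.
have igg i j : Q.-integrable setT (EFin \o (fun t => g (Y i t) * g (Y j t))) by exact: bounded_integrable.
have egg i j : \int[Q]_t (g (Y i t) * g (Y j t)) <= (i == j)%:R * (4 * B ^+ 2).
  have [->|ij] := eqVneq i j.
    rewrite mul1r; apply: (@le_trans _ _ (\int[Q]_t (4 * B ^+ 2))).
      apply: le_Rintegral => //; first exact: (@bounded_integrable _ `|4 * B ^+ 2|).
      by move=> t _; exact: le_trans (ler_norm _) (ggB _ _ _).
    by rewrite expectation_cst.
  by rewrite (expectation_product (ind _ _ ij) mg mg gB gB) !eg !mul0r.
have E t : (e - M%:R^-1 * \sum_i h (Y i t)) ^+ 2 =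
    (M%:R^-1) ^+ 2 * \sum_(p <- index_enum ('I_M * 'I_M)%type) g (Y p.1 t) * g (Y p.2 t).
  have -> : \sum_(p <- index_enum ('I_M * 'I_M)%type) g (Y p.1 t) * g (Y p.2 t) = (\sum_i g (Y i t)) ^+ 2.
    rewrite expr2 mulr_suml; under [RHS]eq_bigr do rewrite mulr_sumr.
    by rewrite pair_big.
  rewrite -exprMn -sqrrN; congr (_ ^+ 2).
  rewrite /g sumrB sumr_const card_ord -[e *+ M]mulr_natl mulrBr mulrA mulVf ?gt_eqF // mul1r.
  by rewrite opprB.
have [iS eS] := Rintegral_finite_sum (index_enum ('I_M * 'I_M)%type) (fun p => igg p.1 p.2).
under eq_fun do rewrite E; split; first exact: (integrable_fscale _ measurableT iS).
rewrite RintegralZl // eS.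
apply: (@le_trans _ _ (M%:R^-1 ^+ 2 * \sum_(p : 'I_M * 'I_M) (p.1 == p.2)%:R * (4 * B ^+ 2))).
  by rewrite ler_wpM2l ?sqr_ge0 //; apply: ler_sum => p _; exact: egg.
rewrite -(pair_big xpredT xpredT (fun i j : 'I_M => (i == j)%:R * (4 * B ^+ 2))) /=.
under eq_bigr => i _.
  rewrite (bigD1 i) //= eqxx mul1r big1 ?addr0; last by move=> j ji; rewrite eq_sym (negbTE ji) mul0r.
  over.
rewrite sumr_const card_ord -[_ *+ M]mulr_natl le_eqVlt; apply/orP; left; apply/eqP.
by field; rewrite gt_eqF.
Qed.

End Independence.

Section NonmeasurableIntegrands.
Context (dT : measure_display) (Th : measurableType dT) (R : realType) (Q : {measure set Th -> \bar R}).

Import HBNNSimple.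

(* [estimator] may fail to be measurable on the null set of samples outside the unit cube. *)
Lemma ae_le_integral_nonmeasurable (f g : Th -> \bar R) : (forall x, 0 <= f x)%E -> (forall x, 0 <= g x)%E ->
  measurable_fun setT g -> {ae Q, forall x, (f x <= g x)%E} -> (\int[Q]_x f x <= \int[Q]_x g x)%E.
Proof.
move=> f0 g0 mg fg; rewrite ge0_integralTE //; apply: ge_ereal_sup => _ [k /= kf <-].
rewrite -integralT_nnsfun; apply: ae_ge0_le_integral => //.
- by move=> x _; rewrite lee_fin.
- exact/measurable_EFinP.
- by apply: filterS fg => x h _; exact: le_trans (kf x) h.
Qed.

End NonmeasurableIntegrands.

(** * Laws of the parameter and of the samples *)

Section UniformProduct.
Context (R : realType) (P : probability (seqR R) R) (hP : is_uniform_product P).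
Implicit Types (w : seqR R) (s j : nat).

Lemma ae_cube : {ae P, forall w, cube w}.
Proof.
pose N j := [set w : seqR R | (~` `[0, 1]%classic) ((w : nat -> R) j)].
have mC : measurable (~` `[0, 1]%classic : set R) by apply: measurableC; exact: measurable_itv.
have mN j : measurable (N j) by exact: measurable_cylinder.
have N0 j : P (N j) = 0%E.
  (* The cylinder formula constrains all coordinates up to j; only the j-th constraint is genuine,
     and it has uniform measure 0. *)
  pose B k : set R := if k == j then ~` `[0, 1]%classic else setT.
  have mB k : measurable (B k) by rewrite /B; case: ifP.
  have := hP j.+1 mB; rewrite (bigD1 (ord_max : 'I_j.+1)) //= {2}/B eqxx.
  rewrite /unif01 setICl measure0 mul0e; move=> <-; congr (P _).
  apply/seteqP; split=> w /=; last by move=> /(_ j (ltnSn j)); rewrite /B eqxx.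
  by move=> h k _; rewrite /B; case: eqP => [->|].
apply: ae_foralln => j; exists (N j); split; [exact: mN|exact: N0|move=> w /= h hj; apply: h].
by move: hj; rewrite /= in_itv.
Qed.

Context (dT : measure_display) (Th : measurableType dT) (Q : probability Th R).

(** The law of a sample and that of the first s coordinates under P agree on rectangles, a pi-system
    generating the tuple sigma-algebra. *)
Lemma iid_uniform_law M s (X : 'I_M -> Th -> s.-tuple R) (i : 'I_M) (A : set (s.-tuple R)) :
  iid_uniform Q X -> measurable A -> Q (X i @^-1` A) = P (truncate s @^-1` A).
Proof.
move=> [mX lawX _] mA.
pose G : set (set (s.-tuple R)) := [set A | exists2 B : 'I_s -> set R, (forall k, measurable (B k)) &
  A = [set x | forall k, B k (tnth x k)]].
have m1 : measurable_fun setT (X i) by exact: mX.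
have m2 := @measurable_truncate R s.
pose Xi : {mfun Th >-> s.-tuple R} := HB.pack (X i) (isMeasurableFun.Build _ _ _ _ _ m1).
pose Ti : {mfun seqR R >-> s.-tuple R} := HB.pack (truncate s) (isMeasurableFun.Build _ _ _ _ _ m2).
have GE : @measurable _ (s.-tuple R) = <<s G >>.
  apply/seteqP; split.
    apply: smallest_sub; first exact: smallest_sigma_algebra.
    move=> A'; rewrite -bigcup_seq => -[k _ [B mB <-]]; apply: sub_sigma_algebra.
    exists (fun k' => if k' == k then B else setT); first by move=> k'; case: ifP.
    rewrite setTI; apply/seteqP; split=> x /=; last by move=> /(_ k); rewrite eqxx.
    by move=> Bx k'; case: eqP => [->|].
  apply: smallest_sub; first exact: sigma_algebra_measurable.
  move=> _ [B mB ->].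
  rewrite (_ : [set x | _] = \bigcap_(k in [set: 'I_s]) (@tnth s R ^~ k @^-1` B k)).
    apply: fin_bigcap_measurable; first exact: finite_finset.
    by move=> k _; rewrite -[X in measurable X]setTI; exact: measurable_tnth.
  by apply/seteqP; split=> x /= h k; [move=> _|have := h k I]; [exact: h|].
have := @measure_unique _ R _ G (fun=> setT) GE _ _ _ (distribution Q Xi) (distribution P Ti).
apply=> //.
- move=> _ _ [B1 mB1 ->] [B2 mB2 ->]; exists (fun k => B1 k `&` B2 k).
    by move=> k; exact: measurableI.
  apply/seteqP; split=> x /=; first by move=> [h1 h2] k; split; [exact: h1|exact: h2].
  by move=> h; split=> k; have [] := h k.
- by move=> _; exists (fun=> setT) => //; apply/seteqP; split.
- by rewrite bigcup_const.
- move=> _ [B mB ->]; transitivity (\prod_(k < s) unif01 (B k))%E; first exact: lawX.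
  change (\prod_(k < s) unif01 (B k) = P (truncate s @^-1` [set x | forall k, B k (tnth x k)]))%E.
  pose B' j := if insub j is Some k then B k else setT.
  have mB' j : measurable (B' j) by rewrite /B'; case: insub.
  rewrite (_ : _ @^-1` _ = [set w | forall j, (j < s)%N -> B' j ((w : nat -> R) j)]).
    by rewrite hP //; apply: eq_bigr => k _; rewrite /B' valK.
  apply/seteqP; split=> w /= h.
    by move=> j js; have := h (Ordinal js); rewrite tnth_mktuple /B' insubT.
  by move=> k; rewrite tnth_mktuple; have := h k (ltn_ord k); rewrite /B' valK.
- by move=> _; apply: le_lt_trans (probability_le1 _ _) (ltry _).
Qed.

Lemma iid_uniform_independent M s (X : 'I_M -> Th -> s.-tuple R) (i j : 'I_M) (A C : set (s.-tuple R)) :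
  iid_uniform Q X -> i != j -> measurable A -> measurable C ->
  (Q (X i @^-1` A `&` X j @^-1` C) = Q (X i @^-1` A) * Q (X j @^-1` C))%E.
Proof.
move=> [mX _ indX] ij mA mC.
(* The joint formula for all M samples reduces to the pair i, j when the other sets are full. *)
pose E k : set (s.-tuple R) := if k == i then A else if k == j then C else setT.
have ji : j != i by rewrite eq_sym.
have mE k : measurable (E k) by rewrite /E; do 2 case: ifP => // _.
have := indX E mE; rewrite (bigD1 i) //= (bigD1 j) //= big1; last first.
  by move=> k /andP[ki kj]; rewrite /E (negbTE ki) (negbTE kj) preimage_setT; exact: probability_setT.
rewrite mule1 /E eqxx (negbTE ji) eqxx => <-; congr (Q _).
apply/seteqP; split=> t /=; last by move=> h; have := h i; have := h j; rewrite !eqxx (negbTE ji).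
by move=> [hA hC] k; case: eqP => [->//|_]; case: eqP => [->|].
Qed.

Context (q : seqR R -> R) (s : nat) (B : R).
Hypotheses (mq : measurable_fun cube q) (qB : forall w, cube w -> `|q w| <= B)
  (q_first : forall w w', cube w -> cube w' -> (forall j, (j < s)%N -> (w : nat -> R) j = (w' : nat -> R) j) -> q w = q w').

(** Nothing is known about q outside the cube, so the squared error is compared with an integrable V
    to which it is equal almost surely. V is built from q cut off outside the cube, which is bounded
    and measurable everywhere. *)
Lemma quadrature_variance M (X : 'I_M -> Th -> s.-tuple R) : (0 < M)%N -> iid_uniform Q X ->
  exists V : Th -> R, [/\ Q.-integrable setT (EFin \o V), \int[Q]_t V t <= 4 * B ^+ 2 / M%:R &
    {ae Q, forall t, (\int[P]_(w in cube) q w - quadrature q (X^~ t)) ^+ 2 = V t}].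
Proof.
move=> M0 iidX; have [mX _ _] := iidX.
pose h (x : s.-tuple R) := (q \_ cube) (extend x).
have mc := @measurable_cube R.
have mqc : measurable_fun setT (q \_ cube) by exact/(measurable_restrictT _ mc).
have mh : measurable_fun setT h by exact: measurableT_comp mqc (@measurable_extend R s).
have cube0 : cube (extend [tuple (0 : R) | i < s]).
  move=> j; have [js|sj] := ltnP j s; last by rewrite /extend nth_default ?size_tuple // lexx ler01.
  by rewrite /extend -(tnth_nth 0 _ (Ordinal js)) tnth_mktuple lexx ler01.
have B0 : 0 <= B by apply: le_trans (qB cube0).
have hB x : `|h x| <= B.
  by rewrite /h patchE; case: ifPn => [|_]; [rewrite inE => /qB|rewrite normr0].
pose Y i : {mfun Th >-> s.-tuple R} := HB.pack (X i) (isMeasurableFun.Build _ _ _ _ _ (mX i)).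
pose Ti : {mfun seqR R >-> s.-tuple R} := HB.pack (@truncate R s) (isMeasurableFun.Build _ _ _ _ _ (@measurable_truncate R s)).
have he i : \int[Q]_t h (Y i t) = \int[P]_(w in cube) q w.
  transitivity (\int[P]_w h (truncate s w)).
    have E1 : (\int[distribution Q (Y i)]_x (h x)%:E = \int[distribution P Ti]_x (h x)%:E)%E.
      by apply: eq_measure_integral => A mA _; exact: (iid_uniform_law i iidX mA).
    have mh' : measurable_fun setT (EFin \o h) by exact/measurable_EFinP.
    have i1 : Q.-integrable setT ((EFin \o h) \o Y i).
      by apply: (@bounded_integrable _ _ _ _ (h \o Y i) B) => [|t]; [exact: measurableT_comp|exact: hB].
    have i2 : P.-integrable setT ((EFin \o h) \o Ti).
      by apply: (@bounded_integrable _ _ _ _ (h \o Ti) B) => [|t]; [exact: measurableT_comp|exact: hB].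
    rewrite /Rintegral; congr fine.
    by rewrite -(integral_distribution mh' i1) -(integral_distribution mh' i2).
  (* Replacing w by its truncation padded with zeros does not change q, which depends on the first s
     coordinates only, and stays in the cube. *)
  rewrite [RHS]Rintegral_mkcond; apply: ae_eq_Rintegral => //.
    exact: measurableT_comp mh (@measurable_truncate R s).
  apply: filterS ae_cube => w cw _; rewrite /h !patchE !mem_set //; last exact: cube_extend_truncate.
  by apply: q_first => //; [exact: cube_extend_truncate|move=> j; exact: extend_truncate].
have ind (i j : 'I_M) : i != j -> independent_maps Q (Y i) (Y j).
  by move=> ij A C mA mC; exact: iid_uniform_independent.
have [iV eV] := monte_carlo_variance M0 ind mh hB he.
exists (fun t => (\int[P]_(w in cube) q w - M%:R^-1 * \sum_i h (Y i t)) ^+ 2); split=> //.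
have aei i : {ae Q, forall t, cube (extend (X i t))}.
  have mA : measurable (~` (@extend R s @^-1` cube)).
    apply: measurableC; rewrite -[X in measurable X]setTI; exact: measurable_extend.
  exists (X i @^-1` (~` (@extend R s @^-1` cube))); split.
  - by rewrite -[X in measurable X]setTI; exact: (mX i measurableT _ mA).
  - rewrite (iid_uniform_law i iidX mA).
    have [N [mN N0 hN]] := ae_cube.
    apply: (subset_measure0 _ mN _ N0).
      by rewrite -[X in measurable X]setTI; exact: measurable_truncate.
    by move=> w /= hw; apply: hN => cw; apply: hw; exact: cube_extend_truncate.
  - by [].
have : {ae Q, forall t, forall i, cube (extend (X i t))} by exact: filter_forall.
apply: filterS => t ht; rewrite /quadrature; congr ((_ - _ * _) ^+ 2).
by apply: eq_bigr => i _; rewrite /h patchE mem_set //; exact: ht.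
Qed.

End UniformProduct.

(** * Cost *)

Section Cost.
Context (R : realType).
Implicit Types (p x y : R) (n : nat).

Lemma simeq_trans (a b c : nat -> R) : simeq a b -> simeq b c -> simeq a c.
Proof.
move=> [k1 [k2 [k10 k20 h]]] [l1 [l2 [l10 l20 h']]].
exists (k1 * l1), (k2 * l2); split; rewrite ?mulr_gt0 // => n.
have /andP[h1 h2] := h n; have /andP[h3 h4] := h' n; apply/andP; split.
  by apply: le_trans h1; rewrite -mulrA ler_wpM2l // ltW.
by apply: (le_trans h2); rewrite -mulrA ler_wpM2l // ltW.
Qed.

Lemma cost_model_simeq (r : R) d : 1 < r -> simeq (cost_model r d) (cost_sum r d).
Proof.
move=> r1; exists 1, 2; split=> // n; apply/andP; split.
  rewrite mul1r; apply: ler_sum => j _; apply: ler_sum => l _; apply: ler_sum => v _.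
  rewrite m_E ler_wpM2l ?mulr_ge0 ?exprn_ge0 //; exact: (s_bounds r v).1.
rewrite mulr_sumr; apply: ler_sum => j _; rewrite mulr_sumr; apply: ler_sum => l _.
rewrite mulr_sumr; apply: ler_sum => v _.
by rewrite m_E mulrCA ler_wpM2l ?mulr_ge0 ?exprn_ge0 //; exact: (s_bounds r v).2.
Qed.

Lemma geometric_sum_le p n : 1 < p -> \sum_(i < n.+1) p ^+ i <= p / (p - 1) * p ^+ n.
Proof.
move=> p1; have p0 : 0 < p - 1 by rewrite subr_gt0.
rewrite mulrAC ler_pdivlMr // mulrC -subrX1 exprS.
by rewrite lerBlDr lerDl.
Qed.

Lemma geometric_series_le p n : 0 <= p < 1 -> \sum_(i < n.+1) p ^+ i <= (1 - p)^-1.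
Proof.
move=> /andP[p0 p1]; have p2 : 0 < 1 - p by rewrite subr_gt0.
rewrite -[leRHS]mul1r ler_pdivlMr // -[1 - p]opprB mulrN mulrC -subrX1 opprB.
by rewrite lerBlDr lerDl exprn_ge0.
Qed.

(** Swaps the outer and inner roles, so that the dominant base can always be put in the innermost
    sum of [triple_sum_le]. *)
Lemma triple_sum_exchange (F : nat -> nat -> nat -> R) n :
  \sum_(j < n.+1) \sum_(l < n.+1) \sum_(v < n.+1 | (j + l + v <= n)%N) F j l v =
  \sum_(j < n.+1) \sum_(l < n.+1) \sum_(v < n.+1 | (j + l + v <= n)%N) F v l j.
Proof.
under eq_bigr do under eq_bigr do rewrite big_mkcond.
under [RHS]eq_bigr do under eq_bigr do rewrite big_mkcond.
rewrite exchange_big [RHS]exchange_big /=; apply: eq_bigr => l _.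
rewrite exchange_big /=; apply: eq_bigr => j _; apply: eq_bigr => v _.
by rewrite (_ : (v + l + j)%N = (j + l + v)%N) //; lia.
Qed.

(** The innermost geometric sum stops at n - j - l and is of order p^(n-j-l). The missing powers of
    p turn x and y into the ratios x/p and y/p, whose sums are bounded when p is the largest
    base. *)
Lemma triple_sum_le p x y n : 1 < p -> 0 <= x -> 0 <= y ->
  \sum_(j < n.+1) \sum_(l < n.+1) \sum_(v < n.+1 | (j + l + v <= n)%N) x ^+ j * y ^+ l * p ^+ v <=
  p / (p - 1) * p ^+ n * ((\sum_(j < n.+1) (x / p) ^+ j) * (\sum_(l < n.+1) (y / p) ^+ l)).
Proof.
move=> p1 x0 y0; have p0 : 0 < p by exact: lt_trans p1.
have p2 : 0 < p - 1 by rewrite subr_gt0.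
have pp : p != 0 by rewrite gt_eqF.
rewrite mulr_suml mulr_sumr; apply: ler_sum => j _.
rewrite mulr_sumr mulr_sumr; apply: ler_sum => l _.
rewrite -mulr_sumr; have xy0 : 0 <= x ^+ j * y ^+ l by rewrite mulr_ge0 ?exprn_ge0.
have [jl|jl] := leqP (j + l) n; last first.
  rewrite big1 ?mulr0; last by move=> v; lia.
  have [xp yp] : 0 <= x / p /\ 0 <= y / p by rewrite !divr_ge0 // ltW.
  have pq : 0 <= p / (p - 1) by rewrite divr_ge0 // ltW.
  by rewrite mulr_ge0 // mulr_ge0 ?exprn_ge0 // ltW.
have -> : \sum_(v < n.+1 | (j + l + v <= n)%N) p ^+ v = \sum_(v < (n - (j + l)).+1) p ^+ v.
  have hn : ((n - (j + l)).+1 <= n.+1)%N by rewrite ltnS leq_subr.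
  rewrite (big_ord_widen _ (fun v => p ^+ v) hn); apply: eq_bigl => v; lia.
apply: (@le_trans _ _ (x ^+ j * y ^+ l * (p / (p - 1) * p ^+ (n - (j + l))))).
  by rewrite ler_wpM2l // geometric_sum_le.
have -> : p ^+ n = p ^+ (n - (j + l)) * (p ^+ j * p ^+ l) by rewrite -!exprD subnK.
rewrite !exprMn !exprVn le_eqVlt; apply/orP; left; apply/eqP.
by field; rewrite !expf_neq0 //= gt_eqF.
Qed.

Lemma gtr1_ltr_powR x : 1 < x -> {homo powR x : a b / a < b}.
Proof.
move=> x1 a b ab; rewrite /powR gt_eqF ?(lt_trans _ x1) //.
by rewrite ltr_expR ltr_pM2r // ln_gt0.
Qed.

(** The three bases are 16, y = 2^d <= 8 and a = 2^(2/(r-1)). The larger of 16 and a dominates; they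
    coincide exactly for r = 3/2, where one geometric sum degenerates to n + 1 equal terms. *)
Lemma cost_sum_bound (r : R) d : 1 < r -> (d < 4)%N -> exists2 C : R, 0 < C & forall n,
  (r <> 3 / 2 -> cost_sum r d n <= C * 2 `^ (Num.max (Num.max 4 d%:R) (2 / (r - 1)) * n%:R)) /\
  (r = 3 / 2 -> cost_sum r d n <= C * n.+1%:R * 2 `^ (4 * n%:R)).
Proof.
move=> r1 d4; have r0 : 0 < r - 1 by rewrite subr_gt0.
pose al := 2 / (r - 1); pose a : R := 2 `^ al; pose y : R := 2 ^+ d.
have al0 : 0 < al by rewrite divr_gt0.
have lt2 : {homo powR 2 : s t / s < t :> R} by apply: gtr1_ltr_powR; rewrite ltr1n.
have a1 : 1 < a by have := lt2 _ _ al0; rewrite powRr0.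
have a0 : 0 < a by exact: lt_trans a1.
have al32 : r = 3 / 2 -> al = 4.
  move=> rE; rewrite /al rE (_ : 3 / 2 - 1 = 2^-1); first by rewrite invrK -natrM.
  by field.
have y0 : 0 <= y by exact: exprn_ge0.
have y16 : y <= 8.
  rewrite (_ : 8 = 2 ^+ 3); last by rewrite -natrX.
  by rewrite ler_eXn2l ?ltr1n.
have p16 k : 2 `^ (4 * k%:R) = 16 ^+ k :> R.
  by rewrite -natrM powR_mulrn // exprM; congr (_ ^+ k); rewrite -natrX.
have d44 : Num.max 4 d%:R = 4 :> R by apply/max_idPl; rewrite ler_nat ltnW.
have E n : cost_sum r d n = \sum_(j < n.+1) \sum_(l < n.+1) \sum_(v < n.+1 | (j + l + v <= n)%N) 16 ^+ j * y ^+ l * a ^+ v.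
  apply: eq_bigr => j _; apply: eq_bigr => l _; apply: eq_bigr => v _.
  rewrite exprM (_ : 2 ^+ 4 = 16 :> R); last by rewrite -natrX.
  by rewrite exprM -(powR_mulrn v (ltW a0)) /a -powRrM /al; congr (_ * _ `^ _); rewrite mulrAC.
have E' n : cost_sum r d n = \sum_(j < n.+1) \sum_(l < n.+1) \sum_(v < n.+1 | (j + l + v <= n)%N) a ^+ j * y ^+ l * 16 ^+ v.
  rewrite E (triple_sum_exchange (fun j l v => 16 ^+ j * y ^+ l * a ^+ v)).
  by do 3 (apply: eq_bigr => ? _); ring.
have geo_y n : \sum_(l < n.+1) (y / 16) ^+ l <= 2.
  apply: le_trans (geometric_series_le _ _) _.
    by rewrite divr_ge0 //= ltr_pdivrMr //; lra.
  by rewrite -[2]invrK lef_pV2 ?posrE ?invr_gt0 //; lra.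
have gy0 n : 0 <= \sum_(l < n.+1) (y / 16) ^+ l by apply: sumr_ge0 => l _; rewrite exprn_ge0 // divr_ge0.
(* The prefactor is 16/15 from the inner sum times 2 from the powers of y / 16, which 4 covers. The
   remaining sum decides between the cases a < 16 and a = 16. *)
have base16 n : cost_sum r d n <= 4 * 16 ^+ n * (\sum_(j < n.+1) (a / 16) ^+ j).
  rewrite E'; apply: le_trans (triple_sum_le _ _ (ltW a0) y0) _; first by rewrite ltr1n.
  have h : 0 <= \sum_(j < n.+1) (a / 16) ^+ j by apply: sumr_ge0 => j _; rewrite exprn_ge0 // divr_ge0 // ltW.
  have h16 : 0 <= 16 ^+ n :> R by exact: exprn_ge0.
  rewrite -!mulrA; have := ler_wpM2l h (geo_y n); have := mulr_ge0 h16 h.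
  move: (\sum_(j < n.+1) (a / 16) ^+ j) h h16 (gy0 n) (\sum_(l < n.+1) (y / 16) ^+ l) => s h h16 _ t hs ht.
  have := ler_wpM2l h16 ht; rewrite (_ : 16 - 1 = 15 :> R); last by ring.
  rewrite [_ * (s * 2)]mulrA; move: (_ * (s * t)) (_ * s) hs => u1 u2; lra.
have [lt|lt|eq] := ltgtP al 4.
- have a16 : a < 16.
    by have := lt2 _ _ lt; rewrite -[4]mulr1 (p16 1%N) expr1.
  have C0 : 0 < 1 - a / 16 by rewrite subr_gt0 ltr_pdivrMr // mul1r.
  exists (4 * (1 - a / 16)^-1); first by rewrite mulr_gt0 ?invr_gt0.
  move=> n; split; last by move=> /al32 e; move: lt; rewrite e ltxx.
  move=> _; rewrite -/al d44 (max_idPl (ltW lt)) p16; apply: le_trans (base16 n) _.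
  rewrite mulrAC ler_wpM2r ?exprn_ge0 // ler_wpM2l //; apply: geometric_series_le.
  by rewrite divr_ge0 ?(ltW a0) //= ltr_pdivrMr // mul1r.
- have a16 : 16 < a.
    by have := lt2 _ _ lt; rewrite -[4]mulr1 (p16 1%N) expr1.
  have ya : 0 <= y / a < 1 by rewrite divr_ge0 ?(ltW a0) //= ltr_pdivrMr // mul1r; lra.
  have xa : 0 <= 16 / a < 1 by rewrite divr_ge0 ?(ltW a0) //= ltr_pdivrMr // mul1r.
  have ca : 0 < a / (a - 1) by rewrite divr_gt0 // subr_gt0.
  have [cy cx] : 0 < 1 - y / a /\ 0 < 1 - 16 / a by split; rewrite subr_gt0; [case/andP: ya|case/andP: xa].
  exists (a / (a - 1) * ((1 - 16 / a)^-1 * (1 - y / a)^-1)); first by rewrite mulr_gt0 // mulr_gt0 ?invr_gt0.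
  move=> n; split; last by move=> /al32 e; move: lt; rewrite e ltxx.
  move=> _; rewrite -/al d44 (max_idPr (ltW lt)) powRrM powR_mulrn ?powR_ge0 // -/a E.
  apply: le_trans (triple_sum_le _ a1 _ y0) _ => //.
  rewrite mulrAC ler_wpM2r ?exprn_ge0 ?(ltW a0) // ler_wpM2l ?(ltW ca) //.
  apply: ler_pM; rewrite ?geometric_series_le //; apply: sumr_ge0 => i _; rewrite exprn_ge0 //.
    by case/andP: xa.
  by case/andP: ya.
- have a16 : a = 16 by rewrite /a eq -[16](p16 1%N) mulr1.
  exists 4 => // n; split.
    have h : 2 = 4 * (r - 1) by rewrite -eq /al divfK // gt_eqF.
    by move=> rn; exfalso; apply: rn; move: h; lra.
  move=> _; rewrite p16; apply: le_trans (base16 n) _.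
  rewrite a16 divff // (eq_bigr (fun=> 1)); last by move=> i _; rewrite expr1n.
  by rewrite sumr_const card_ord mulrAC.
Qed.

End Cost.

(** * Error of the multilevel estimator *)

Section SparseMonteCarlo.
Context (R : realType) (P : probability (seqR R) R) (hP : is_uniform_product P).
Context (r : R) (N : nat) (q : nat -> nat -> seqR R -> R) (g : seqR R -> R) (K : R).
Hypotheses (K0 : 0 <= K) (mq : forall l nu, measurable_fun cube (q l nu)) (mg : measurable_fun cube g)
  (qK : forall l nu w, cube w -> `|q l nu w| <= K * 4 ^- (l + nu))
  (q_first : forall l nu w w', cube w -> cube w' ->
     (forall j, (j < s_ r nu)%N -> (w : nat -> R) j = (w' : nat -> R) j) -> q l nu w = q l nu w')
  (bias : forall w, cube w ->
     `|g w - \sum_(l < N.+1) \sum_(nu < N.+1 | (l + nu <= N)%N) q l nu w| <= K * N.+1%:R * 4 ^- N).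
Context (dT : measure_display) (Th : measurableType dT) (Q : probability Th R) (Y : sample_family r Th N).
Hypothesis iidY : forall l nu, (l + nu <= N)%N -> iid_uniform Q (@Y l nu).

Lemma sum_sqr_le (I : finType) (x : I -> R) : (\sum_i x i) ^+ 2 <= #|I|%:R * \sum_i x i ^+ 2.
Proof.
have S0 : 0 <= \sum_i x i ^+ 2 by apply: sumr_ge0 => i _; exact: sqr_ge0.
have := finite_CS (fun i => normr_ge0 (x i)) (fun _ => ler01).
under eq_bigr do rewrite mulr1.
rewrite [X in _ * Num.sqrt X](_ : _ = #|I|%:R); last first.
  by rewrite (eq_bigr (fun=> 1)) ?sumr_const // => i _; rewrite expr1n.
rewrite [X in Num.sqrt X * _](_ : _ = \sum_i x i ^+ 2); last first.
  by apply: eq_bigr => i _; rewrite real_normK ?num_real.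
rewrite -sqrtrM // => h.
have h1 := le_trans (ler_norm_sum (index_enum I) x xpredT) h.
rewrite mulrC -(sqr_sqrtr (mulr_ge0 S0 (ler0n _ _))) -[leLHS]real_normK ?num_real //.
by rewrite lerXn2r ?nnegrE ?sqrtr_ge0.
Qed.

Let mc := @measurable_cube R.

Let patch_measurable (f : seqR R -> R) : measurable_fun cube f -> measurable_fun setT (f \_ cube).
Proof. by move=> mf; exact/(measurable_restrictT _ mc). Qed.

Let patch_bounded (f : seqR R -> R) (B : R) : 0 <= B -> (forall w, cube w -> `|f w| <= B) ->
  forall w, `|(f \_ cube) w| <= B.
Proof. by move=> B0 fB w; rewrite patchE; case: ifPn => [|_]; [rewrite inE => /fB|rewrite normr0]. Qed.

Local Notation I := ('I_N.+1 * 'I_N.+1)%type.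
Let ok (p : I) := (p.1 + p.2 <= N)%N.
(** The triangular index set is embedded in the full square by zero terms, so that [finite_CS]
    applies to one finite type. *)
Let e (p : I) : R := if ok p then \int[P]_(w in cube) q p.1 p.2 w else 0.
Let b : R := K * N.+1%:R * 4 ^- N.

Let e_bias : `|\int[P]_(w in cube) g w - \sum_p e p| <= b.
Proof.
have q40 n : 0 <= 4 ^- n :> R by rewrite invr_ge0 exprn_ge0.
have b0 : 0 <= b by rewrite !mulr_ge0.
pose f (p : I) w := if ok p then (q p.1 p.2 \_ cube) w else 0.
have fi (p : I) : P.-integrable setT (EFin \o f p).
  rewrite /f; case: (ok p); last exact: integrable0.
  by apply: bounded_integrable (patch_measurable (mq _ _)) (patch_bounded _ (qK p.1 p.2)); rewrite mulr_ge0.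
have [fS eS] := Rintegral_finite_sum (index_enum I) fi.
have eE : \sum_p e p = \int[P]_w \sum_p f p w.
  rewrite eS; apply: eq_bigr => p _; rewrite /e /f; case: (ok p); first by rewrite Rintegral_mkcond.
  by rewrite expectation_cst.
have fE w : cube w -> \sum_p f p w = \sum_(l < N.+1) \sum_(nu < N.+1 | (l + nu <= N)%N) q l nu w.
  move=> cw; under [RHS]eq_bigr do rewrite big_mkcond.
  by rewrite pair_big; apply: eq_bigr => p _; rewrite /f patchE mem_set.
have gb w : `|(g \_ cube) w - \sum_p f p w| <= b.
  rewrite patchE; case: ifPn => [|nw]; first by rewrite inE => cw; rewrite fE //; exact: bias.
  by rewrite big1 ?subrr ?normr0 // => p _; rewrite /f patchE (negbTE nw); case: (ok p).
have mS : measurable_fun setT (fun w => \sum_p f p w) by apply/measurable_EFinP; exact: measurable_int fS.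
have id : P.-integrable setT (EFin \o (fun w => (g \_ cube) w - \sum_p f p w)).
  by apply: bounded_integrable gb; apply: measurable_funB => //; exact: patch_measurable.
(* No bound on g itself is given: it is integrable as a bounded difference plus a finite sum of
   bounded terms. *)
have gi : P.-integrable setT (EFin \o (g \_ cube)).
  have := integrable_fadd measurableT id fS; apply: eq_integrable => // w _.
  by rewrite /= subrK.
rewrite eE Rintegral_mkcond -RintegralB //.
apply: le_trans (le_normr_Rintegral measurableT id) _.
rewrite -[leRHS](expectation_cst P); apply: le_Rintegral => //.
- exact: integrable_fnorm.
- by apply: (@bounded_integrable _ _ _ _ _ `|b|) => //; exact: measurable_cst.
Qed.

Let v : R := 4 * K ^+ 2 * 16 ^- N.

Let level_variance (p : I) : exists V : Th -> R, [/\ Q.-integrable setT (EFin \o V), \int[Q]_t V t <= v,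
  (forall t, 0 <= V t) &
  {ae Q, forall t, (e p - (if ok p then quadrature (q p.1 p.2) (fun i => @Y p.1 p.2 i t) else 0)) ^+ 2 = V t}].
Proof.
have v0 : 0 <= v by rewrite /v mulr_ge0 ?invr_ge0 ?exprn_ge0 // mulr_ge0 // sqr_ge0.
rewrite /e; case: (boolP (ok p)) => [okp|_]; last first.
  exists (fun=> 0); split=> //; first exact: integrable0.
    by rewrite expectation_cst.
  by apply/aeW => t; rewrite subr0 expr0n.
have M0 : (0 < 2 ^ m_ R (N - p.1 - p.2))%N by rewrite expn_gt0.
have [V [iV eV aeV]] := quadrature_variance hP (mq p.1 p.2) (qK p.1 p.2) (@q_first p.1 p.2) M0 (iidY okp).
have vE : 4 * (K * 4 ^- (p.1 + p.2)) ^+ 2 / (2 ^ m_ R (N - p.1 - p.2))%:R = v.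
  rewrite m_E natrX exprM (_ : 2%:R ^+ 4 = 16 :> R); last by rewrite -natrX.
  rewrite exprMn exprVn -exprM mulnC exprM (_ : 4 ^+ 2 = 16 :> R); last by rewrite -natrX.
  have -> : 16 ^- (N - p.1 - p.2) = (16 ^- (N - (p.1 + p.2)) : R) by rewrite subnDA.
  have -> : v = 4 * K ^+ 2 * (16 ^- (p.1 + p.2) * 16 ^- (N - (p.1 + p.2))).
    by rewrite /v -invfM -exprD subnKC.
  by move: (16 ^- (p.1 + p.2)) (16 ^- (N - (p.1 + p.2))) => x y; ring.
(* V is a square only almost surely; the absolute value makes it nonnegative everywhere. *)
exists (fun t => `|V t|); split=> //; first exact: integrable_fnorm.
  rewrite -vE; apply: le_trans eV; rewrite le_eqVlt; apply/orP; left; apply/eqP.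
  have mV : measurable_fun setT V by apply/measurable_EFinP; exact: measurable_int iV.
  apply: ae_eq_Rintegral => //; first exact: measurableT_comp.
  by apply: filterS aeV => t <- _; rewrite ger0_norm ?sqr_ge0.
by apply: filterS aeV => t <-; rewrite ger0_norm ?sqr_ge0.
Qed.

Lemma sparse_monte_carlo_error :
  ('E_Q[fun t => (`|\int[P]_(w in cube) g w - estimator q Y t| ^+ 2)%R] `^ 2^-1
   <= (4 * K * N.+1%:R ^+ 2 * 4 ^- N)%:E)%E.
Proof.
have [V hV] := choice level_variance.
have iV p : Q.-integrable setT (EFin \o V p) by case: (hV p).
have n1 : 1 <= N.+1%:R :> R by rewrite ler1n.
set T := 4 * K * N.+1%:R ^+ 2 * 4 ^- N.
have T0 : 0 <= T by rewrite mulr_ge0 ?invr_ge0 ?exprn_ge0 // mulr_ge0 ?exprn_ge0 // mulr_ge0.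
have [iS eS] := Rintegral_finite_sum (index_enum I) iV.
pose n2 : R := (N.+1 * N.+1)%:R.
(* The error is bias plus sampling error: (x + y)^2 <= 2 x^2 + 2 y^2, and Cauchy-Schwarz over the
   (N+1)^2 index pairs. W is measurable, whereas the error need not be. *)
pose W t := 2 * b ^+ 2 + 2 * n2 * \sum_p V p t.
have iW : Q.-integrable setT (EFin \o W).
  apply: integrable_fadd => //; last exact: integrable_fscale.
  by apply: (@bounded_integrable _ _ _ _ _ `|2 * b ^+ 2|) => //; exact: measurable_cst.
(* In units of K^2 16^(-N), the bias gives 2 (N+1)^2 and the sampling 8 (N+1)^4. The sum is at most
   16 (N+1)^4, whence the factor 4 in T. *)
have eW : \int[Q]_t W t <= T ^+ 2.
  rewrite RintegralD //; last 2 first.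
  - by apply: (@bounded_integrable _ _ _ _ _ `|2 * b ^+ 2|) => //; exact: measurable_cst.
  - exact: integrable_fscale.
  rewrite expectation_cst RintegralZl // eS.
  have hS : \sum_p \int[Q]_t V p t <= n2 * v.
    apply: (@le_trans _ _ (\sum_(p : I) v)); first by apply: ler_sum => p _; case: (hV p).
    by rewrite sumr_const card_prod card_ord mulr_natl.
  have n20 : 0 <= 2 * n2 by rewrite mulr_ge0.
  apply: le_trans (lerD (lexx _) (ler_wpM2l n20 hS)) _.
  have x0 : 0 <= 16 ^- N :> R by rewrite invr_ge0 exprn_ge0.
  have x2 : (4 ^- N) ^+ 2 = 16 ^- N :> R.
    by rewrite exprVn -exprM mulnC exprM; congr (_ ^+ N)^-1; rewrite -natrX.
  have -> : T ^+ 2 = 16 * (K ^+ 2 * 16 ^- N) * N.+1%:R ^+ 4.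
    by rewrite /T !exprMn x2; ring.
  rewrite /b /v /n2 natrM !exprMn x2.
  have k0 : 0 <= K ^+ 2 * 16 ^- N by rewrite mulr_ge0 // sqr_ge0.
  have n24 : N.+1%:R ^+ 2 <= N.+1%:R ^+ 4 :> R by rewrite ler_weXn2l.
  have := ler_wpM2l k0 n24; have := mulr_ge0 k0 (exprn_ge0 4 (le_trans ler01 n1)).
  move: (16 ^- N : R) (N.+1%:R : R) => x y.
  rewrite [X in _ -> _ -> X <= _](_ : _ = 2 * (K ^+ 2 * x * y ^+ 2) + 8 * (K ^+ 2 * x * y ^+ 4)); last by ring.
  rewrite -[16 * _ * _]mulrA.
  by move: (K ^+ 2 * x * y ^+ 2) (K ^+ 2 * x * y ^+ 4) => z1 z2; lra.
have aeW' : {ae Q, forall t, `|\int[P]_(w in cube) g w - estimator q Y t| ^+ 2 <= W t}.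
  have : {ae Q, forall t, forall p,
      (e p - (if ok p then quadrature (q p.1 p.2) (fun i => @Y p.1 p.2 i t) else 0)) ^+ 2 = V p t}.
    by apply: filter_forall => p; case: (hV p).
  apply: filterS => t ht; rewrite real_normK ?num_real //.
  set c := fun p : I => e p - (if ok p then quadrature (q p.1 p.2) (fun i => @Y p.1 p.2 i t) else 0).
  have -> : \int[P]_(w in cube) g w - estimator q Y t = (\int[P]_(w in cube) g w - \sum_p e p) + \sum_p c p.
    rewrite /c sumrB addrA subrK; congr (_ - _); rewrite /estimator.
    by under eq_bigr do rewrite big_mkcond; rewrite pair_big.
  have hc : (\sum_p c p) ^+ 2 <= n2 * \sum_p V p t.
    apply: le_trans (sum_sqr_le c) _; rewrite card_prod card_ord.
    by rewrite ler_wpM2l //; apply: ler_sum => p _; rewrite /c ht.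
  have hb : (\int[P]_(w in cube) g w - \sum_p e p) ^+ 2 <= b ^+ 2.
    by rewrite -[leLHS]real_normK ?num_real // lerXn2r ?nnegrE // (le_trans _ e_bias).
  rewrite /W -[2 * n2 * _]mulrA; move: hb hc.
  move: (\int[P]_(w in cube) g w - \sum_p e p) (\sum_p c p) => x y hb hc.
  by have := sqr_ge0 (x - y); rewrite sqrrB sqrrD; lra.
have W0 t : 0 <= W t.
  rewrite addr_ge0 ?mulr_ge0 ?sqr_ge0 //; apply: sumr_ge0 => p _; by case: (hV p).
have E1 : ('E_Q[fun t => (`|\int[P]_(w in cube) g w - estimator q Y t| ^+ 2)%R] <= (T ^+ 2)%:E)%E.
  rewrite unlock; apply: (@le_trans _ _ (\int[Q]_t (W t)%:E)%E).
    apply: ae_le_integral_nonmeasurable.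
    - by move=> t; rewrite lee_fin exprn_ge0.
    - by move=> t; rewrite lee_fin.
    - exact: measurable_int iW.
    - by apply: filterS aeW' => t h; rewrite lee_fin.
  by rewrite -[leLHS]fineK ?integrable_fin_num // lee_fin.
have E0 : (0 <= 'E_Q[fun t => (`|\int[P]_(w in cube) g w - estimator q Y t| ^+ 2)%R])%E.
  by rewrite unlock; apply: integral_ge0 => t _; rewrite lee_fin exprn_ge0.
have := @gt0_ler_poweR R 2^-1 _ _ _ _ _ E1.
rewrite poweR_EFin powR12_sqrt ?exprn_ge0 // sqrtr_sqr ger0_norm //; apply.
- by rewrite invr_ge0.
- by rewrite in_itv /= E0 leey.
- by rewrite in_itv /= leey andbT lee_fin exprn_ge0.
Qed.

End SparseMonteCarlo.

(** * Measurability and finite-dimensional dependence of the double differences *)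

Section ParametricQuantities.
Context (R : realType) (r : R) (r1 : 1 < r) (psi : nat -> R -> R)
  (mpsi : forall j, measurable_fun (`[0, 1]%classic : set R) (psi j)).
Context (U : seqR R -> nat -> nat -> R) (c : nat -> R) (c0 : forall j, 0 <= c j).
Implicit Types (w : seqR R).
Hypothesis U_lipschitz : forall nu l w w', cube w -> cube w' ->
  `|U w nu l - U w' nu l| <= \sum_(0 <= j < s_ r nu)
     c j * `|psi j ((w : nat -> R) j) - psi j ((w' : nat -> R) j)|.

Lemma double_diff_measurable l nu : measurable_fun cube (fun w => double_diff (U w) l nu).
Proof.
have mU nu' l' : measurable_fun cube (fun w => U w nu' l').
  by apply: (measurable_separable_lipschitz c0 mpsi) => w w'; exact: U_lipschitz.
have mB n : measurable_fun cube (fun w => backward_diff (U w n) l).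
  by case: l => [|l]; rewrite /backward_diff; apply: measurable_funB => //; exact: measurable_cst.
by case: nu => [|nu]; rewrite /double_diff {1}/backward_diff; apply: measurable_funB => //; exact: measurable_cst.
Qed.

(** If the relevant coordinates agree, the Lipschitz bound is 0. Level nu - 1 is covered because
    [s_] is monotone. *)
Lemma double_diff_first l nu w w' : cube w -> cube w' ->
  (forall j, (j < s_ r nu)%N -> (w : nat -> R) j = (w' : nat -> R) j) ->
  double_diff (U w) l nu = double_diff (U w') l nu.
Proof.
move=> cw cw' ww'.
have E n l' : (s_ r n <= s_ r nu)%N -> U w n l' = U w' n l'.
  move=> nn; apply/eqP; rewrite -subr_eq0 -normr_le0; apply: le_trans (U_lipschitz _ _ cw cw') _.
  rewrite big_nat big1 // => j /andP[_ jn].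
  by rewrite (ww' j (leq_trans jn nn)) subrr normr0 mulr0.
have EB n : (s_ r n <= s_ r nu)%N -> backward_diff (U w n) l = backward_diff (U w' n) l.
  by move=> nn; case: l => [|l]; rewrite /backward_diff !E.
rewrite /double_diff; case: nu ww' E EB => [|nu] ww' E EB; rewrite /backward_diff -!/(backward_diff _ _) EB //.
by rewrite EB // s_mono.
Qed.

End ParametricQuantities.

(** Since n + 1 <= 2^n, half of the decay absorbs the linear factor. *)
Lemma cvg_linear_geometric (R : realType) (K : R) :
  (fun n => K * n.+1%:R * 4 ^- n) @ \oo --> (0 : R).
Proof.
have h : (fun n => `|K| * 2^-1 ^+ n : R) @ \oo --> (0 : R).
  rewrite -[X in _ --> X](mulr0 `|K|); apply: cvgMl_tmp.
  by apply: cvg_expr; rewrite ger0_norm ?invr_ge0 // invf_lt1 // ltr1n.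
apply/cvgr0Pnorm_le => e e0; move/cvgr0Pnorm_le : h => /(_ e e0); apply: filterS => n.
apply: le_trans; rewrite !normrM normr_id -mulrA ler_wpM2l // !ger0_norm ?invr_ge0 ?exprn_ge0 ?invr_ge0 //.
rewrite exprVn ler_pdivrMr ?exprn_gt0 // (_ : 4 = 2 * 2 :> R); last by rewrite -natrM.
rewrite exprMn mulrA mulVf ?mul1r ?expf_neq0 ?pnatr_eq0 // -natrX ler_nat.
exact: ltn_expl.
Qed.

Lemma bounded_set_obox (R : realType) d (D : set 'rV[R]_d) : bounded_set D ->
  exists2 N : R, 0 < N & D `<=` obox (const_mx (- N)) (const_mx N).
Proof.
move=> [M [_ hM]]; pose N := `|M| + 1.
have N0 : 0 < N by rewrite ltr_wpDl.
have MN : M < N by rewrite (le_lt_trans (ler_norm _)) // ltrDl.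
exists (N + 1); first by rewrite ltr_wpDl // ltW.
move=> x Dx i; rewrite !mxE.
have := hM N MN x Dx => /= hx.
have : ball (0 : 'rV[R]_d) (N + 1) x.
  by rewrite -ball_normE /= sub0r normrN (le_lt_trans hx) // ltrDl.
rewrite ball_rVE; last by rewrite ltr_wpDl // ltW.
by move=> /(_ i); rewrite !mxE sub0r add0r.
Qed.

(** * Assembly of the error and cost bounds *)

Theorem mainTheorem1
  (R : realType) (d : nat) (hd : d = 2%N \/ d = 3%N)
  (mu : {measure set 'rV[R]_d -> \bar R}) (hmu : is_lebesgue mu)
  (D : set 'rV[R]_d) (hD : lipschitz_domain D)
  (* random coefficient *)
  (P : probability (seqR R) R) (hP : is_uniform_product P)
  (r : R) (hr : 1 < r)
  (phi : nat -> 'rV[R]_d -> R) (hphi : forall j, in_W1inf mu D (phi j))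
  (Cpsi : R) (hCpsi : 0 < Cpsi)
  (psi : nat -> R -> R)
  (hpsi_meas : forall j, measurable_fun (`[0, 1]%classic : set R) (psi j))
  (hpsi : forall j t, 0 <= t <= 1 -> `|psi j t| <= Cpsi)
  (A := coef psi phi (s_ r))
  (hseries_abs : forall w, cube w ->
     (\sum_(0 <= j <oo)
        W1infnorm mu D (fun x => psi j ((w : nat -> R) j) * phi j.+1 x)%R
      < +oo)%E)
  (hseries : forall w, cube w -> in_W1inf mu D (A None w) /\
     W1infnorm mu D (A None w \- coef_trunc psi phi n w) @[n --> \oo]
       --> (0 : \bar R)%E)
  (hAlim :
     ess_sup P (fun w => W1infnorm mu D (A None w \- A (Some nu) w))
       @[nu --> \oo] --> (0 : \bar R)%E)
  (Amin Amax : R) (hAmin : 0 < Amin <= 1)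
  (hAbounds : forall nu w, cube w ->
     {ae mu, forall x, D x -> Amin <= A nu w x <= Amax})
  (hcoercive : forall nu w v, cube w -> in_H10 mu D v ->
     Amin * H1norm mu D v ^+ 2 <= bform mu D (A nu w) v v)
  (hbounded : forall nu w u v, cube w -> in_H10 mu D u -> in_H10 mu D v ->
     `|bform mu D (A nu w) u v| <= Amax * H1norm mu D u * H1norm mu D v)
  (* H^2-regularity *)
  (Creg : R)
  (hreg : forall nu w f, cube w -> in_L2 mu D f ->
     exists u, [/\ solves mu D (A nu w) f (in_H10 mu D) u, in_H2 mu D u &
       ((H2norm mu D u)%:E <= (Creg * Amin ^- 2)%:E
          * (1 + W1infnorm mu D (A nu w)) * (L2norm mu D f)%:E)%E])
  (* finite elements *)
  (T : nat -> mesh R d) (p : nat) (X : nat -> set ('rV[R]_d -> R))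
  (h : nat -> R) (Cunif Capprox : R)
  (hT : forall l, triangulation D (T l))
  (hTnested : forall l, refines (T l.+1) (T l))
  (hX : forall l, fe_space mu D (T l) p (X l))
  (hXnested : forall l, X l `<=` X l.+1)
  (hh_pos : forall l, 0 < h l)
  (hh_mono : forall l, h l.+1 <= h l)
  (hh_lim : h n @[n --> \oo] --> (0 : R))
  (hCunif : 0 < Cunif) (hh_unif : forall l, Cunif * h l <= h l.+1)
  (happrox : forall l w, in_H2 mu D w -> in_H10 mu D w ->
     inf [set H1norm mu D (w \- v) | v in X l]
       <= Capprox * h l * H2norm mu D w)
  (* assumptions of the theorem *)
  (CKL : R)
  (hKL : forall j,
     (W1infnorm mu D (phi j.+1) <= (CKL * j.+1%:R `^ (- r))%:E)%E)
  (hh_rate : simeq h (fun l => 2 ^- l))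
  (hT_rate : simeq (fun l => (ncells (T l))%:R) (fun l => 2 ^+ (d * l) : R))
  (cost : nat -> R) (hcost : simeq cost (cost_model r d)) :
  exists2 C : R, 0 < C &
    (forall (f g : 'rV[R]_d -> R)
        (uh : nat -> nat -> seqR R -> 'rV[R]_d -> R)
        (u : seqR R -> 'rV[R]_d -> R),
        in_L2 mu D f -> in_L2 mu D g ->
        (forall nu l w, cube w ->
           solves mu D (A (Some nu) w) f (X l) (uh nu l w)) ->
        (forall w, cube w -> solves mu D (A None w) f (in_H10 mu D) (u w)) ->
      forall (N : nat) (dT : measure_display) (Th : measurableType dT)
        (PMC : probability Th R) (Y : sample_family r Th N),
        (forall l nu, (l + nu <= N)%N -> iid_uniform PMC (Y l nu)) ->
      let G v := L2dot mu D g v in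
      let GDD l nu (w : seqR R) :=
        G (double_diff (fun nu' l' => uh nu' l' w) l nu) in
      let EGu := \int[P]_(w in cube) G (u w) in
      let EN := ('E_PMC[fun t => (`|EGu - estimator GDD Y t| ^+ 2)%R] `^ 2^-1)%E in
      (EN <= (C * N.+1%:R ^+ 2 * 2 ^- (2 * N)
              * L2norm mu D f * L2norm mu D g)%:E)%E)
    /\ simeq cost (cost_sum r d)
    /\ forall N : nat,
        (r <> 3 / 2 ->
           cost_sum r d N
           <= C * 2 `^ (Num.max (Num.max 4 d%:R) (2 / (r - 1)) * N%:R))
        /\ (r = 3 / 2 -> cost_sum r d N <= C * N.+1%:R * 2 `^ (4 * N%:R)).
Proof.
have [oD _ _ bndD _] := hD; have bD := bounded_set_obox bndD.
have mD : measurable D := open_measurable_rV oD.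
have d4 : (d < 4)%N by case: hd => ->.
have Amin0 : 0 < Amin by case/andP: hAmin.
have Amin1 : Amin <= 1 by case/andP: hAmin.
have Cpsi0 := ltW hCpsi.
have XH l : X l `<=` in_H10 mu D by case: (hX l).
have X0 l : X l (fun=> 0) by case: (hX l).
have Xlin l (k : R) v w : X l v -> X l w -> X l (fun x => k * v x + w x).
  by case: (hX l) => _ _ + _; exact.
have [Ch h_rate] : exists Ch : R, forall l, h l <= Ch * 2 ^- l.
  by have [c1 [c2 [_ _ hc]]] := hh_rate; exists c2 => l; case/andP: (hc l).
have [K K0 hK] := quantity_bounds hmu oD bD hr Cpsi0 hphi hpsi hKL hseries Amin0 Amin1
  hcoercive hbounded hreg XH X0 Xlin hh_pos h_rate happrox.
have [Cc Cc0 hCc] := cost_sum_bound hr d4.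
exists (4 * K + Cc); first by rewrite addr_gt0 // mulr_gt0.
have K4 : 0 <= 4 * K by rewrite mulr_ge0 // ltW.
split; last split; last 2 first.
- exact: simeq_trans hcost (cost_model_simeq d hr).
- move=> N; have [c1 c2] := hCc N; split=> rr.
    by apply: le_trans (c1 rr) _; rewrite ler_wpM2r ?powR_ge0 // lerDr.
  by apply: le_trans (c2 rr) _; rewrite ler_wpM2r ?powR_ge0 // ler_wpM2r // lerDr.
move=> f g uh u Lf Lg suh su N dT Th PMC Y iidY /=.
set nfg := L2norm mu D f * L2norm mu D g.
have nfg0 : 0 <= nfg by rewrite mulr_ge0 ?L2norm_ge0.
pose U (w : seqR R) nu l := L2dot mu D g (uh nu l w).
pose q l nu (w : seqR R) := L2dot mu D g (double_diff (fun nu' l' => uh nu' l' w) l nu).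
(* The families [uh] and [u] are arbitrary outside the cube, so this and the following facts are
   confined to it. *)
have qE l nu w : cube w -> q l nu w = double_diff (U w) l nu.
  move=> cw; apply: (L2dot_double_diff oD Lg) => l' nu'.
  by have [/XH/H10_H1/H1_L2] := suh nu' l' w cw.
pose c j := Amin ^- 2 * nfg * KL_weight r CKL j.
have c0 j : 0 <= c j by rewrite mulr_ge0 ?KL_weight_ge0 // mulr_ge0 // invr_ge0 sqr_ge0.
have lip nu l w w' : cube w -> cube w' -> `|U w nu l - U w' nu l| <= \sum_(0 <= j < s_ r nu)
    c j * `|psi j ((w : nat -> R) j) - psi j ((w' : nat -> R) j)|.
  move=> cw cw'; apply: le_trans (quantity_lipschitz hmu oD bD hr Cpsi0 hphi hpsi hKL hseries Amin0
    hcoercive hbounded hreg XH Xlin Lf Lg suh nu l cw cw') _.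
  rewrite mulrAC mulr_sumr le_eqVlt; apply/orP; left; apply/eqP.
  by apply: eq_bigr => j _; rewrite /c mulrA mulrAC.
have mq l nu : measurable_fun cube (q l nu).
  apply: (@eq_measurable_fun _ _ _ _ _ (fun w => double_diff (U w) l nu)).
    by move=> w; rewrite inE => cw; rewrite qE.
  exact: (double_diff_measurable hpsi_meas c0 lip).
have q_first l nu w w' : cube w -> cube w' ->
    (forall j, (j < s_ r nu)%N -> (w : nat -> R) j = (w' : nat -> R) j) -> q l nu w = q l nu w'.
  by move=> cw cw' ww'; rewrite !qE //; exact: (double_diff_first hr lip).
have hq w (cw : cube w) := hK f g uh u Lf Lg suh su w cw.
(* On the cube G(u) is the pointwise limit of the sparse sums as N grows, by the bias bound; each
   sum is measurable. *)
have mg : measurable_fun cube (fun w => L2dot mu D g (u w)).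
  apply: (@measurable_fun_cvg _ _ _ _ (fun n w => \sum_(l < n.+1) \sum_(nu < n.+1 | (l + nu <= n)%N) q l nu w)).
    move=> n; apply: measurable_sum => l.
    rewrite (_ : (fun w => _) = fun w => \sum_(nu < n.+1) if (l + nu <= n)%N then q l nu w else 0); last first.
      by apply/funext => w; rewrite big_mkcond.
    by apply: measurable_sum => nu; case: (l + nu <= n)%N.
  move=> w cw; have [_ b2] := hq w cw.
  apply/cvgrPdist_le => e e0.
  have := @cvg_linear_geometric R (K * nfg); move/cvgr0Pnorm_le => /(_ e e0).
  apply: filterS => n hn; apply: le_trans (b2 n) _; apply: le_trans hn.
  by apply: le_trans (ler_norm _); rewrite le_eqVlt; apply/orP; left; apply/eqP; rewrite /nfg; ring.
have K'0 : 0 <= K * nfg by rewrite mulr_ge0 // ltW.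
apply: le_trans (sparse_monte_carlo_error hP K'0 mq mg _ q_first _ iidY) _.
- move=> l nu w cw; have [b1 _] := hq w cw; apply: le_trans (b1 l nu) _.
  by rewrite le_eqVlt; apply/orP; left; apply/eqP; rewrite /nfg; ring.
- move=> w cw; have [_ b2] := hq w cw; apply: le_trans (b2 N) _.
  by rewrite le_eqVlt; apply/orP; left; apply/eqP; rewrite /nfg; ring.
rewrite lee_fin exprM (_ : 2 ^+ 2 = 4 :> R); last by rewrite -natrX.
have x0 : 0 <= N.+1%:R ^+ 2 * 4 ^- N :> R by rewrite mulr_ge0 ?invr_ge0 ?exprn_ge0.
have := mulr_ge0 (mulr_ge0 (ltW Cc0) x0) nfg0; rewrite /nfg.
rewrite -subr_ge0 => h1; rewrite -subr_ge0; apply: le_trans h1 _.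
by rewrite le_eqVlt; apply/orP; left; apply/eqP; ring.
Qed.
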